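(* Let $f\in L^2(\mathbb{R}^2,\mathbb{H})$ be a quaternion-valued function such that $D^{M_1M_2}_{t_1^mt_2^n}f\in L^2(\mathbb{R}^2,\mathbb{H})$ for $(m,n)\in\{(1,0),(0,1)\}$. Then $$\prod_{k=1}^{2}\big(\Delta^{\mathbb{H}}_{t_k}\Delta^{\mathbb{H}}_{u_k}\big)^2\ \ge\ \prod_{k=1}^{2}\left|\frac{b_k}{2}\right|^2\|f\|_2^4,$$ where, for $k=1,2$, $\Delta^{\mathbb{H}}_{t_k}=\|t_kf(t)\|_2$ and $\Delta^{\mathbb{H}}_{u_k}=\|u_k\,\mathcal{O}^{\mathbb{H}}_{M_1M_2}f(u)\|_2$, and the factor $\|f\|_2^4$ is inside the product.
   Context: $\mathbb{H}$ denotes the real quaternions with imaginary units $i,j,k$ and modulus $|\cdot|$; $L^2(\mathbb{R}^2,\mathbb{H})$ is the space of measurable $f:\mathbb{R}^2\to\mathbb{H}$ with $\|f\|_2=(\int_{\mathbb{R}^2}|f|^2)^{1/2}<\infty$. For $r=1,2$ let $M_r=(a_r,b_r,c_r,d_r,\tau_r,\eta_r)$ be real parameters with $a_rd_r-b_rc_r=1$ and $b_r\neq0$. The two-sided quaternion offset linear canonical transform (QOLCT) of $f\in L^1(\mathbb{R}^2,\mathbb{H})$ is $$(\mathcal{O}^{\mathbb{H}}_{M_1M_2}f)(u)=\int_{\mathbb{R}^2}\mathcal{K}^{i}_{M_1}(u_1,t_1)\,f(t)\,\mathcal{K}^{j}_{M_2}(u_2,t_2)\,dt,$$ $$\mathcal{K}^{i}_{M_1}(u_1,t_1)=\sqrt{\tfrac{1}{2\pi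 i b_1}}\,\exp\!\Big(\tfrac{i}{2b_1}\big(a_1t_1^2+2t_1(\tau_1-u_1)-2u_1(d_1\tau_1-b_1\eta_1)+d_1u_1^2+d_1\tau_1^2\big)\Big),$$ $$\mathcal{K}^{j}_{M_2}(u_2,t_2)=\sqrt{\tfrac{1}{2\pi j b_2}}\,\exp\!\Big(\tfrac{j}{2b_2}\big(a_2t_2^2+2t_2(\tau_2-u_2)-2u_2(d_2\tau_2-b_2\eta_2)+d_2u_2^2+d_2\tau_2^2\big)\Big),$$ where the square roots are principal square roots in $\mathbb{R}+i\mathbb{R}$ and $\mathbb{R}+j\mathbb{R}$ respectively; the transform is extended to $L^2(\mathbb{R}^2,\mathbb{H})$ by density as usual. The differential operators are $$D^{M_1M_2}_{t_1^1t_2^0}f=-\Big(\frac{\partial}{\partial t_1}+\frac{i}{b_1}(a_1t_1+\tau_1)\Big)f,\qquad D^{M_1M_2}_{t_1^0t_2^1}f=-\Big(\frac{\partial}{\partial t_2}+\frac{i}{b_2}(a_2t_2+\tau_2)\Big)f,$$ with $i$ acting by left multiplication. *)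

(* Defs.v *)
From HB Require Import structures.
From mathcomp Require Import all_boot all_order all_algebra.
From mathcomp Require Import all_classical all_reals all_analysis.
From mathcomp.real_closed Require Import complex.
From mathcomp Require Import ring.
Set Implicit Arguments.
Unset Strict Implicit.
Unset Printing Implicit Defensive.
Import Order.TTheory GRing.Theory Num.Theory.
Import numFieldNormedType.Exports.
Local Open Scope classical_set_scope.
Local Open Scope ring_scope.

Record quat (R : Type) : Type := Quat { q0 : R; qi : R; qj : R; qk : R }.

Section QuatChoice.
Variable R : Type.
Definition seq_of_quat (x : quat R) := [:: q0 x; qi x; qj x; qk x].
Definition quat_of_seq (s : seq R) :=
  if s is [:: a; b; c; d] then Some (Quat a b c d) else None.
Lemma seq_of_quatK : pcancel seq_of_quat quat_of_seq.
Proof. by case. Qed.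
End QuatChoice.

HB.instance Definition _ (R : eqType) := Equality.copy (quat R)
  (pcan_type (@seq_of_quatK R)).
HB.instance Definition _ (R : choiceType) := Choice.copy (quat R)
  (pcan_type (@seq_of_quatK R)).

Section QuatRing.
Variable R : comNzRingType.
Implicit Types (x y z : quat R) (r s : R).

Definition addq x y :=
  Quat (q0 x + q0 y) (qi x + qi y) (qj x + qj y) (qk x + qk y).
Definition oppq x := Quat (- q0 x) (- qi x) (- qj x) (- qk x).
Definition mulq x y := Quat
  (q0 x * q0 y - qi x * qi y - qj x * qj y - qk x * qk y)
  (q0 x * qi y + qi x * q0 y + qj x * qk y - qk x * qj y)
  (q0 x * qj y - qi x * qk y + qj x * q0 y + qk x * qi y)
  (q0 x * qk y + qi x * qj y - qj x * qi y + qk x * q0 y).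
Definition scaleq r x := Quat (r * q0 x) (r * qi x) (r * qj x) (r * qk x).

Let addqA : associative addq.
Proof. by move=> x y z; rewrite /addq /= !addrA. Qed.
Let addqC : commutative addq.
Proof. by move=> x y; rewrite /addq; congr Quat; exact: addrC. Qed.
Let add0q : left_id (Quat 0 0 0 0) addq.
Proof. by case=> *; rewrite /addq /= !add0r. Qed.
Let addNq : left_inverse (Quat 0 0 0 0) oppq addq.
Proof. by move=> x; rewrite /addq /= !addNr. Qed.

HB.instance Definition _ := GRing.isZmodule.Build (quat R)
  addqA addqC add0q addNq.

Let mulqA : associative mulq.
Proof. by move=> x y z; rewrite /mulq /=; congr Quat; ring. Qed.
Let mul1q : left_id (Quat 1 0 0 0) mulq.
Proof. by case=> a b c d; rewrite /mulq /=; congr Quat; ring. Qed.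
Let mulq1 : right_id (Quat 1 0 0 0) mulq.
Proof. by case=> a b c d; rewrite /mulq /=; congr Quat; ring. Qed.
Let mulqDl : left_distributive mulq addq.
Proof. by move=> x y z; rewrite /mulq /addq /=; congr Quat; ring. Qed.
Let mulqDr : right_distributive mulq addq.
Proof. by move=> x y z; rewrite /mulq /addq /=; congr Quat; ring. Qed.
Let oneq_neq0 : Quat 1 0 0 0 != Quat 0 0 0 0 :> quat R.
Proof. by apply/eqP => -[] /eqP; rewrite oner_eq0. Qed.

HB.instance Definition _ := GRing.Zmodule_isNzRing.Build (quat R)
  mulqA mul1q mulq1 mulqDl mulqDr oneq_neq0.

Let scaleqA r s x : scaleq r (scaleq s x) = scaleq (r * s) x.
Proof. by rewrite /scaleq /= !mulrA. Qed.
Let scale1q : left_id 1 scaleq.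
Proof. by case=> *; rewrite /scaleq /= !mul1r. Qed.
Let scaleqDr : right_distributive scaleq +%R.
Proof. by move=> r x y; rewrite /scaleq /= !mulrDr. Qed.
Let scaleqDl x : {morph scaleq^~ x : r s / r + s}.
Proof. by move=> r s; rewrite /scaleq /= !mulrDl. Qed.

HB.instance Definition _ := GRing.Zmodule_isLmodule.Build R (quat R)
  scaleqA scale1q scaleqDr scaleqDl.

End QuatRing.

(* The embeddings of the complex field as R + iR and as R + jR. *)
Definition complex_i (R : nzRingType) (z : R[i]) : quat R :=
  Quat (complex.Re z) (complex.Im z) 0 0.
Definition complex_j (R : nzRingType) (z : R[i]) : quat R :=
  Quat (complex.Re z) 0 (complex.Im z) 0.

Definition qmod (R : rcfType) (x : quat R) : R :=
  Num.sqrt (q0 x ^+ 2 + qi x ^+ 2 + qj x ^+ 2 + qk x ^+ 2).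

Definition coord (R : Type) (k : 'I_2) (t : R * R) : R :=
  if k == ord0 then t.1 else t.2.

Definition basis_vec (R : nzRingType) (k : 'I_2) : R * R :=
  if k == ord0 then (1, 0) else (0, 1).

Section FunctionSpaces.
Variable R : realType.

Definition plane := (measurableTypeR R * measurableTypeR R)%type.

Definition plane_measure : {measure set plane -> \bar R} :=
  (@lebesgue_measure R \x @lebesgue_measure R)%E.

Definition qmeasurable (f : R * R -> quat R) :=
  [/\ measurable_fun [set: plane] (fun t : plane => q0 (f t)),
      measurable_fun [set: plane] (fun t : plane => qi (f t)),
      measurable_fun [set: plane] (fun t : plane => qj (f t)) &
      measurable_fun [set: plane] (fun t : plane => qk (f t))].

Definition qLnorm (p : \bar R) (f : R * R -> quat R) : \bar R :=
  Lnorm plane_measure p (fun t => (qmod (f t))%:E).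

Definition Lq (p : \bar R) (f : R * R -> quat R) :=
  qmeasurable f /\ (qLnorm p f < +oo)%E.

(* Bochner integral over the plane; junk value when f is not integrable. *)
Definition qintegral (f : R * R -> quat R) : quat R :=
  Quat (\int[plane_measure]_t q0 (f t)) (\int[plane_measure]_t qi (f t))
       (\int[plane_measure]_t qj (f t)) (\int[plane_measure]_t qk (f t)).

End FunctionSpaces.

Section WeakDerivative.
Variable R : realType.

Fixpoint Cn (n : nat) (phi : R * R -> R) : Prop :=
  continuous phi /\
  if n is m.+1 then
    forall k : 'I_2, (forall t, derivable phi t (basis_vec R k)) /\
                     Cn m ('D_(basis_vec R k) phi)
  else True.

Definition test_function (phi : R * R -> R) :=
  (forall n, Cn n phi) /\ compact (closure [set t | phi t != 0]).

Definition qlocally_integrable (f : R * R -> quat R) :=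
  qmeasurable f /\
  forall K : set (R * R), compact K ->
    (\int[plane_measure R]_(t in K) (qmod (f t))%:E < +oo)%E.

(* h is the distributional partial derivative of f along the k-th axis. *)
Definition weak_partial (k : 'I_2) (f h : R * R -> quat R) :=
  [/\ qlocally_integrable f, qlocally_integrable h &
      forall phi, test_function phi ->
        qintegral (fun t => 'D_(basis_vec R k) phi t *: f t) =
        - qintegral (fun t => phi t *: h t)].

End WeakDerivative.

Record olct_param (R : Type) := OlctParam {
  oa : R; ob : R; oc : R; od : R; otau : R; oeta : R }.

Section QOLCT.
Variable R : realType.
Implicit Types (m : olct_param R) (M : 'I_2 -> olct_param R).

Definition expi (theta : R) : R[i] := Complex (cos theta) (sin theta).

Definition olct_phase m (u t : R) : R :=
  (oa m * t ^+ 2 + 2 * t * (otau m - u)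
   - 2 * u * (od m * otau m - ob m * oeta m)
   + od m * u ^+ 2 + od m * otau m ^+ 2) / (2 * ob m).

(* [sqrtc] is the principal square root. *)
Definition olct_kernel m (u t : R) : R[i] :=
  sqrtc ((Complex 0 (2 * pi * ob m))^-1) * expi (olct_phase m u t).

Definition QOLCT1 M (f : R * R -> quat R) (u : R * R) : quat R :=
  qintegral (fun t =>
    complex_i (olct_kernel (M ord0) u.1 t.1) * f t *
    complex_j (olct_kernel (M ord_max) u.2 t.2)).

(* F is a limit in L^2 of transforms of functions of L^1 `&` L^2 tending
   to f in L^2. *)
Definition is_QOLCT M (f F : R * R -> quat R) :=
  Lq 2%:E F /\
  exists f_ : nat -> R * R -> quat R,
    [/\ forall n, Lq 1%:E (f_ n) /\ Lq 2%:E (f_ n),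
        qLnorm 2%:E (fun t => f_ n t - f t) @[n --> \oo] --> 0%E &
        qLnorm 2%:E (fun u => QOLCT1 M (f_ n) u - F u) @[n --> \oo] --> 0%E].

(* The extension by density to L^2, determined up to equality almost
   everywhere. *)
Definition QOLCT M (f : R * R -> quat R) : R * R -> quat R :=
  xget (fun=> 0) [set F | is_QOLCT M f F].

(* D f along the k-th axis, where h stands for the k-th partial derivative
   of f; in both cases the unit i acts on the left. *)
Definition Dop M (k : 'I_2) (f h : R * R -> quat R) (t : R * R) : quat R :=
  - (h t + complex_i (Complex 0
       ((oa (M k) * coord k t + otau (M k)) / ob (M k))) * f t).

Definition Dop_in_L2 M (k : 'I_2) (f : R * R -> quat R) :=
  exists2 h, weak_partial k f h & Lq 2%:E (Dop M k f h).

(* Both spreads may be +oo. *)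
Definition Delta_t (k : 'I_2) (f : R * R -> quat R) : \bar R :=
  qLnorm 2%:E (fun t => coord k t *: f t).

Definition Delta_u M (k : 'I_2) (f : R * R -> quat R) : \bar R :=
  qLnorm 2%:E (fun u => coord k u *: QOLCT M f u).

End QOLCT.

(* Main.v *)
From HB Require Import structures.
Require Import Defs.
From mathcomp Require Import all_boot all_order all_algebra.
From mathcomp Require Import finmap all_classical all_reals all_analysis.
From mathcomp.real_closed Require Import complex.
From mathcomp Require Import measurable_realfun ring lra.
Set Implicit Arguments.
Unset Strict Implicit.
Unset Printing Implicit Defensive.
Import Order.TTheory GRing.Theory Num.Theory.
Import numFieldNormedType.Exports.
Local Open Scope classical_set_scope.
Local Open Scope ring_scope.

(** The inequality holds coordinate by coordinate:
    [|b_k / 2| ^ 2 |f|_2 ^ 4 <= |t_k f|_2 ^ 2 |u_k O f|_2 ^ 2], and the two factors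
    are multiplied.

    The phase of the kernel is a function of [u] plus a function of [t] minus
    [u t / b]. So [O f] is, up to unit quaternions and a constant, the
    two-sided Fourier transform of the chirped function
    [G = exp (i phi_1) f exp (j phi_2)], for which [|G| = |f|]
    pointwise ([QOLCT1_chirp]). Everything then rests on Plancherel's identity
    for that transform ([QFT_plancherel]). It is reduced to a Parseval identity
    for real functions: adding the values of [|QFT g| ^ 2] at [(+- u_1, +- u_2)]
    cancels all the cross terms between the four real components of [g] and
    leaves the sum of their sine-cosine energies. The real identity is obtained
    by damping the energy with [exp (- e |u_1| - e |u_2|)], which turns it into
    the quadratic form of a Poisson kernel. Schur's test gives Bessel's
    inequality, so that the defect in Parseval's identity is a nonnegative
    quadratic form and its zero set is a closed linear space; the defect
    vanishes on indicators of boxes by an explicit limit, hence on all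
    square-integrable functions that are integrable ([parseval]).

    Plancherel's identity and the completeness of [L ^ 2] ([L2_complete]),
    applied to truncations of [f], show that the extended transform exists, so
    that the chosen [QOLCT M f] is a limit of transforms and inherits the
    estimates below ([is_QOLCT_QOLCT]).

    The uncertainty inequality is the classical argument of Heisenberg, with
    difference quotients in place of the derivative. A translation by [h] along
    the [k]-th axis acts on the transform of [G] by a unit quaternion of angle
    [h u_k / b_k], so
    [|G (. + h e_k) - G|_2 <= (h / |b_k|) |u_k O f|_2] ([qnorm2_difference_le]).
    On the other hand [h |G|_2 ^ 2] is the integral of
    [t_k (|G (t)| ^ 2 - |G (t + h e_k)| ^ 2)], which Young's inequality bounds
    by the difference and by [|t_k G|_2]; letting [h] tend to 0 and optimizing
    the weight gives the claim ([uncertainty]). If one spread is infinite the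
    inequality is trivial unless the other one vanishes, and then [f] is zero
    almost everywhere. *)

(** * The Poisson kernel as a Fourier transform *)

Section poisson_kernel.
Variable R : realType.
Notation lam := (@lebesgue_measure R).
Implicit Types e x w : R.

(** [2 pi] times the Poisson kernel of the half-plane. *)
Definition poisson e x := 2 * e / (e ^+ 2 + x ^+ 2).

(** An antiderivative of [exp (- e w) (1 + cos (x w))]. *)
Let prim e x w := - expR (- e * w) / e
  + expR (- e * w) * (x * sin (x * w) - e * cos (x * w)) / (e ^+ 2 + x ^+ 2).

Let den_gt0 e x : 0 < e -> 0 < e ^+ 2 + x ^+ 2.
Proof. by move=> e0; rewrite ltr_pwDl ?exprn_gt0// sqr_ge0. Qed.

Let is_derive_prim e x w : 0 < e ->
  is_derive w 1 (prim e x) (expR (- e * w) * (1 + cos (x * w))).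
Proof.
move=> e0; have d0 := lt0r_neq0 (den_gt0 x e0).
rewrite /prim.
have h1 : is_derive w 1 (fun w => expR (- e * w)) (- e * expR (- e * w)).
  apply: is_derive_eq; rewrite /= /GRing.scale /=; ring.
have h2 : is_derive w 1 (fun w => sin (x * w)) (x * cos (x * w)).
  apply: is_derive_eq; rewrite /= /GRing.scale /=; ring.
have h3 : is_derive w 1 (fun w => cos (x * w)) (- x * sin (x * w)).
  apply: is_derive_eq; rewrite /= /GRing.scale /=; ring.
apply: is_derive_eq; rewrite /= /GRing.scale /=.
field.
by rewrite d0 lt0r_neq0.
Qed.

Lemma cvg_expR_decay e : 0 < e -> expR (- e * w) @[w --> +oo%R] --> (0 : R).
Proof.
move=> e0; rewrite (_ : (fun w => _) = (fun z => expR (- z)) \o (fun w => e * w)).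
  apply: cvg_comp; last exact: cvgr_expR.
  exact: gt0_cvgMry.
by apply/funext => w /=; rewrite mulNr.
Qed.

Let prim_cvg e x : 0 < e -> prim e x w @[w --> +oo%R] --> (0 : R).
Proof.
move=> e0; have D0 := den_gt0 x e0.
have Ecvg := cvg_expR_decay e0.
rewrite /prim -[0](addr0 0); apply: cvgD.
  rewrite -[0](mul0r e^-1) -oppr0; apply: cvgM; last exact: cvg_cst.
  exact: cvgN.
pose M := (`|x| + e) / (e ^+ 2 + x ^+ 2).
apply/norm_cvg0P.
apply: (@squeeze_cvgr _ _ _ _ (cst 0) (fun w => expR (- e * w) * M)).
- near=> w; rewrite normr_ge0/=.
  rewrite -mulrA normrM ger0_norm ?expR_ge0// ler_wpM2l ?expR_ge0//.
  rewrite /M normrM (@ger0_norm _ (_^-1)) ?invr_ge0 ?(ltW D0)//.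
  rewrite ler_wpM2r ?invr_ge0 ?(ltW D0)//.
  apply: le_trans (ler_normB _ _) _; rewrite !normrM (gtr0_norm e0).
  apply: lerD; first by rewrite ler_piMr// ler_norml sin_geN1 sin_le1.
  by rewrite ler_piMr ?(ltW e0)// ler_norml cos_geN1 cos_le1.
- exact: cvg_cst.
- by rewrite -[0](mul0r M); apply: cvgM => //; exact: cvg_cst.
Unshelve. all: by end_near. Qed.

Let continuous_expabs e : continuous (fun w => expR (- e * `|w|)).
Proof.
move=> w; apply: (@continuous_comp _ _ _ (fun w => - e * `|w|) expR).
  by apply: cvgM; [exact: cvg_cst|exact: norm_continuous].
exact: continuous_expR.
Qed.

Let continuous_cosM x : continuous (fun w => cos (x * w)).
Proof.
move=> w; apply: (@continuous_comp _ _ _ (fun w => x * w) cos).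
  by apply: cvgM; [exact: cvg_cst|exact: cvg_id].
exact: continuous_cos.
Qed.

(** Adding 1 to the cosine makes the integrand nonnegative, as the
    fundamental theorem of calculus on a half-line asks; the term added is
    subtracted again in [integral_expabs_cos]. *)
Let integral_expabs1cos e x : 0 < e ->
  (\int[lam]_w (expR (- e * `|w|) * (1 + cos (x * w)))%:E
   = (2 / e + poisson e x)%:E)%E.
Proof.
move=> e0; have d0 := lt0r_neq0 (den_gt0 x e0).
have c1 w : 0 <= 1 + cos (x * w) by have := cos_geN1 (x * w); lra.
rewrite ge0_symfun_integralT; first last.
- by move=> w /=; rewrite normrN mulrN cosN.
- move=> w; apply: cvgM; first exact: continuous_expabs.
  by apply: cvgD; [exact: cvg_cst|exact: continuous_cosM].
- by move=> w; rewrite mulr_ge0 ?expR_ge0.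
rewrite -set_itvcy.
have -> : (\int[lam]_(w in `[0%R, +oo[) (expR (- e * `|w|) * (1 + cos (x * w)))%:E
    = \int[lam]_(w in `[0%R, +oo[) (expR (- e * w) * (1 + cos (x * w)))%:E)%E.
  apply: eq_integral => w; rewrite inE/= in_itv/= andbT => w0.
  by rewrite ger0_norm.
rewrite (@ge0_continuous_FTC2y _ _ (prim e x) 0 0).
- rewrite sub0e -EFinN -EFinM; congr EFin; rewrite /prim /poisson !mulr0 expR0 sin0 cos0.
  by field; rewrite d0 lt0r_neq0.
- by move=> w _; rewrite mulr_ge0 ?expR_ge0.
- apply: continuous_subspaceT => w; apply: cvgM.
    apply: (@continuous_comp _ _ _ (fun w => - e * w) expR).
      by apply: cvgM; [exact: cvg_cst|exact: cvg_id].
    exact: continuous_expR.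
  by apply: cvgD; [exact: cvg_cst|exact: continuous_cosM].
- exact: prim_cvg.
- by move=> w _; have /@ex_derive := is_derive_prim x w e0.
- apply: cvg_at_right_filter; apply: differentiable_continuous.
  by apply/derivable1_diffP; have /@ex_derive := is_derive_prim x 0 e0.
- move=> w _; rewrite derive1E.
  by have /@derive_val := is_derive_prim x w e0.
Qed.

Let integral_expabs e : 0 < e ->
  (\int[lam]_w (expR (- e * `|w|))%:E = (2 / e)%:E)%E.
Proof.
move=> e0; have := integral_expabs1cos 0 e0.
under eq_integral do rewrite mul0r cos0 mulrC EFinM.
rewrite ge0_integralZl//; last first.
  apply/measurable_EFinP.
  by apply: continuous_measurable_fun; exact: continuous_expabs.
rewrite /poisson expr0n addr0 => h.
have -> : (2 / e)%:E = ((2^-1)%:E * (2 / e + 2 * e / e ^+ 2)%:E)%E :> \bar R.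
  by rewrite -EFinM; congr EFin; field; exact: lt0r_neq0.
rewrite -h muleA -EFinM mulVf ?mul1e//.
Qed.

Lemma integrable_expabs e : 0 < e ->
  lam.-integrable setT (fun w => (expR (- e * `|w|))%:E).
Proof.
move=> e0; apply/integrableP; split.
  apply/measurable_EFinP.
  by apply: continuous_measurable_fun; exact: continuous_expabs.
under eq_integral do rewrite abse_EFin ger0_norm ?expR_ge0//.
by rewrite integral_expabs// ltry.
Qed.

Lemma integrable_expabs_cos e x : 0 < e ->
  lam.-integrable setT (fun w => (expR (- e * `|w|) * cos (x * w))%:E).
Proof.
move=> e0; apply: le_integrable (integrable_expabs e0) => //.
  apply/measurable_EFinP; apply: continuous_measurable_fun => w.
  by apply: cvgM; [exact: continuous_expabs|exact: continuous_cosM].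
move=> w _; rewrite !abse_EFin lee_fin normrM ger0_norm ?expR_ge0//.
by rewrite ler_piMr ?expR_ge0// ler_norml cos_geN1 cos_le1.
Qed.

Lemma integral_expabs_cos e x : 0 < e ->
  (\int[lam]_w (expR (- e * `|w|) * cos (x * w))%:E = (poisson e x)%:E)%E.
Proof.
move=> e0; have := integral_expabs1cos x e0.
have -> : (\int[lam]_w (expR (- e * `|w|) * (1 + cos (x * w)))%:E =
  \int[lam]_w ((expR (- e * `|w|))%:E + (expR (- e * `|w|) * cos (x * w))%:E))%E.
  by apply: eq_integral => w _ /=; rewrite -EFinD; congr EFin; ring.
rewrite integralD//; [|exact: integrable_expabs|exact: integrable_expabs_cos].
rewrite integral_expabs// EFinD addeC => /(congr1 (fun z => z - (2 / e)%:E)%E).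
by rewrite addeK// [in RHS]addeC addeK.
Qed.

End poisson_kernel.

(** * Translations and reflections of the line *)

Section lebesgue_invariance.
Variable R : realType.
Notation lam := (@lebesgue_measure R).
Notation line := (measurableTypeR R).

Lemma measurable_shift (c : R) : measurable_fun [set: line] (fun x : line => (x + c : line)).
Proof.
apply: continuous_measurable_fun => x.
by apply: cvgD; [exact: cvg_id|exact: cvg_cst].
Qed.

Lemma measurable_opp : measurable_fun [set: line] (fun x : line => (- x : line)).
Proof. by apply: continuous_measurable_fun => x; apply: cvgN; exact: cvg_id. Qed.

Lemma lebesgue_measure_shift (c : R) (A : set line) : measurable A ->
  pushforward lam (fun x : line => (x + c : line)) A = lam A.
Proof.
move=> mA; apply/esym/lebesgue_measure_unique => //=.
  exact: measurable_shift.
move=> mc _ [[a b]] _ <-; rewrite /pushforward /=.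
rewrite (_ : _ @^-1` _ = `](a - c), (b - c)]%classic).
  rewrite !lebesgue_measure_itv/= !lte_fin ltrD2r.
  by case: ifPn => // _; rewrite -!EFinB; congr EFin; ring.
apply/seteqP; split => x /=; rewrite !in_itv/=; lra.
Qed.

Lemma ge0_integral_shift (c : R) (f : line -> \bar R) :
  measurable_fun [set: line] f -> (forall x, 0 <= f x)%E ->
  (\int[lam]_x f (x + c)%R = \int[lam]_x f x)%E.
Proof.
move=> mf f0.
have -> : (\int[lam]_x f (x + c)%R = \int[lam]_x (f \o (fun x : line => (x + c : line)%R)) x)%E by [].
rewrite -[LHS](ge0_integral_pushforward (measurable_shift c) lam (D := setT))//.
apply: eq_measure_integral; first exact: measurable_shift.
by move=> ? A mA _; exact: lebesgue_measure_shift.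
Qed.

Lemma ge0_integral_opp (f : line -> \bar R) :
  measurable_fun [set: line] f -> (forall x, 0 <= f x)%E ->
  (\int[lam]_x f (- x)%R = \int[lam]_x f x)%E.
Proof.
move=> mf f0.
have -> : (\int[lam]_x f (- x)%R = \int[lam]_x (f \o (fun x : line => (- x : line)%R)) x)%E by [].
rewrite -[LHS](ge0_integral_pushforward measurable_opp lam (D := setT))//.
apply: eq_measure_integral; first exact: measurable_opp.
by move=> ? A mA _; exact: lebesgue_measureN.
Qed.

End lebesgue_invariance.

(** * Mass and concentration of the Poisson kernel *)

Section poisson_mass.
Variable R : realType.
Notation lam := (@lebesgue_measure R).
Notation line := (measurableTypeR R).
Implicit Types e b x t : R.

Let den_gt0 e x : 0 < e -> 0 < e ^+ 2 + x ^+ 2.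
Proof. by move=> e0; rewrite ltr_pwDl ?exprn_gt0// sqr_ge0. Qed.

Lemma poisson_ge0 e x : 0 < e -> 0 <= poisson e x.
Proof.
by move=> e0; rewrite /poisson divr_ge0 ?(ltW (den_gt0 _ e0))// mulr_ge0// ltW.
Qed.

Lemma poisson_norm e b x : poisson e (`|b| * x) = poisson e (b * x).
Proof. by rewrite /poisson !exprMn real_normK ?num_real. Qed.

Lemma continuous_poisson e : 0 < e -> continuous (poisson e).
Proof.
move=> e0 x; rewrite /poisson; apply: cvgM; first exact: cvg_cst.
apply: cvgV; first by rewrite lt0r_neq0 ?den_gt0.
by apply: cvgD; [exact: cvg_cst|exact: exprn_continuous].
Qed.

Let continuous_aff (u v : R) : continuous (fun s : R => u * s + v).
Proof.
by move=> s; apply: cvgD; [apply: cvgM; [exact: cvg_cst|exact: cvg_id]|exact: cvg_cst].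
Qed.

Let is_derive_atanM e b x : 0 < e -> b != 0 ->
  is_derive x 1 (fun x => 2 / b * atan (b * x / e)) (poisson e (b * x)).
Proof.
move=> e0 b0.
have h : is_derive x 1 (fun x => b * x / e) (b / e).
  apply: is_derive_eq; rewrite /= /GRing.scale /=; ring.
apply: is_derive_eq; rewrite /= /GRing.scale /= /poisson.
have := den_gt0 (b * x) e0; move/lt0r_neq0 => d0.
field.
by rewrite d0 b0 lt0r_neq0.
Qed.

Let cvg_atanM e b : 0 < e -> 0 < b ->
  2 / b * atan (b * x / e) @[x --> +oo%R] --> 2 / b * (pi / 2).
Proof.
move=> e0 b0; apply: cvgM; first exact: cvg_cst.
apply: (@cvg_comp _ _ _ (fun x => b * x / e) atan); last exact: cvgy_atan.
rewrite (_ : (fun x => _) = (fun x => (b / e) * x)); last first.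
  by apply/funext => x; ring.
by apply: gt0_cvgMry; [rewrite divr_gt0|].
Qed.

Let measurable_poisson_aff e (u v : R) : 0 < e ->
  measurable_fun [set: line] (fun s : line => (poisson e (u * s + v))%:E).
Proof.
move=> e0; apply/measurable_EFinP; apply: continuous_measurable_fun => s.
by apply: (@continuous_comp _ _ _ (fun s : R => u * s + v) (poisson e));
  [exact: continuous_aff|exact: continuous_poisson].
Qed.

(** The kernel is the derivative of an arctangent, whose limit at infinity
    is [pi / 2] for every [e]. *)
Lemma integral_poisson e b t : 0 < e -> b != 0 ->
  (\int[lam]_s (poisson e (b * (t - s)))%:E = (2 * pi / `|b|)%:E)%E.
Proof.
wlog b0 : b / 0 < b => [hwlog e0 b0|e0 _].
  under eq_integral do rewrite -poisson_norm.
  by rewrite hwlog ?normr_gt0 ?normr_id// normr_eq0.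
rewrite gtr0_norm//.
pose h := fun s : line => (poisson e (b * s))%:E.
have mh : measurable_fun [set: line] h.
  by have := measurable_poisson_aff b 0 e0; under eq_fun do rewrite addr0.
have h0 s : (0 <= h s)%E by rewrite lee_fin poisson_ge0.
transitivity (\int[lam]_s h s)%E.
  rewrite -(ge0_integral_opp mh h0) -(@ge0_integral_shift _ (- t) (fun s => h (- s)%R))//.
    apply: eq_integral => s _; rewrite /h; congr (poisson _ _)%:E; ring.
  by apply: (measurableT_comp mh); exact: measurable_opp.
rewrite /h ge0_symfun_integralT; first last.
- by move=> s; rewrite /= mulrN /poisson sqrrN.
- move=> s; apply: (@continuous_comp _ _ _ (fun s => b * s)).
    by apply: cvgM; [exact: cvg_cst|exact: cvg_id].
  exact: continuous_poisson.
- by move=> s; rewrite poisson_ge0.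
rewrite -set_itvcy.
rewrite (@ge0_continuous_FTC2y _ _ (fun x => 2 / b * atan (b * x / e)) 0 (2 / b * (pi / 2))).
- rewrite !(mulr0, mul0r) atan0 mulr0 sube0 -EFinM; congr EFin; field.
  exact: lt0r_neq0.
- by move=> s _; rewrite poisson_ge0.
- apply: continuous_subspaceT => s; apply: (@continuous_comp _ _ _ (fun s => b * s)).
    by apply: cvgM; [exact: cvg_cst|exact: cvg_id].
  exact: continuous_poisson.
- exact: cvg_atanM.
- by move=> w _; have /@ex_derive := is_derive_atanM w e0 (lt0r_neq0 b0).
- apply: cvg_at_right_filter.
  have /@ex_derive/derivable1_diffP/differentiable_continuous := is_derive_atanM 0 e0 (lt0r_neq0 b0).
  exact.
- move=> w _; rewrite derive1E.
  by have /@derive_val := is_derive_atanM w e0 (lt0r_neq0 b0).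
Qed.

Let integral_poisson_itv e b t u v : 0 < e -> 0 < b -> u < v ->
  (\int[lam]_(s in `]u, v]) (poisson e (b * (t - s)))%:E
   = (2 / b * (atan (b * (t - u) / e) - atan (b * (t - v) / e)))%:E)%E.
Proof.
move=> e0 b0 uv.
have dF x : is_derive x 1 (fun s => - (2 / b * atan (b * (t - s) / e))) (poisson e (b * (t - x))).
  have h1 : is_derive x 1 (fun s => t - s) (-1).
    by apply: is_derive_eq; rewrite add0r mul1r.
  have h2 := is_derive_atanM (t - x) e0 (lt0r_neq0 b0).
  have h3 : is_derive x 1 ((fun x => 2 / b * atan (b * x / e)) \o (fun s => t - s))
     (poisson e (b * (t - x)) * -1).
    exact: is_derive1_comp.
  apply: is_derive_eq; rewrite /= /GRing.scale /=; ring.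
have mp : measurable_fun [set: line] (fun s : line => (poisson e (b * (t - s)))%:E).
  rewrite (_ : (fun s => _) = (fun s : line => (poisson e (- b * s + b * t))%:E)).
    exact: measurable_poisson_aff.
  by apply/funext => s; congr (poisson _ _)%:E; ring.
rewrite integral_itv_bndoo; last exact: measurable_funTS.
rewrite -(@integral_itv_bndoo _ _ _ _ true false); last exact: measurable_funTS.
rewrite (@continuous_FTC2 _ _ (fun s => - (2 / b * atan (b * (t - s) / e)))).
- by rewrite -EFinB; congr EFin; ring.
- by [].
- apply: continuous_subspaceT => s; apply: (@continuous_comp _ _ _ (fun s => b * (t - s))).
    apply: cvgM; first exact: cvg_cst.
    by apply: cvgB; [exact: cvg_cst|exact: cvg_id].
  exact: continuous_poisson.
- have cF x : (fun s => - (2 / b * atan (b * (t - s) / e))) y @[y --> x] -->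
     (fun s => - (2 / b * atan (b * (t - s) / e))) x.
    by have /@ex_derive/derivable1_diffP/differentiable_continuous := dF x.
  split; first by move=> w _; have /@ex_derive := dF w.
  + exact: cvg_at_right_filter.
  + exact: cvg_at_left_filter.
- by move=> w _; rewrite derive1E; have /@derive_val := dF w.
Qed.

Let cvg_atan_mulrn (c : R) : 0 < c -> atan (c / n.+1%:R^-1) @[n --> \oo] --> pi / 2.
Proof.
move=> c0; apply: (@cvg_comp _ _ _ (fun n : nat => c / n.+1%:R^-1) atan).
  rewrite (_ : (fun n => _) = (fun n : nat => c * n.+1%:R)).
    apply: (@cvg_comp _ _ _ (fun n : nat => n.+1%:R : R) (fun x => c * x) _ +oo%R).
      by rewrite (cvg_shiftS (fun n : nat => n%:R : R)); exact: cvgr_idn.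
    exact: gt0_cvgMry.
  by apply/funext => n; rewrite invrK.
exact: cvgy_atan.
Qed.

(** The inner integral is a difference of two arctangents; as the parameter
    tends to 0 they tend to [pi / 2] and [- pi / 2] at every interior point,
    and dominated convergence applies. *)
Lemma cvg_poisson_square b u v : b != 0 -> u < v ->
  (\int[lam]_(t in `]u, v]) \int[lam]_(s in `]u, v])
     (poisson n.+1%:R^-1 (b * (t - s)))%:E)%E @[n --> \oo]
  --> (2 * pi / `|b| * (v - u))%:E.
Proof.
wlog b0 : b / 0 < b => [hwlog b0 uv|_ uv].
  under eq_fun do under eq_integral do under eq_integral do rewrite -poisson_norm.
  by have := hwlog `|b|; rewrite normr_id; apply; rewrite ?normr_gt0 ?normr_eq0.
rewrite gtr0_norm//.
pose F n t : \bar R := (2 / b * (atan (b * (t - u) / n.+1%:R^-1) - atan (b * (t - v) / n.+1%:R^-1)))%:E.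
have mF n : measurable_fun [set: line] (F n).
  have cat w : continuous (fun t => atan (b * (t - w) / n.+1%:R^-1)).
    move=> t; apply: (@continuous_comp _ _ _ (fun t => b * (t - w) / n.+1%:R^-1) atan).
      apply: cvgM; last exact: cvg_cst.
      by apply: cvgM; [exact: cvg_cst|apply: cvgB; [exact: cvg_id|exact: cvg_cst]].
    exact: continuous_atan.
  apply/measurable_EFinP; apply: continuous_measurable_fun => t.
  apply: cvgM; first exact: cvg_cst.
  by apply: cvgB; exact: cat.
rewrite (_ : (fun n => _) = (fun n => \int[lam]_(t in `]u, v[) F n t)%E); last first.
  apply/funext => n; rewrite -(@integral_itv_bndoo _ _ _ _ false false); last first.
    exact: measurable_funTS (mF n).
  by apply: eq_integral => t _; rewrite integral_poisson_itv.
have -> : (2 * pi / b * (v - u))%:E = (\int[lam]_(t in `]u, v[) (cst (2 * pi / b)%:E) t)%E.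
  rewrite integral_cst//= lebesgue_measure_itv/= lte_fin uv -EFinB -EFinM//.
have atan_lt (x : R) : `|atan x| <= pi / 2.
  by rewrite ler_norml ltW ?atan_gtNpi2// ltW// atan_ltpi2.
have [] := @dominated_convergence _ _ R lam `]u, v[%classic _ F (cst (2 * pi / b)%:E)
   (cst (2 * pi / b)%:E).
- by [].
- by move=> n; exact: measurable_funTS (mF n).
- by [].
- apply/nearW => t; rewrite /= in_itv/= => /andP[ut tv].
  apply: cvg_EFin; first exact: nearW.
  rewrite /= (_ : 2 * pi / b = 2 / b * (pi / 2 - - (pi / 2))); last by field; exact: lt0r_neq0.
  apply: cvgM; first exact: cvg_cst.
  apply: cvgB; first by apply: cvg_atan_mulrn; rewrite mulr_gt0// subr_gt0.
  rewrite (_ : (fun n => _) = (fun n : nat => - atan (b * (v - t) / n.+1%:R^-1))); last first.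
    by apply/funext => n /=; rewrite -atanN; congr atan; ring.
  by apply: cvgN; apply: cvg_atan_mulrn; rewrite mulr_gt0// subr_gt0.
- apply/integrableP; split; first exact: measurable_cst.
  rewrite (_ : (fun x => _) = cst `|(2 * pi / b)%:E|%E)// integral_cst//=.
  by rewrite lebesgue_measure_itv/= lte_fin uv -EFinB -EFinM ltry.
- apply/nearW => t n _ /=; rewrite lee_fin normrM ger0_norm ?divr_ge0 ?(ltW b0)//.
  rewrite (_ : 2 * pi / b = 2 / b * pi); last by ring.
  rewrite ler_wpM2l ?divr_ge0 ?(ltW b0)//.
  by apply: le_trans (ler_normB _ _) _; rewrite [leRHS](splitr pi) lerD.
- by move=> _ _; exact.
Qed.

End poisson_mass.

(** * Integral operators with bounded kernels *)

Lemma integrable_bounded_mul (R : realType) d (T : measurableType d)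
    (mu : {measure set T -> \bar R}) (C : R) (w h : T -> R) :
  mu.-integrable setT (EFin \o w) -> measurable_fun setT h ->
  (forall x, `|h x| <= C) -> mu.-integrable setT (EFin \o (fun x => w x * h x)).
Proof.
move=> iw mh hC; apply: le_integrable (integrableZl measurableT C iw) => //.
  apply/measurable_EFinP; apply: measurable_funM => //.
  by have /measurable_int/measurable_EFinP := iw.
move=> x _ /=; rewrite lee_fin !normrM mulrC ler_wpM2r//.
exact: le_trans (hC x) (ler_norm _).
Qed.

Lemma Rintegral_bounded_mul (R : realType) d (T : measurableType d)
    (mu : {measure set T -> \bar R}) (C : R) (w h : T -> R) :
  mu.-integrable setT (EFin \o w) -> measurable_fun setT h ->
  (forall x, `|h x| <= C) ->
  `|\int[mu]_x (w x * h x)| <= C * \int[mu]_x `|w x|.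
Proof.
move=> iw mh hC; have iwh := integrable_bounded_mul iw mh hC.
apply: le_trans (le_normr_Rintegral measurableT iwh) _.
have inw : mu.-integrable setT (EFin \o (fun x => `|w x|)) by exact: integrable_norm.
rewrite -RintegralZl//; apply: le_Rintegral => //.
- exact: integrable_norm.
- exact: (integrableZl measurableT C inw).
- by move=> x _; rewrite normrM mulrC ler_wpM2r.
Qed.

Section bounded_kernel.
Context d1 d2 (X : measurableType d1) (Y : measurableType d2) (R : realType).
Variables (m1 : {sigma_finite_measure set X -> \bar R})
          (m2 : {sigma_finite_measure set Y -> \bar R}).
Variables (w : X -> R) (g : Y -> R) (h : X * Y -> R) (C : R).
Hypotheses (iw : m1.-integrable setT (EFin \o w))
  (ig : m2.-integrable setT (EFin \o g))
  (mh : measurable_fun setT h) (hC : forall z, `|h z| <= C).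

Let mw : measurable_fun setT w.
Proof. by have /measurable_int/measurable_EFinP := iw. Qed.

Let mg : measurable_fun setT g.
Proof. by have /measurable_int/measurable_EFinP := ig. Qed.

Lemma integrable_tensor :
  (m1 \x m2)%E.-integrable setT (EFin \o (fun z : X * Y => w z.1 * g z.2)).
Proof.
have mwg : measurable_fun [set: X * Y] (EFin \o (fun z : X * Y => w z.1 * g z.2)).
  apply/measurable_EFinP; apply: measurable_funM.
    exact: (measurableT_comp mw measurable_fst).
  exact: (measurableT_comp mg measurable_snd).
apply/integrable12ltyP => //=.
under eq_integral => x _.
  under eq_integral do rewrite /= normrM EFinM.
  rewrite ge0_integralZl//; last first.
    by apply/measurable_EFinP; exact: measurableT_comp.
  over.
rewrite ge0_integralZr//; last 2 first.
  by apply/measurable_EFinP; exact: measurableT_comp.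
  by apply: integral_ge0 => y _; rewrite lee_fin.
have /integrableP[_ iwoo] := iw; have /integrableP[_ igoo] := ig.
rewrite lte_mul_pinfty//.
- by apply: integral_ge0 => y _; rewrite lee_fin.
- by rewrite ge0_fin_numE//; apply: integral_ge0 => y _; rewrite lee_fin.
Qed.

Lemma integrable_kernel :
  (m1 \x m2)%E.-integrable setT (EFin \o (fun z : X * Y => w z.1 * g z.2 * h z)).
Proof. by apply: (integrable_bounded_mul integrable_tensor mh hC). Qed.

Lemma measurable_kernel_transform :
  measurable_fun setT (fun x => \int[m2]_y (g y * h (x, y))).
Proof.
pose F : X * Y -> \bar R := EFin \o (fun z : X * Y => g z.2 * h z).
have mF : measurable_fun setT F.
  apply/measurable_EFinP; apply: measurable_funM => //.
  exact: (measurableT_comp mg measurable_snd).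
suff mG : measurable_fun setT (fun x => \int[m2]_y F (x, y))%E.
  exact: (measurableT_comp (@fine_measurable R setT measurableT) mG).
rewrite (_ : (fun x => _) =
    fubini_F m2 F^\+ \- fubini_F m2 F^\-)%E; last first.
  apply/funext => x; rewrite /fubini_F /= [LHS]integralE.
  by congr (_ - _)%E; apply: eq_integral => y _; rewrite ?funeposE ?funenegE.
apply: emeasurable_funB.
- apply: measurable_fun_fubini_tonelli_F => //; exact: measurable_funepos.
- apply: measurable_fun_fubini_tonelli_F => //; exact: measurable_funeneg.
Qed.

Lemma kernel_transform_bounded x :
  `|\int[m2]_y (g y * h (x, y))| <= C * \int[m2]_y `|g y|.
Proof.
apply: Rintegral_bounded_mul => //.
exact: (measurable_fun_pair2 _ mh).
Qed.

Let EFin_kernel_transform x : (w x * \int[m2]_y (g y * h (x, y)))%:E =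
  fubini_F m2 (EFin \o (fun z : X * Y => w z.1 * g z.2 * h z)) x.
Proof.
have i1 : m2.-integrable setT (EFin \o (fun y => g y * h (x, y))).
  apply: (integrable_bounded_mul ig _ (fun y => hC (x, y))).
  exact: (measurable_fun_pair2 _ mh).
rewrite EFinM fineK; last exact: integrable_fin_num.
rewrite -integralZl//; apply: eq_integral => y _ /=.
by rewrite -EFinM mulrA.
Qed.

Lemma integrable_kernel_transform :
  m1.-integrable setT (EFin \o (fun x => w x * \int[m2]_y (g y * h (x, y)))).
Proof.
apply: eq_integrable (integrable_fubini_F integrable_kernel) => // x _.
by rewrite /= EFin_kernel_transform.
Qed.

End bounded_kernel.

Lemma bounded_kernel_Fubini (R : realType) d1 d2 (X : measurableType d1)
    (Y : measurableType d2) (m1 : {sigma_finite_measure set X -> \bar R})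
    (m2 : {sigma_finite_measure set Y -> \bar R})
    (w : X -> R) (g : Y -> R) (h : X * Y -> R) (C : R) :
  m1.-integrable setT (EFin \o w) -> m2.-integrable setT (EFin \o g) ->
  measurable_fun setT h -> (forall z, `|h z| <= C) ->
  \int[m1]_x (w x * \int[m2]_y (g y * h (x, y))) =
  \int[m2]_y (g y * \int[m1]_x (w x * h (x, y))).
Proof.
move=> iw ig mh hC; congr fine.
have ik := integrable_kernel iw ig mh hC.
transitivity (\int[m1]_x fubini_F m2 (EFin \o (fun z : X * Y => (w z.1 * g z.2 * h z)%R)) x)%E.
  apply: eq_integral => x _; rewrite EFinM fineK; last first.
    apply: integrable_fin_num => //.
    apply: (integrable_bounded_mul ig _ (fun y => hC (x, y))).
    exact: (measurable_fun_pair2 _ mh).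
  rewrite -integralZl//; last first.
    apply: (integrable_bounded_mul ig _ (fun y => hC (x, y))).
    exact: (measurable_fun_pair2 _ mh).
  by apply: eq_integral => y _ /=; rewrite -EFinM mulrA.
rewrite integral12_prod_meas1// -integral21_prod_meas1//.
apply: eq_integral => y _; rewrite EFinM fineK; last first.
  apply: integrable_fin_num => //.
  apply: (integrable_bounded_mul iw _ (fun x => hC (x, y))).
  exact: (measurable_fun_pair1 _ mh).
rewrite -integralZl//; last first.
  apply: (integrable_bounded_mul iw _ (fun x => hC (x, y))).
  exact: (measurable_fun_pair1 _ mh).
by apply: eq_integral => x _ /=; rewrite -EFinM; congr EFin; ring.
Qed.

Lemma Rintegral_sum (R : realType) d (T : measurableType d)
    (mu : {measure set T -> \bar R}) (I : Type) (r : seq I) (F : I -> T -> R) :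
  (forall i, mu.-integrable setT (EFin \o F i)) ->
  \int[mu]_x (\sum_(i <- r) F i x) = \sum_(i <- r) \int[mu]_x F i x.
Proof.
move=> iF; rewrite (_ : (fun x => _) = \sum_(i <- r) F i); last first.
  by apply/funext => x; rewrite fct_sumE.
suff [] : mu.-integrable setT (EFin \o (\sum_(i <- r) F i)) /\
  \int[mu]_x (\sum_(i <- r) F i) x = \sum_(i <- r) \int[mu]_x F i x by [].
elim: r => [|i r [ir IH]].
  rewrite !big_nil; split; first exact: integrable0.
  by rewrite Rintegral_cst// mul0r.
rewrite !big_cons; split.
  by apply: (integrableD measurableT (iF i) ir).
by rewrite RintegralD// IH.
Qed.

Lemma Rintegral_tensor (R : realType) d1 d2 (X : measurableType d1)
    (Y : measurableType d2) (m1 : {sigma_finite_measure set X -> \bar R})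
    (m2 : {sigma_finite_measure set Y -> \bar R}) (w : X -> R) (g : Y -> R) :
  m1.-integrable setT (EFin \o w) -> m2.-integrable setT (EFin \o g) ->
  \int[(m1 \x m2)%E]_z (w z.1 * g z.2) = \int[m1]_x w x * \int[m2]_y g y.
Proof.
move=> iw ig; rewrite -RintegralZr//; congr fine.
rewrite -integral12_prod_meas1; last exact: integrable_tensor.
apply: eq_integral => x _; rewrite /fubini_F /=.
rewrite [RHS]EFinM fineK; last exact: integrable_fin_num.
by rewrite -integralZl//; apply: eq_integral => y _; rewrite EFinM.
Qed.

(** By Fubini, the weighted square norm of the images of [g] under the integral
    operators of kernels [h i] is a quadratic form in [g], given by the Gram
    kernel of the [h i]. *)
Lemma weighted_energy (R : realType) d1 d2 (X : measurableType d1)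
    (Y : measurableType d2) (m1 : {sigma_finite_measure set X -> \bar R})
    (m2 : {sigma_finite_measure set Y -> \bar R})
    (w : X -> R) (g : Y -> R) (I : Type) (r : seq I) (h : I -> X * Y -> R) (C : R) :
  m1.-integrable setT (EFin \o w) -> m2.-integrable setT (EFin \o g) ->
  (forall i, measurable_fun setT (h i)) -> (forall i z, `|h i z| <= C) ->
  \int[m1]_x (w x * \sum_(i <- r) (\int[m2]_y (g y * h i (x, y))) ^+ 2) =
  \int[m2]_t (g t * \int[m2]_s (g s *
    \int[m1]_x (w x * \sum_(i <- r) (h i (x, t) * h i (x, s))))).
Proof.
move=> iw ig mh hC.
pose T i x := \int[m2]_y (g y * h i (x, y)).
have mT i : measurable_fun setT (T i) by exact: (measurable_kernel_transform ig (mh i)).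
have bT i x := kernel_transform_bounded ig (mh i) (hC i) x.
have iwT i : m1.-integrable setT (EFin \o (fun x => w x * T i x)).
  exact: (integrable_bounded_mul iw (mT i) (bT i)).
have iwTT i : m1.-integrable setT (EFin \o (fun x => w x * T i x * T i x)).
  exact: (integrable_bounded_mul (iwT i) (mT i) (bT i)).
pose h' i (z : Y * X) := h i (z.2, z.1).
have mh' i : measurable_fun setT (h' i).
  apply: (measurableT_comp (mh i)).
  by apply: measurable_fun_pair; [exact: measurable_snd|exact: measurable_fst].
have hC' i z : `|h' i z| <= C by exact: hC.
have mh1 i y : measurable_fun setT (fun x => h i (x, y)).
  exact: (measurable_fun_pair1 _ (mh i)).
have iwh i y : m1.-integrable setT (EFin \o (fun x => w x * h i (x, y))).
  by apply: (integrable_bounded_mul iw (mh1 i y)) => x; exact: hC.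
transitivity (\int[m1]_x (\sum_(i <- r) (w x * T i x * T i x))).
  by apply: eq_Rintegral => x _; rewrite mulr_sumr; apply: eq_bigr => i _; rewrite -mulrA -expr2.
rewrite Rintegral_sum//.
under eq_bigr => i _ do rewrite (bounded_kernel_Fubini (iwT i) ig (mh i) (hC i)).
rewrite -Rintegral_sum; last first.
  by move=> i; exact: (integrable_kernel_transform ig (iwT i) (mh' i) (hC' i)).
apply: eq_Rintegral => t _; rewrite -mulr_sumr; congr (_ * _).
transitivity (\sum_(i <- r) \int[m1]_x ((w x * h i (x, t)) * \int[m2]_y (g y * h i (x, y)))).
  by apply: eq_bigr => i _; apply: eq_Rintegral => x _; rewrite /T; ring.
under eq_bigr => i _ do rewrite (bounded_kernel_Fubini (iwh i t) ig (mh i) (hC i)).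
rewrite -Rintegral_sum; last first.
  by move=> i; exact: (integrable_kernel_transform ig (iwh i t) (mh' i) (hC' i)).
apply: eq_Rintegral => s _; rewrite -mulr_sumr; congr (_ * _).
rewrite -Rintegral_sum; last first.
  move=> i; apply: (integrable_bounded_mul (iwh i t) (mh1 i s)) => x; exact: hC.
by apply: eq_Rintegral => x _; rewrite mulr_sumr; apply: eq_bigr => i _; rewrite mulrA.
Qed.

Lemma measurable_fun_Tonelli (R : realType) d1 d2 (X : measurableType d1)
    (Y : measurableType d2) (m : {sigma_finite_measure set Y -> \bar R})
    (F : X * Y -> R) :
  measurable_fun setT F -> (forall z, 0 <= F z) ->
  measurable_fun setT (fun x => \int[m]_y (F (x, y))%:E)%E.
Proof.
move=> mF F0; apply: (measurable_fun_fubini_tonelli_F (EFin \o F)).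
  exact/measurable_EFinP.
by move=> z; rewrite lee_fin.
Qed.

(** Schur's test, from [2 |a| |b| <= a^2 + b^2] and Tonelli. *)
Lemma schur_test (R : realType) d (Y : measurableType d)
    (m : {sigma_finite_measure set Y -> \bar R}) (K : Y * Y -> R) (C : R) (g : Y -> R) :
  measurable_fun setT K -> (forall z, 0 <= K z) -> 0 <= C ->
  (forall t, \int[m]_s (K (t, s))%:E <= C%:E)%E ->
  (forall s, \int[m]_t (K (t, s))%:E <= C%:E)%E ->
  measurable_fun setT g ->
  (\int[m]_t \int[m]_s (`|g t| * `|g s| * K (t, s))%:E <= C%:E * \int[m]_t (g t ^+ 2)%:E)%E.
Proof.
move=> mK K0 C0 K1 K2 mg.
have mgg : measurable_fun setT (fun t => (g t ^+ 2)%:E).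
  by apply/measurable_EFinP; exact: measurable_funX.
have half (k : Y * Y -> R) : measurable_fun setT k -> (forall z, 0 <= k z) ->
    (forall t, \int[m]_s (k (t, s))%:E <= C%:E)%E ->
    (\int[m]_t \int[m]_s (2^-1 * g t ^+ 2 * k (t, s))%:E
     <= (2^-1)%:E * (C%:E * \int[m]_t (g t ^+ 2)%:E))%E.
  move=> mk k0 kC; rewrite -ge0_integralZl//; last first.
    by move=> t _; rewrite lee_fin sqr_ge0.
  rewrite -ge0_integralZl//; last 2 first.
  - exact: (measurable_funeM _ mgg).
  - by move=> t _; rewrite mule_ge0// lee_fin ?sqr_ge0.
  apply: ge0_le_integral => //.
  - move=> t _; apply: integral_ge0 => s _.
    by rewrite lee_fin mulr_ge0// mulr_ge0// sqr_ge0.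
  - apply: (@measurable_fun_Tonelli _ _ _ _ _ _ (fun z : Y * Y => 2^-1 * g z.1 ^+ 2 * k z)).
      apply: measurable_funM => //; apply: measurable_funM => //.
      by apply: measurable_funX; exact: (measurableT_comp mg measurable_fst).
    by move=> z; rewrite mulr_ge0// mulr_ge0// sqr_ge0.
  - exact: (measurable_funeM _ (measurable_funeM _ mgg)).
  move=> t _; under eq_integral do rewrite EFinM.
  rewrite ge0_integralZl//; last 3 first.
  - by apply/measurable_EFinP; exact: (measurable_fun_pair2 _ mk).
  - by move=> s _; rewrite lee_fin.
  - by rewrite lee_fin mulr_ge0 ?sqr_ge0.
  rewrite EFinM -muleA; apply: lee_wpmul2l; first by rewrite lee_fin.
  rewrite muleC; apply: lee_wpmul2r => //; by rewrite lee_fin sqr_ge0.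
pose K' (z : Y * Y) := K (z.2, z.1).
have mK' : measurable_fun setT K'.
  apply: (measurableT_comp mK).
  by apply: measurable_fun_pair; [exact: measurable_snd|exact: measurable_fst].
pose A (z : Y * Y) := (2^-1 * g z.1 ^+ 2 * K z)%:E.
pose B (z : Y * Y) := (2^-1 * g z.2 ^+ 2 * K z)%:E.
have A0 z : (0 <= A z)%E by rewrite lee_fin mulr_ge0// mulr_ge0// sqr_ge0.
have B0 z : (0 <= B z)%E by rewrite lee_fin mulr_ge0// mulr_ge0// sqr_ge0.
have mA : measurable_fun setT A.
  apply/measurable_EFinP; apply: measurable_funM => //; apply: measurable_funM => //.
  by apply: measurable_funX; exact: (measurableT_comp mg measurable_fst).
have mB : measurable_fun setT B.
  apply/measurable_EFinP; apply: measurable_funM => //; apply: measurable_funM => //.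
  by apply: measurable_funX; exact: (measurableT_comp mg measurable_snd).
apply: (@le_trans _ _ (\int[(m \x m)%E]_z (A z + B z))%E).
  rewrite (fubini_tonelli1 (A \+ B)%E); last 2 first.
  - exact: emeasurable_funD.
  - by move=> z; rewrite adde_ge0.
  apply: ge0_le_integral => //.
  - by move=> t _; apply: integral_ge0 => s _; rewrite lee_fin !mulr_ge0.
  - apply: (@measurable_fun_Tonelli _ _ _ _ _ _ (fun z : Y * Y => `|g z.1| * `|g z.2| * K z)).
      apply: measurable_funM => //; apply: measurable_funM.
        by apply: measurableT_comp => //; exact: (measurableT_comp mg measurable_fst).
      by apply: measurableT_comp => //; exact: (measurableT_comp mg measurable_snd).
    by move=> z; rewrite !mulr_ge0.
  - apply: (measurable_fun_fubini_tonelli_F (A \+ B)%E) => //.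
      exact: emeasurable_funD.
    by move=> z; rewrite adde_ge0.
  move=> t _; apply: ge0_le_integral => //.
  - by move=> s _; rewrite lee_fin !mulr_ge0.
  - apply/measurable_EFinP; apply: measurable_funM; last exact: (measurable_fun_pair2 _ mK).
    by apply: measurable_funM => //; exact: measurableT_comp.
  - by apply: (measurable_fun_pair2 t (emeasurable_funD mA mB)).
  move=> s _; rewrite /A /B -EFinD lee_fin -mulrDl ler_wpM2r//=.
  rewrite -(real_normK (num_real (g t))) -(real_normK (num_real (g s))).
  have := sqr_ge0 (`|g t| - `|g s|); rewrite sqrrB; lra.
rewrite ge0_integralD// [leRHS](_ : _ =
  (2^-1)%:E * (C%:E * \int[m]_t (g t ^+ 2)%:E) + (2^-1)%:E * (C%:E * \int[m]_t (g t ^+ 2)%:E))%E.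
  apply: leeD.
    by rewrite fubini_tonelli1//; exact: (half K).
  by rewrite fubini_tonelli2//; exact: (half K' mK' (fun=> K0 _) K2).
rewrite -ge0_muleDl ?lee_fin// -EFinD (_ : 2^-1 + 2^-1 = 1 :> R) ?mul1e//.
by lra.
Qed.

(** * Integration over the plane *)

(** The set function of [plane_measure] under a name of its own, to which
    the sigma-finite structure can be attached. *)
Definition plane_lebesgue (R : realType) :
  set (measurableTypeR R * measurableTypeR R)%type -> \bar R :=
  (@lebesgue_measure R \x @lebesgue_measure R)%E.

HB.instance Definition _ (R : realType) := Measure.copy (@plane_lebesgue R)
  (@lebesgue_measure R \x @lebesgue_measure R)%E.

HB.instance Definition _ (R : realType) :=
  @Measure_isSigmaFinite.Build _ _ _ (@plane_lebesgue R)
  (@isSigmaFinite.sigma_finiteT _ _ _ _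
    (lebesgue_integral_fubini.measure_function_Measure_isSigmaFinite__to__measure_function_isSigmaFinite
      (@lebesgue_measure R) (@lebesgue_measure R))).

Section plane_integrals.
Variable R : realType.
Notation lam := (@lebesgue_measure R).
Notation line := (measurableTypeR R).
Notation P := (line * line)%type.
Notation mu := (@plane_lebesgue R).

Lemma measurable_coord1 : measurable_fun [set: P] (fun t : P => t.1 : R).
Proof. exact: measurable_fst. Qed.

Lemma measurable_coord2 : measurable_fun [set: P] (fun t : P => t.2 : R).
Proof. exact: measurable_snd. Qed.

Lemma plane_Tonelli (f : P -> \bar R) :
  measurable_fun [set: P] f -> (forall z, 0 <= f z)%E ->
  (\int[mu]_z f z = \int[lam]_x \int[lam]_y f (x, y))%E.
Proof. exact: fubini_tonelli1. Qed.

Lemma plane_Rintegral_tensor (w g : line -> R) :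
  lam.-integrable setT (EFin \o w) -> lam.-integrable setT (EFin \o g) ->
  \int[mu]_z (w z.1 * g z.2) = \int[lam]_x w x * \int[lam]_y g y.
Proof. exact: Rintegral_tensor. Qed.

Lemma ge0_integral_plane_comp (phi psi : line -> line) (f : P -> \bar R) :
  measurable_fun [set: line] phi -> measurable_fun [set: line] psi ->
  (forall h : line -> \bar R, measurable_fun [set: line] h -> (forall x, 0 <= h x)%E ->
    \int[lam]_x h (phi x) = \int[lam]_x h x)%E ->
  (forall h : line -> \bar R, measurable_fun [set: line] h -> (forall x, 0 <= h x)%E ->
    \int[lam]_x h (psi x) = \int[lam]_x h x)%E ->
  measurable_fun [set: P] f -> (forall z, 0 <= f z)%E ->
  (\int[mu]_z f (phi z.1, psi z.2) = \int[mu]_z f z)%E.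
Proof.
move=> mphi mpsi Iphi Ipsi mf f0.
rewrite (@plane_Tonelli (fun z => f (phi z.1, psi z.2))); last 2 first.
- apply: (measurableT_comp mf); apply: measurable_fun_pair.
    by apply: (measurableT_comp mphi); exact: measurable_fst.
  by apply: (measurableT_comp mpsi); exact: measurable_snd.
- by move=> z; exact: f0.
rewrite (plane_Tonelli mf)//.
rewrite -(Iphi (fun x => \int[lam]_y f (x, y))%E); last 2 first.
- exact: (measurable_fun_fubini_tonelli_F f).
- by move=> x; apply: integral_ge0 => y _; exact: f0.
apply: eq_integral => x _; rewrite (Ipsi (fun y => f (phi x, y)))// => *; exact: (measurable_fun_pair2 _ mf).
Qed.

Lemma ge0_integral_plane_shift (c d : R) (f : P -> \bar R) :
  measurable_fun [set: P] f -> (forall z, 0 <= f z)%E ->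
  (\int[mu]_z f ((z.1 + c)%R, (z.2 + d)%R) = \int[mu]_z f z)%E.
Proof.
apply: (@ge0_integral_plane_comp (fun x => x + c) (fun x => x + d)).
- exact: measurable_shift.
- exact: measurable_shift.
- by move=> h mh h0; exact: ge0_integral_shift.
- by move=> h mh h0; exact: ge0_integral_shift.
Qed.

Lemma ge0_integral_plane_opp1 (f : P -> \bar R) :
  measurable_fun [set: P] f -> (forall z, 0 <= f z)%E ->
  (\int[mu]_z f ((- z.1)%R, z.2) = \int[mu]_z f z)%E.
Proof.
apply: (@ge0_integral_plane_comp (fun x => - x) id) => //.
- exact: measurable_opp.
- by move=> h mh h0; exact: ge0_integral_opp.
Qed.

Lemma ge0_integral_plane_opp2 (f : P -> \bar R) :
  measurable_fun [set: P] f -> (forall z, 0 <= f z)%E ->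
  (\int[mu]_z f (z.1, (- z.2)%R) = \int[mu]_z f z)%E.
Proof.
apply: (@ge0_integral_plane_comp id (fun x => - x)) => //.
- exact: measurable_opp.
- by move=> h mh h0; exact: ge0_integral_opp.
Qed.

Lemma measurable_plane_opp1 (f : P -> \bar R) : measurable_fun [set: P] f ->
  measurable_fun [set: P] (fun z : P => f ((- z.1)%R, z.2)).
Proof.
move=> mf; apply: (measurableT_comp mf); apply: measurable_fun_pair.
  exact: (measurableT_comp (@measurable_opp R) measurable_fst).
exact: measurable_snd.
Qed.

Lemma measurable_plane_opp2 (f : P -> \bar R) : measurable_fun [set: P] f ->
  measurable_fun [set: P] (fun z : P => f (z.1, (- z.2)%R)).
Proof.
move=> mf; apply: (measurableT_comp mf); apply: measurable_fun_pair.
  exact: measurable_fst.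
exact: (measurableT_comp (@measurable_opp R) measurable_snd).
Qed.

(** Used to average a function of the frequency over the sign changes of its
    coordinates. *)
Lemma ge0_integral_plane_reflect (f : P -> \bar R) :
  measurable_fun [set: P] f -> (forall z, 0 <= f z)%E ->
  (\int[mu]_z (f z + f ((- z.1)%R, z.2) + (f (z.1, (- z.2)%R) + f ((- z.1)%R, (- z.2)%R)))
   = 4%:E * \int[mu]_z f z)%E.
Proof.
move=> mf f0; have m1 := measurable_plane_opp1 mf; have m2 := measurable_plane_opp2 mf.
have m12 := measurable_plane_opp1 m2.
have I12 : (\int[mu]_z f ((- z.1)%R, (- z.2)%R) = \int[mu]_z f z)%E.
  rewrite -[RHS](ge0_integral_plane_opp2 mf f0).
  by rewrite -[RHS](ge0_integral_plane_opp1 m2).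
rewrite (ge0_integralD _ _ (f1 := fun z => f z + f ((- z.1)%R, z.2))
  (f2 := fun z => f (z.1, (- z.2)%R) + f ((- z.1)%R, (- z.2)%R)))%E//; last 4 first.
- by move=> z _; rewrite adde_ge0.
- exact: emeasurable_funD.
- by move=> z _; rewrite adde_ge0.
- exact: emeasurable_funD.
rewrite !ge0_integralD// I12 ge0_integral_plane_opp1// ge0_integral_plane_opp2//.
have : (0 <= \int[mu]_z f z)%E by apply: integral_ge0.
case: (\int[mu]_z f z)%E => [r _||//].
  by rewrite -!EFinD -EFinM; congr EFin; ring.
by rewrite gt0_muley.
Qed.

End plane_integrals.

(** * Sine-cosine transforms and Bessel's inequality *)

Section trig_transform.
Variable R : realType.
Notation lam := (@lebesgue_measure R).
Notation line := (measurableTypeR R).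
Notation P := (line * line)%type.
Notation mu := (@plane_lebesgue R).
Variables (b1 b2 : R).
Hypotheses (b1_neq0 : b1 != 0) (b2_neq0 : b2 != 0).
Implicit Types (g : P -> R) (u t s : P) (i : bool * bool).

Definition trig (p : bool) (x : R) := if p then sin x else cos x.

(** Up to sign, the four real components of the product of the exponentials
    [exp (- i b1 u_1 t_1)] and [exp (- j b2 u_2 t_2)]; the true value stands
    for the sine. *)
Definition trig_kernel i (z : P * P) : R :=
  trig i.1 (b1 * z.1.1 * z.2.1) * trig i.2 (b2 * z.1.2 * z.2.2).

Definition trig_transform i g u : R := \int[mu]_t (g t * trig_kernel i (u, t)).

Definition trig_indices := [:: (false, false); (true, false); (false, true); (true, true)].

Definition energy g u : R := \sum_(i <- trig_indices) trig_transform i g u ^+ 2.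

Lemma trig_le1 p x : `|trig p x| <= 1.
Proof. by rewrite ler_norml; case: p; rewrite /= ?sin_geN1 ?sin_le1 ?cos_geN1 ?cos_le1. Qed.

Lemma continuous_trig p : continuous (trig p).
Proof. by case: p; [exact: continuous_sin|exact: continuous_cos]. Qed.

Lemma measurable_trig p : measurable_fun setT (trig p).
Proof. by apply: continuous_measurable_fun; exact: continuous_trig. Qed.

Lemma trig_kernel_le1 i z : `|trig_kernel i z| <= 1.
Proof. by rewrite normrM -[leRHS]mulr1 ler_pM// trig_le1. Qed.

Lemma measurable_trig_kernel i : measurable_fun setT (trig_kernel i).
Proof.
apply: measurable_funM; apply: (measurableT_comp (measurable_trig _)).
- apply: measurable_funM; last exact: (measurableT_comp (@measurable_coord1 R) measurable_snd).
  apply: measurable_funM => //; exact: (measurableT_comp (@measurable_coord1 R) measurable_fst).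
- apply: measurable_funM; last exact: (measurableT_comp (@measurable_coord2 R) measurable_snd).
  apply: measurable_funM => //; exact: (measurableT_comp (@measurable_coord2 R) measurable_fst).
Qed.

(** The addition formula makes the Gram kernel depend on the differences
    [t - s] only, and as a product over the two coordinates. *)
Lemma trig_kernel_gram u t s :
  \sum_(i <- trig_indices) trig_kernel i (u, t) * trig_kernel i (u, s) =
  cos (b1 * (t.1 - s.1) * u.1) * cos (b2 * (t.2 - s.2) * u.2).
Proof.
have cosBE (b x y z : R) : cos (b * (x - y) * z) =
    cos (b * z * x) * cos (b * z * y) + sin (b * z * x) * sin (b * z * y).
  by rewrite (_ : b * (x - y) * z = b * z * x - b * z * y) ?cosB//; ring.
rewrite /trig_indices !big_cons big_nil /trig_kernel /= !cosBE; ring.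
Qed.

(** A frequency cutoff that is integrable, tends to 1 with [e], and whose
    Fourier transform is known in closed form. *)
Definition exp_weight (e : R) u : R := expR (- e * `|u.1|) * expR (- e * `|u.2|).

Lemma integrable_exp_weight e : 0 < e -> mu.-integrable setT (EFin \o exp_weight e).
Proof.
by move=> e0; exact: (integrable_tensor (integrable_expabs e0) (integrable_expabs e0)).
Qed.

Definition plane_poisson e (z : P * P) : R :=
  poisson e (b1 * (z.1.1 - z.2.1)) * poisson e (b2 * (z.1.2 - z.2.2)).

Lemma Rintegral_expabs_cos e x : 0 < e ->
  \int[lam]_w (expR (- e * `|w|) * cos (x * w)) = poisson e x.
Proof. by move=> e0; rewrite /Rintegral integral_expabs_cos. Qed.

Lemma weighted_energyE e g : 0 < e -> mu.-integrable setT (EFin \o g) ->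
  \int[mu]_u (exp_weight e u * energy g u) =
  \int[mu]_t (g t * \int[mu]_s (g s * plane_poisson e (t, s))).
Proof.
move=> e0 ig; rewrite (@weighted_energy R _ _ P P mu mu (exp_weight e) g _ trig_indices trig_kernel 1
  (integrable_exp_weight e0) ig measurable_trig_kernel trig_kernel_le1).
apply: eq_Rintegral => t _; congr (_ * _); apply: eq_Rintegral => s _; congr (_ * _).
rewrite /plane_poisson -!Rintegral_expabs_cos//.
rewrite -(plane_Rintegral_tensor (integrable_expabs_cos _ e0) (integrable_expabs_cos _ e0)).
by apply: eq_Rintegral => u _; rewrite trig_kernel_gram /exp_weight /=; ring.
Qed.

Lemma measurable_plane_poisson e : 0 < e -> measurable_fun setT (plane_poisson e).
Proof.
move=> e0; have mp : measurable_fun setT (poisson e).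
  by apply: continuous_measurable_fun; exact: continuous_poisson.
apply: measurable_funM; apply: (measurableT_comp mp); apply: measurable_funM => //;
  apply: measurable_funB.
- exact: (measurableT_comp (@measurable_coord1 R) measurable_fst).
- exact: (measurableT_comp (@measurable_coord1 R) measurable_snd).
- exact: (measurableT_comp (@measurable_coord2 R) measurable_fst).
- exact: (measurableT_comp (@measurable_coord2 R) measurable_snd).
Qed.

Lemma plane_poisson_ge0 e z : 0 < e -> 0 <= plane_poisson e z.
Proof. by move=> e0; rewrite mulr_ge0 ?poisson_ge0. Qed.

Lemma plane_poissonC e t s : plane_poisson e (t, s) = plane_poisson e (s, t).
Proof.
by rewrite /plane_poisson /poisson /= -(opprB s.1) -(opprB s.2) !mulrN !sqrrN.
Qed.

(** The constant of Plancherel's identity, [(2 pi) ^ 2 / |b1 b2|]; it is the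
    mass of the Poisson kernel for every [e]. *)
Definition trig_mass : R := (2 * pi / `|b1|) * (2 * pi / `|b2|).

Lemma trig_mass_gt0 : 0 < trig_mass.
Proof.
by rewrite mulr_gt0// divr_gt0 ?normr_gt0// mulr_gt0 ?pi_gt0.
Qed.

Lemma integral_plane_poisson e t : 0 < e ->
  (\int[mu]_s (plane_poisson e (t, s))%:E = trig_mass%:E)%E.
Proof.
move=> e0; rewrite (@plane_Tonelli _ (fun s => (plane_poisson e (t, s))%:E)); first last.
- by move=> s; rewrite lee_fin plane_poisson_ge0.
- apply/measurable_EFinP.
  by apply: (measurable_fun_pair2 t); exact: measurable_plane_poisson.
rewrite /plane_poisson /=.
under eq_integral => x _.
  under eq_integral do rewrite EFinM.
  rewrite ge0_integralZl//; last 3 first.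
  - apply/measurable_EFinP; apply: continuous_measurable_fun => y.
    apply: (@continuous_comp _ _ _ (fun y => b2 * (t.2 - y))).
      by apply: cvgM; [exact: cvg_cst|apply: cvgB; [exact: cvg_cst|exact: cvg_id]].
    exact: continuous_poisson.
  - by move=> y _; rewrite lee_fin poisson_ge0.
  - by rewrite lee_fin poisson_ge0.
  rewrite integral_poisson//.
  over.
rewrite ge0_integralZr//; last 3 first.
- apply/measurable_EFinP; apply: continuous_measurable_fun => y.
  apply: (@continuous_comp _ _ _ (fun y => b1 * (t.1 - y))).
    by apply: cvgM; [exact: cvg_cst|apply: cvgB; [exact: cvg_cst|exact: cvg_id]].
  exact: continuous_poisson.
- by move=> y _; rewrite lee_fin poisson_ge0.
- by rewrite lee_fin divr_ge0// mulr_ge0// pi_ge0.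
by rewrite integral_poisson// -EFinM.
Qed.

End trig_transform.

(** If [f] is not integrable, the left-hand side is the default value 0. *)
Lemma EFin_Rintegral_le (R : realType) d (T : measurableType d)
    (mu : {measure set T -> \bar R}) (f : T -> R) :
  measurable_fun setT f ->
  (`|\int[mu]_x f x|%:E <= \int[mu]_x (`|f x|)%:E)%E.
Proof.
move=> mf; have mF : measurable_fun setT (EFin \o f) by exact/measurable_EFinP.
apply: (@le_trans _ _ `|\int[mu]_x (EFin \o f) x|)%E; last first.
  by have := le_abse_integral mu measurableT mF; rewrite /comp /=.
rewrite /Rintegral; case: (\int[mu]_x _)%E => [r||] //=.
- by rewrite normr0 leey.
- by rewrite normr0 leey.
Qed.

Section bessel.
Variable R : realType.
Notation line := (measurableTypeR R).
Notation P := (line * line)%type.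
Notation mu := (@plane_lebesgue R).
Variables (b1 b2 : R).
Hypotheses (b1_neq0 : b1 != 0) (b2_neq0 : b2 != 0).
Implicit Types (g : P -> R) (u t s : P) (i : bool * bool).
Notation energy := (energy b1 b2).
Notation trig_transform := (trig_transform b1 b2).
Notation trig_mass := (trig_mass b1 b2).

Lemma measurable_trig_transform i g : mu.-integrable setT (EFin \o g) ->
  measurable_fun setT (trig_transform i g).
Proof.
by move=> ig; exact: (measurable_kernel_transform ig (measurable_trig_kernel b1 b2 i)).
Qed.

Lemma trig_transform_le i g u : mu.-integrable setT (EFin \o g) ->
  `|trig_transform i g u| <= \int[mu]_t `|g t|.
Proof.
move=> ig; have := kernel_transform_bounded ig (measurable_trig_kernel b1 b2 i)
  (trig_kernel_le1 b1 b2 i) u.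
by rewrite mul1r.
Qed.

Lemma measurable_energy g : mu.-integrable setT (EFin \o g) ->
  measurable_fun setT (energy g).
Proof.
move=> ig; rewrite /energy; apply: measurable_sum => i.
by apply: measurable_funX; exact: measurable_trig_transform.
Qed.

Lemma energy_ge0 g u : 0 <= energy g u.
Proof. by apply: sumr_ge0 => i _; exact: sqr_ge0. Qed.

Lemma energy_bounded g u : mu.-integrable setT (EFin \o g) ->
  `|energy g u| <= 4 * (\int[mu]_t `|g t|) ^+ 2.
Proof.
move=> ig; rewrite ger0_norm ?energy_ge0// /energy /trig_indices !big_cons big_nil.
have h i : trig_transform i g u ^+ 2 <= (\int[mu]_t `|g t|) ^+ 2.
  have M0 : 0 <= \int[mu]_t `|g t| by apply: Rintegral_ge0 => t _.
  rewrite -(real_normK (num_real (trig_transform _ _ _))).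
  by rewrite ler_sqr ?nnegrE ?normr_ge0// trig_transform_le.
have := h (false, false); have := h (true, false); have := h (false, true).
by have := h (true, true); lra.
Qed.

Lemma cvg_integral_exp_weight (F : P -> R) : measurable_fun setT F ->
  (forall u, 0 <= F u) ->
  (\int[mu]_u (exp_weight n.+1%:R^-1 u * F u)%:E @[n --> \oo] -->
   \int[mu]_u (F u)%:E)%E.
Proof.
move=> mF F0.
have mw e : measurable_fun setT (exp_weight e : P -> R).
  have me : measurable_fun setT (fun x : R => expR (- e * `|x|)).
    apply: continuous_measurable_fun => x.
    apply: (@continuous_comp _ _ _ (fun x => - e * `|x|) expR); last exact: continuous_expR.
    by apply: cvgM; [exact: cvg_cst|exact: norm_continuous].
  apply: measurable_funM; apply: (measurableT_comp me).
    exact: measurable_coord1.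
  exact: measurable_coord2.
have wle e1 e2 u : e1 <= e2 -> exp_weight e2 u <= exp_weight e1 u :> R.
  by move=> e12; rewrite /exp_weight ler_pM ?expR_ge0// ler_expR !mulNr lerN2 ler_wpM2r.
have := @cvg_monotone_convergence _ P R mu setT measurableT
  (fun n u => (exp_weight n.+1%:R^-1 u * F u)%:E).
have -> : (fun x => limn ((fun n u => (exp_weight n.+1%:R^-1 u * F u)%:E)^~ x)) = EFin \o F.
  apply/funext => u; apply/cvg_lim => //; apply: cvg_EFin; first exact: nearW.
  rewrite -[X in _ --> X]mul1r; apply: cvgM; last exact: cvg_cst.
  have ew (x : R) : expR (- n.+1%:R^-1 * x) @[n --> \oo] --> (1 : R).
    have h0 : (- n.+1%:R^-1 * x) @[n --> \oo] --> (0 : R).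
      rewrite -[X in _ --> X](mul0r x) -oppr0; apply: cvgM; last exact: cvg_cst.
      by apply: cvgN; exact: cvg_harmonic.
    by have := cvg_comp _ _ h0 (@continuous_expR R 0); rewrite expR0; exact.
  by rewrite -[X in _ --> X]mulr1; apply: cvgM; exact: ew.
apply.
- by move=> n; apply/measurable_EFinP; exact: measurable_funM.
- by move=> n u _; rewrite lee_fin mulr_ge0// mulr_ge0// expR_ge0.
- move=> u _ n m nm; rewrite lee_fin ler_wpM2r// wle// lef_pV2 ?posrE//.
  by rewrite ler_nat.
Qed.

Lemma EFin_weighted_energy (e : R) g : 0 < e -> mu.-integrable setT (EFin \o g) ->
  (\int[mu]_u (exp_weight e u * energy g u)%:E =
   (\int[mu]_t (g t * \int[mu]_s (g s * plane_poisson b1 b2 e (t, s))))%:E)%E.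
Proof.
move=> e0 ig; rewrite -weighted_energyE// fineK//.
apply: integrable_fin_num => //.
apply: (integrable_bounded_mul (integrable_exp_weight e0) (measurable_energy ig)).
by move=> u; exact: energy_bounded.
Qed.

(** The damped energy is a Poisson quadratic form, which Schur's test bounds
    uniformly in the cutoff by the mass of the kernel. *)
Lemma bessel g : mu.-integrable setT (EFin \o g) ->
  (\int[mu]_u (energy g u)%:E <= trig_mass%:E * \int[mu]_t (g t ^+ 2)%:E)%E.
Proof.
move=> ig; have mg : measurable_fun setT g by have /measurable_int/measurable_EFinP := ig.
have hcvg := cvg_integral_exp_weight (measurable_energy ig) (energy_ge0 g).
rewrite -(cvg_lim _ hcvg)//; apply: lime_le; first by apply/cvg_ex; eexists; exact: hcvg.
apply: nearW => n; have e0 : 0 < n.+1%:R^-1 :> R by [].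
rewrite EFin_weighted_energy//.
have mK := measurable_plane_poisson b1 b2 e0.
have K0 z := plane_poisson_ge0 b1 b2 z e0.
apply: le_trans (schur_test (m := mu) mK K0 (ltW (trig_mass_gt0 b1_neq0 b2_neq0)) _ _ mg); last 2 first.
- by move=> t; rewrite integral_plane_poisson.
- by move=> s; under eq_integral do rewrite plane_poissonC; rewrite integral_plane_poisson.
have mgK : measurable_fun setT (fun z : P * P => g z.2 * plane_poisson b1 b2 n.+1%:R^-1 z).
  by apply: measurable_funM => //; exact: (measurableT_comp mg measurable_snd).
have mI : measurable_fun setT (fun t => \int[mu]_s (g s * plane_poisson b1 b2 n.+1%:R^-1 (t, s))).
  exact: (measurable_kernel_transform ig mK).
apply: (@le_trans _ _ (`|\int[mu]_t (g t * \int[mu]_s (g s * plane_poisson b1 b2 n.+1%:R^-1 (t, s)))|%:E)).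
  by rewrite lee_fin ler_norm.
apply: le_trans (EFin_Rintegral_le mu _) _; first exact: measurable_funM.
apply: ge0_le_integral => //.
- by apply/measurable_EFinP; apply: measurableT_comp => //; exact: measurable_funM.
- apply: (@measurable_fun_Tonelli _ _ _ _ _ mu
    (fun z : P * P => `|g z.1| * `|g z.2| * plane_poisson b1 b2 n.+1%:R^-1 z)).
    apply: measurable_funM => //; apply: measurable_funM.
      by apply: measurableT_comp => //; exact: (measurableT_comp mg measurable_fst).
    by apply: measurableT_comp => //; exact: (measurableT_comp mg measurable_snd).
  by move=> z; rewrite mulr_ge0// mulr_ge0.
move=> t _; rewrite normrM EFinM.
under [leRHS]eq_integral do rewrite -mulrA EFinM.
rewrite ge0_integralZl//; last 2 first.
- apply/measurable_EFinP; apply: measurable_funM; first exact: measurableT_comp.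
  exact: (measurable_fun_pair2 _ mK).
- by move=> s _; rewrite lee_fin mulr_ge0.
apply: lee_wpmul2l; first by rewrite lee_fin.
apply: le_trans (EFin_Rintegral_le mu _) _; first exact: (measurable_fun_pair2 _ mgK).
by under eq_integral do rewrite normrM (ger0_norm (K0 _)).
Qed.

End bessel.

(** * Boxes in the plane *)

Section plane_boxes.
Variable R : realType.
Notation line := (measurableTypeR R).
Notation P := (line * line)%type.

Definition boxes : set (set P) := [set I `*` J | I in @ocitv R & J in @ocitv R].

Lemma boxes_setI : setI_closed boxes.
Proof.
move=> _ _ [I oI [J oJ <-]] [I' oI' [J' oJ' <-]].
exists (I `&` I'); first exact: ocitvI.
by exists (J `&` J'); [exact: ocitvI|rewrite setXI].
Qed.

Let sG : sigma_algebra setT <<s boxes >> := smallest_sigma_algebra _ _.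

Let line_cover : \bigcup_n `](- n%:R : R), n%:R]%classic = [set: line].
Proof.
apply/seteqP; split => // x _.
exists (Num.truncn `|x|).+1 => //=; rewrite in_itv/=.
have := truncnS_gt `|x|; set n := (Num.truncn _).+1 => xn.
by move: xn; rewrite ltr_norml => /andP[-> /ltW].
Qed.

Lemma sub_measurable_boxes : @measurable _ P `<=` <<s boxes >>.
Proof.
have [s0 sD sU] := sG.
have sI A B : <<s boxes >> A -> <<s boxes >> B -> <<s boxes >> (A `&` B).
  move=> hA hB; rewrite -(setCK A) -(setCK B) -setCU -setTD; apply: (sD).
  rewrite -bigcup2E; apply: (sU) => -[|[|n]] /=; rewrite ?setTD//.
  - by rewrite -setTD; exact: sD.
  - by rewrite -setTD; exact: sD.
rewrite measurable_prod_measurableType; apply: smallest_sub => // _ [A mA [B mB <-]].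
have -> : A `*` B = (A `*` setT) `&` (setT `*` B) by rewrite -setXI setIT setTI.
apply: sI.
- have : @measurable _ line `<=` [set A | <<s boxes >> (A `*` setT)].
    apply: smallest_sub; first split => /=.
    + by rewrite set0X.
    + move=> X hX; rewrite (_ : (_ `*` _) = setT `\` (X `*` setT)); first exact: sD.
      apply/seteqP; split => -[x y] /= => [[[_ nX] _]|[_ nX]].
        by split=> // -[/nX].
      by split=> //; split => // hx; apply: (nX).
    + move=> F hF; rewrite setX_bigcupl; exact: sU.
    move=> I oI /=; rewrite -line_cover setX_bigcupr; apply: (sU) => n.
    apply: sub_sigma_algebra; exists I; first exact: oI.
    by exists `](- n%:R), n%:R]%classic => //; exact: is_ocitv.
  by apply.
- have : @measurable _ line `<=` [set B | <<s boxes >> (setT `*` B)].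
    apply: smallest_sub; first split => /=.
    + by rewrite setX0.
    + move=> X hX; rewrite (_ : (_ `*` _) = setT `\` (setT `*` X)); first exact: sD.
      apply/seteqP; split => -[x y] /= => [[_ [_ nX]]|[_ nX]].
        by split=> // -[_ /nX].
      by split=> //; split => // hx; apply: (nX).
    + move=> F hF; rewrite setX_bigcupr; exact: sU.
    move=> I oI /=; rewrite -line_cover setX_bigcupl; apply: (sU) => n.
    apply: sub_sigma_algebra; exists `](- n%:R), n%:R]%classic; first exact: is_ocitv.
    by exists I => //; exact: oI.
  by apply.
Qed.

(** Boxes are stable under intersection and generate the Borel sets. *)
Lemma boxes_dynkin (H : set (set P)) : lambda_system setT H -> boxes `<=` H ->
  @measurable _ P `<=` H.
Proof.
move=> lH GH; apply: subset_trans sub_measurable_boxes _.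
by apply: (lambda_system_subset boxes_setI lH GH).
Qed.

End plane_boxes.

(** * Parseval's identity for real functions *)

Section parseval.
Variable R : realType.
Notation line := (measurableTypeR R).
Notation P := (line * line)%type.
Notation mu := (@plane_lebesgue R).
Variables (b1 b2 : R).
Hypotheses (b1_neq0 : b1 != 0) (b2_neq0 : b2 != 0).
Implicit Types (g h : P -> R) (u t : P) (i : bool * bool).
Notation energy := (energy b1 b2).
Notation trig_transform := (trig_transform b1 b2).
Notation trig_mass := (trig_mass b1 b2).

Definition L12 g := mu.-integrable setT (EFin \o g) /\
  mu.-integrable setT (EFin \o (fun t => g t ^+ 2)).

Lemma L12_measurable g : L12 g -> measurable_fun setT g.
Proof. by move=> [ig _]; have /measurable_int/measurable_EFinP := ig. Qed.

Lemma L12D g h : L12 g -> L12 h -> L12 (fun t => g t + h t).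
Proof.
move=> Lg Lh; have mg := L12_measurable Lg; have mh := L12_measurable Lh.
have [ig ig2] := Lg; have [ih ih2] := Lh.
split; first by apply: (integrableD measurableT ig ih).
apply: le_integrable (integrableZl measurableT 2 (integrableD measurableT ig2 ih2)) => //.
  by apply/measurable_EFinP; apply: measurable_funX; exact: measurable_funD.
move=> t _; rewrite !abse_EFin lee_fin !ger0_norm ?sqr_ge0//.
- by have := sqr_ge0 (g t - h t); lra.
- by have := (sqr_ge0 (g t), sqr_ge0 (h t)) => -[]; lra.
Qed.

Lemma L12Z c g : L12 g -> L12 (fun t => c * g t).
Proof.
move=> [ig ig2]; split; first exact: (integrableZl measurableT c ig).
apply: eq_integrable (integrableZl measurableT (c ^+ 2) ig2) => // t _ /=.
by rewrite exprMn EFinM.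
Qed.

Lemma L12B g h : L12 g -> L12 h -> L12 (fun t => g t - h t).
Proof.
move=> Lg Lh; have := L12D Lg (L12Z (-1) Lh).
by under eq_fun do rewrite mulN1r.
Qed.

Lemma trig_transformD i g h u : L12 g -> L12 h ->
  trig_transform i (fun t => g t + h t) u = trig_transform i g u + trig_transform i h u.
Proof.
move=> [ig _] [ih _]; rewrite -RintegralD//.
- by apply: eq_Rintegral => t _; rewrite mulrDl.
- apply: (integrable_bounded_mul ig _ (fun t => trig_kernel_le1 b1 b2 i (u, t))).
  exact: (measurable_fun_pair2 _ (measurable_trig_kernel b1 b2 i)).
- apply: (integrable_bounded_mul ih _ (fun t => trig_kernel_le1 b1 b2 i (u, t))).
  exact: (measurable_fun_pair2 _ (measurable_trig_kernel b1 b2 i)).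
Qed.

Lemma trig_transformZ i c g u : L12 g ->
  trig_transform i (fun t => c * g t) u = c * trig_transform i g u.
Proof.
move=> [ig _]; rewrite -RintegralZl//.
- by apply: eq_Rintegral => t _; rewrite mulrA.
- apply: (integrable_bounded_mul ig _ (fun t => trig_kernel_le1 b1 b2 i (u, t))).
  exact: (measurable_fun_pair2 _ (measurable_trig_kernel b1 b2 i)).
Qed.

Lemma energyZ c g u : L12 g -> energy (fun t => c * g t) u = c ^+ 2 * energy g u.
Proof.
move=> Lg; rewrite mulr_sumr; apply: eq_bigr => i _.
by rewrite trig_transformZ// exprMn.
Qed.

Lemma energy_parallelogram g h u : L12 g -> L12 h ->
  energy (fun t => g t + h t) u + energy (fun t => g t - h t) u
  = 2 * energy g u + 2 * energy h u.
Proof.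
move=> Lg Lh; rewrite -big_split/= !mulr_sumr -big_split/=; apply: eq_bigr => i _.
have -> : (fun t => g t - h t) = (fun t => g t + -1 * h t).
  by apply/funext => t; rewrite mulN1r.
by rewrite !trig_transformD ?trig_transformZ//; [ring|exact: L12Z].
Qed.

Lemma energy_integrable g : L12 g -> mu.-integrable setT (EFin \o energy g).
Proof.
move=> [ig ig2]; apply/integrableP; split.
  by apply/measurable_EFinP; exact: measurable_energy.
rewrite (@eq_integral _ _ _ _ _ (EFin \o energy g))//; last first.
  by move=> t _ /=; rewrite ger0_norm ?energy_ge0.
apply: le_lt_trans (bessel b1_neq0 b2_neq0 ig) _.
rewrite lte_mul_pinfty ?lee_fin ?(ltW (trig_mass_gt0 _ _))//.
have /integrableP[_] := ig2; congr (_ < _)%E.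
by apply: eq_integral => t _ /=; rewrite ger0_norm ?sqr_ge0.
Qed.

(** The failure of Parseval's identity. It is a quadratic form, nonnegative
    by Bessel's inequality, so that its zeros form a linear space closed for
    the norm. *)
Definition defect g : R :=
  trig_mass * (\int[mu]_t (g t ^+ 2)) - \int[mu]_u energy g u.

Lemma defect_ge0 g : L12 g -> 0 <= defect g.
Proof.
move=> Lg; rewrite subr_ge0 -lee_fin EFinM !fineK; first exact: (bessel _ _ Lg.1).
- exact: (integrable_fin_num _ Lg.2).
- exact: (integrable_fin_num _ (energy_integrable Lg)).
Qed.

Lemma defect_le g : L12 g -> defect g <= trig_mass * (\int[mu]_t (g t ^+ 2)).
Proof.
by move=> Lg; rewrite gerBl Rintegral_ge0// => u _; exact: energy_ge0.
Qed.

Lemma defectZ c g : L12 g -> defect (fun t => c * g t) = c ^+ 2 * defect g.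
Proof.
move=> Lg; rewrite /defect mulrBr mulrCA.
congr (_ * _ - _).
  by rewrite -RintegralZl//; [apply: eq_Rintegral => t _; rewrite exprMn|exact: Lg.2].
rewrite -RintegralZl//; last exact: energy_integrable.
by apply: eq_Rintegral => t _; exact: energyZ.
Qed.

Lemma defect_parallelogram g h : L12 g -> L12 h ->
  defect (fun t => g t + h t) + defect (fun t => g t - h t)
  = 2 * defect g + 2 * defect h.
Proof.
move=> Lg Lh; have LD := L12D Lg Lh; have LB := L12B Lg Lh.
have E2 : \int[mu]_t ((g t + h t) ^+ 2) + \int[mu]_t ((g t - h t) ^+ 2) =
    2 * \int[mu]_t (g t ^+ 2) + 2 * \int[mu]_t (h t ^+ 2).
  rewrite -mulrDr -!RintegralD//; [|exact: Lg.2|exact: Lh.2|exact: LD.2|exact: LB.2].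
  rewrite -RintegralZl//; last exact: (integrableD measurableT Lg.2 Lh.2).
  by apply: eq_Rintegral => t _; ring.
have EE : \int[mu]_u energy (fun t => g t + h t) u + \int[mu]_u energy (fun t => g t - h t) u =
    2 * \int[mu]_u energy g u + 2 * \int[mu]_u energy h u.
  have iE := energy_integrable.
  rewrite -mulrDr -!RintegralD//; [|exact: iE Lg|exact: iE Lh|exact: iE LD|exact: iE LB].
  rewrite -RintegralZl//; last exact: (integrableD measurableT (iE _ Lg) (iE _ Lh)).
  by apply: eq_Rintegral => t _; rewrite energy_parallelogram// mulrDr.
rewrite /defect addrACA -opprD EE -mulrDr E2.
move: (\int[mu]_t (g t ^+ 2)) (\int[mu]_t (h t ^+ 2)) (\int[mu]_u energy g u)
  (\int[mu]_u energy h u) => *; ring.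
Qed.

Definition parseval_class g := L12 g /\ defect g = 0.

Lemma defectD_le g h : L12 g -> L12 h ->
  defect (fun t => g t + h t) <= 2 * defect g + 2 * defect h.
Proof.
move=> Lg Lh; rewrite -defect_parallelogram// lerDl.
by apply: defect_ge0; exact: L12B.
Qed.

Lemma parseval_classD g h : parseval_class g -> parseval_class h ->
  parseval_class (fun t => g t + h t).
Proof.
move=> [Lg g0] [Lh h0]; have LD := L12D Lg Lh; split; first exact: LD.
apply/eqP; rewrite eq_le defect_ge0// andbT.
by apply: le_trans (defectD_le Lg Lh) _; rewrite g0 h0 !mulr0 addr0.
Qed.

Lemma parseval_classZ c g : parseval_class g -> parseval_class (fun t => c * g t).
Proof.
by move=> [Lg g0]; split; [exact: L12Z|rewrite defectZ// g0 mulr0].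
Qed.

Lemma parseval_classB g h : parseval_class g -> parseval_class h ->
  parseval_class (fun t => g t - h t).
Proof.
move=> Lg Lh; have := parseval_classD Lg (parseval_classZ (-1) Lh).
by under eq_fun do rewrite mulN1r.
Qed.

Lemma parseval_class0 : parseval_class (fun=> 0).
Proof.
have L0 : L12 (fun=> 0).
  split; first exact: integrable0.
  by under eq_fun do rewrite /= expr0n; exact: integrable0.
have := defectZ 0 L0.
under eq_fun do rewrite mul0r.
by rewrite expr0n mul0r; split.
Qed.

Lemma parseval_class_sum (I : Type) (r : seq I) (F : I -> P -> R) :
  (forall k, parseval_class (F k)) -> parseval_class (fun t => \sum_(k <- r) F k t).
Proof.
move=> hF; elim: r => [|i r IH].
  rewrite (_ : (fun t => _) = fun=> 0); first exact: parseval_class0.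
  by apply/funext => t; rewrite big_nil.
rewrite (_ : (fun t => _) = fun t => F i t + \sum_(k <- r) F k t); first exact: (parseval_classD (hF i) IH).
by apply/funext => t; rewrite big_cons.
Qed.

(** The class is closed: by the parallelogram law
    [defect g <= 2 defect (g - g_n) <= 2 C |g - g_n|^2]. *)
Lemma parseval_class_lim (g_ : nat -> P -> R) g : L12 g ->
  (forall n, parseval_class (g_ n)) ->
  (\int[mu]_t ((g t - g_ n t) ^+ 2)%:E @[n --> \oo] --> 0)%E ->
  parseval_class g.
Proof.
move=> Lg hg hlim; split=> //; apply/eqP; rewrite eq_le defect_ge0// andbT.
have h0 : \int[mu]_t ((g t - g_ n t) ^+ 2) @[n --> \oo] --> 0.
  exact: (fine_cvg hlim).
have h1 : 2 * (trig_mass * \int[mu]_t ((g t - g_ n t) ^+ 2)) @[n --> \oo] --> 0.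
  rewrite -[X in _ --> X](mulr0 2); apply: cvgM; first exact: cvg_cst.
  by rewrite -[X in _ --> X](mulr0 trig_mass); apply: cvgM => //; exact: cvg_cst.
rewrite -(cvg_lim _ h1)//; apply: limr_ge; first by apply/cvg_ex; eexists; exact: h1.
apply: nearW => n; have [Ln n0] := hg n.
have := defectD_le (L12B Lg Ln) Ln; rewrite n0 mulr0 addr0.
under [X in defect X]eq_fun do rewrite subrK.
by move/le_trans; apply; rewrite ler_pM2l//; apply: defect_le; exact: L12B.
Qed.

End parseval.

Section parseval_boxes.
Variable R : realType.
Notation lam := (@lebesgue_measure R).
Notation line := (measurableTypeR R).
Implicit Types (a b : R).

Lemma poisson_le (e x : R) : 0 < e -> `|poisson e x| <= 2 / e.
Proof.
move=> e0; rewrite ger0_norm ?poisson_ge0// /poisson.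
have d0 : 0 < e ^+ 2 + x ^+ 2 by rewrite ltr_pwDl ?exprn_gt0// sqr_ge0.
rewrite ler_pdivrMr// mulrAC ler_pdivlMr//.
by have := sqr_ge0 x; lra.
Qed.

Lemma integrable_indic_line a b :
  lam.-integrable setT (EFin \o (\1_(`]a, b]%classic : set line) : line -> R)).
Proof. exact: (integrable_indic_itv a b false false). Qed.

Lemma cvg_poisson_square_indic b1 a b : b1 != 0 -> a < b ->
  \int[lam]_x (\1_(`]a, b]%classic : set line) x * \int[lam]_y (\1_(`]a, b]%classic : set line) y *
     poisson n.+1%:R^-1 (b1 * (x - y)))) @[n --> \oo] --> 2 * pi / `|b1| * (b - a).
Proof.
move=> b10 ab; have h := cvg_poisson_square b10 ab.
rewrite (_ : (fun n => _) = fine \o (fun n => (\int[lam]_(t in `]a, b]) \int[lam]_(s in `]a, b])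
     (poisson n.+1%:R^-1 (b1 * (t - s)))%:E)%E)); first exact: fine_cvg.
apply/funext => n; apply/esym.
rewrite /= /Rintegral; congr fine.
rewrite [LHS]integral_mkcond; apply: eq_integral => x _.
rewrite patchE indicE; case: ifP => _; rewrite ?mul1r ?mul0r// fineK.
  rewrite [LHS]integral_mkcond; apply: eq_integral => y _.
  by rewrite patchE indicE; case: ifP => _; rewrite ?mul1r ?mul0r.
have e0 : 0 < n.+1%:R^-1 :> R by [].
rewrite ge0_fin_numE; last first.
  apply: integral_ge0 => y _.
  by rewrite lee_fin mulr_ge0 ?poisson_ge0.
have mp : measurable_fun [set: line] (fun s : line => poisson n.+1%:R^-1 (b1 * (x - s))).
  apply: continuous_measurable_fun => s.
  apply: (@continuous_comp _ _ _ (fun s => b1 * (x - s))).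
    apply: cvgM; first exact: cvg_cst.
    by apply: cvgB; [exact: cvg_cst|exact: cvg_id].
  exact: continuous_poisson.
apply: (@le_lt_trans _ _ (\int[lam]_s (poisson n.+1%:R^-1 (b1 * (x - s)))%:E)%E).
  apply: ge0_le_integral => //.
  - by move=> y _; rewrite lee_fin mulr_ge0 ?poisson_ge0.
  - by apply/measurable_EFinP; apply: measurable_funM.
  - exact/measurable_EFinP.
  - by move=> y _; rewrite lee_fin ler_piMl ?poisson_ge0.
by rewrite integral_poisson// ltry.
Qed.

End parseval_boxes.

Section parseval_identity.
Variable R : realType.
Notation lam := (@lebesgue_measure R).
Notation line := (measurableTypeR R).
Notation P := (line * line)%type.
Notation mu := (@plane_lebesgue R).
Variables (b1 b2 : R).
Hypotheses (b1_neq0 : b1 != 0) (b2_neq0 : b2 != 0).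
Implicit Types (g : P -> R) (u t s : P) (X : set P).
Notation energy := (energy b1 b2).
Notation trig_mass := (trig_mass b1 b2).
Notation parseval_class := (parseval_class b1 b2).

Let indic_box (I J : set line) (t : P) : \1_(I `*` J) t = \1_I t.1 * \1_J t.2 :> R.
Proof.
rewrite !indicE -natrM mulnb; congr (nat_of_bool _)%:R.
by apply/idP/andP; rewrite !inE.
Qed.

Lemma L12_indic X : measurable X -> (mu X < +oo)%E -> L12 (\1_X : P -> R).
Proof.
move=> mX Xoo; have iX : mu.-integrable setT (EFin \o (\1_X : P -> R)).
  apply/integrableP; split; first by apply/measurable_EFinP.
  under eq_integral do rewrite /= ger0_norm//.
  by rewrite integral_indic// setIT.
split => //; apply: eq_integrable iX => // t _ /=.
by rewrite indicE; case: (_ \in _); rewrite ?expr1n ?expr0n.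
Qed.

Lemma measurable_box X : boxes X -> measurable X.
Proof.
by move=> [_ [[a b] _ <-] [_ [[c d] _ <-] <-]]; apply: measurableX; exact: measurable_itv.
Qed.

Lemma box_finite X : boxes X -> (mu X < +oo)%E.
Proof.
move=> [_ [[a b] _ <-] [_ [[c d] _ <-] <-]].
rewrite [X in (X < _)%E]product_measure1E//.
rewrite /= !lebesgue_measure_itv/= !lte_fin.
by case: ifP => _; case: ifP => _; rewrite -?EFinB ?mule0 ?mul0e// -EFinM ltry.
Qed.

(** For the indicator of a box the damped energy is a product of two Poisson
    integrals over squares, and both sides of Parseval's identity are
    proportional to the area. *)
Lemma box_parseval X : boxes X -> parseval_class (\1_X : P -> R).
Proof.
move=> [_ [[a b] _ <-] [_ [[c d] _ <-] <-]] /=.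
have [ba|ab] := leP b a.
  rewrite (_ : _ `*` _ = set0) ?indic0; first exact: parseval_class0.
  apply/seteqP; split => // -[x y] /= [+ _]; rewrite in_itv/= => /andP[ax xb].
  by have := lt_le_trans ax (le_trans xb ba); rewrite ltxx.
have [dc|cd] := leP d c.
  rewrite (_ : _ `*` _ = set0) ?indic0; first exact: parseval_class0.
  apply/seteqP; split => // -[x y] /= [_]; rewrite in_itv/= => /andP[cy yd].
  by have := lt_le_trans cy (le_trans yd dc); rewrite ltxx.
set I := `]a, b]%classic : set line; set J := `]c, d]%classic : set line.
have mI : measurable (I `*` J) by apply: measurableX; exact: measurable_itv.
have vol : mu (I `*` J) = ((b - a) * (d - c))%:E.
  rewrite [LHS]product_measure1E//; [|exact: measurable_itv|exact: measurable_itv].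
  by rewrite /I /J /= !lebesgue_measure_itv/= !lte_fin ab cd -!EFinB -EFinM.
have Lg : L12 (\1_(I `*` J) : P -> R) by apply: L12_indic => //; rewrite vol ltry.
split; first exact: Lg.
set g := (\1_(I `*` J) : P -> R).
have hE := cvg_integral_exp_weight (measurable_energy b1 b2 Lg.1) (energy_ge0 b1 b2 g).
have hW : (\int[mu]_u (exp_weight n.+1%:R^-1 u * energy g u)%:E)%E @[n --> \oo] -->
    (2 * pi / `|b1| * (b - a) * (2 * pi / `|b2| * (d - c)))%:E.
  pose A b (K : set line) (e : R) : R := \int[lam]_x (\1_K x * \int[lam]_y (\1_K y *
    poisson e (b * (x - y)))).
  rewrite (_ : (fun n => _) = EFin \o (fun n => A b1 I n.+1%:R^-1 * A b2 J n.+1%:R^-1)).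
    apply: cvg_EFin; first exact: nearW.
    by apply: cvgM; exact: cvg_poisson_square_indic.
  suff key (e : R) : 0 < e -> (\int[mu]_u (exp_weight e u * energy g u)%:E)%E =
      (A b1 I e * A b2 J e)%:E by apply/funext => n; exact: key.
  move=> e0.
  rewrite /= EFin_weighted_energy//=; last exact: Lg.1.
  have iI : lam.-integrable setT (EFin \o (\1_I : line -> R)) by exact: integrable_indic_line.
  have iJ : lam.-integrable setT (EFin \o (\1_J : line -> R)) by exact: integrable_indic_line.
  have mh b' : measurable_fun setT (fun z : line * line => poisson e (b' * (z.1 - z.2))).
    have mp : measurable_fun setT (poisson e).
      by apply: continuous_measurable_fun; exact: continuous_poisson.
    apply: (measurableT_comp mp); apply: measurable_funM => //.
    by apply: measurable_funB; [exact: measurable_coord1|exact: measurable_coord2].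
  have hC b' (z : line * line) : `|poisson e (b' * (z.1 - z.2))| <= 2 / e.
    exact: poisson_le.
  congr EFin; rewrite /A -plane_Rintegral_tensor; last 2 first.
  - exact: (integrable_kernel_transform iI iI (mh b1) (hC b1)).
  - exact: (integrable_kernel_transform iJ iJ (mh b2) (hC b2)).
  apply: eq_Rintegral => t _; rewrite /g indic_box mulrACA; congr (_ * _).
  rewrite -plane_Rintegral_tensor; last 2 first.
  - have mp : measurable_fun setT (fun s : line => poisson e (b1 * (t.1 - s))).
      exact: (measurable_fun_pair2 t.1 (mh b1)).
    by apply: (integrable_bounded_mul iI mp) => s; exact: (hC b1 (t.1, s)).
  - have mp : measurable_fun setT (fun s : line => poisson e (b2 * (t.2 - s))).
      exact: (measurable_fun_pair2 t.2 (mh b2)).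
    by apply: (integrable_bounded_mul iJ mp) => s; exact: (hC b2 (t.2, s)).
  by apply: eq_Rintegral => s _; rewrite indic_box mulrACA.
have EE : \int[mu]_u energy g u = trig_mass * ((b - a) * (d - c)).
  rewrite /Rintegral -(cvg_lim _ hE)// (cvg_lim _ hW)//= /trig_mass; ring.
rewrite /defect EE.
have -> : \int[mu]_t (g t ^+ 2) = (b - a) * (d - c).
  have hI : (\int[mu]_t (g t)%:E = ((b - a) * (d - c))%:E)%E.
    by rewrite integral_indic// setIT.
  rewrite /Rintegral -[RHS]/(fine ((b - a) * (d - c))%:E) -hI; congr fine.
  by apply: eq_integral => t _; rewrite /g indicE; case: (_ \in _); rewrite ?expr1n ?expr0n.
by rewrite subrr.
Qed.

End parseval_identity.

Section parseval_theorem.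
Variable R : realType.
Notation line := (measurableTypeR R).
Notation P := (line * line)%type.
Notation mu := (@plane_lebesgue R).
Variables (b1 b2 : R).
Hypotheses (b1_neq0 : b1 != 0) (b2_neq0 : b2 != 0).
Implicit Types (g h : P -> R) (u t : P) (X : set P).
Notation energy := (energy b1 b2).
Notation trig_mass := (trig_mass b1 b2).
Notation parseval_class := (parseval_class b1 b2).

Lemma L12_indic_box X B : measurable X -> boxes B -> L12 (\1_(X `&` B) : P -> R).
Proof.
move=> mX bB; have mB := measurable_box bB.
apply: L12_indic; first exact: measurableI.
by apply: le_lt_trans (box_finite bB); apply: le_measure; rewrite ?inE//; exact: measurableI.
Qed.

(** A Dynkin argument on [X]; cutting with a box keeps the indicators
    integrable although [X] may have infinite measure. *)
Lemma indic_parseval X B : measurable X -> boxes B ->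
  parseval_class (\1_(X `&` B) : P -> R).
Proof.
move=> mX; move: B; suff : @measurable _ P `<=`
    [set X | measurable X /\ forall B, boxes B -> parseval_class (\1_(X `&` B) : P -> R)].
  by move=> /(_ X mX)[].
apply: boxes_dynkin; last first.
  move=> A bA; split; first exact: measurable_box.
  by move=> B bB; apply: box_parseval => //; exact: boxes_setI.
split; first by move=> A _; exact: subsetT.
- split; first exact: measurableT.
  by move=> B bB; rewrite setTI; exact: box_parseval.
- move=> A B BA [mA hA] [mB hB]; split; first exact: measurableD.
  move=> C bC; have := parseval_classB b1_neq0 b2_neq0 (hA C bC) (hB C bC).
  congr parseval_class; apply/funext => t.
  have BAt : t \in B -> t \in A by move/set_mem/BA/mem_set.
  rewrite setDE !indicE !in_setI classical_sets.in_setC.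
  case: (boolP (t \in B)) BAt => [_ /(_ isT) ->|_ _] /=; last by rewrite subr0 andbT.
  by rewrite subrr.
- move=> F ndF hF; split; first by apply: bigcupT_measurable => n; case: (hF n).
  move=> B bB; have mF n : measurable (F n) by case: (hF n).
  apply: (parseval_class_lim b1_neq0 b2_neq0 (g_ := fun n => \1_(F n `&` B))).
  + by apply: L12_indic_box => //; exact: bigcupT_measurable.
  + by move=> n; have [_] := hF n; exact.
  have iB : mu.-integrable setT (EFin \o (\1_B : P -> R)).
    by have := (L12_indic_box measurableT bB).1; rewrite setTI.
  have [] := @dominated_convergence _ P R mu setT measurableT
    (fun n t => ((\1_((\bigcup_n F n) `&` B) t - \1_(F n `&` B) t) ^+ 2)%:E) (cst 0%E)
    (EFin \o (\1_B : P -> R)).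
  + move=> n; apply/measurable_EFinP; apply: measurable_funX; apply: measurable_funB.
      apply: measurable_indic; apply: measurableI; last exact: measurable_box.
      exact: bigcupT_measurable.
    by apply: measurable_indic; apply: measurableI => //; exact: measurable_box.
  + by [].
  + apply: nearW => t _; apply: cvg_near_cst.
    have [[N _ FN]|nF] := pselect ((\bigcup_n F n) t).
      exists N => // n /= Nn; congr EFin.
      have Fn : F n t by exact: (subsetPset _ _ (ndF _ _ Nn)).
      have Un : (\bigcup_n F n) t by exists N.
      by rewrite !indicE !in_setI (mem_set Fn) (mem_set Un) subrr expr0n.
    exists 0%N => // n _ /=; congr EFin; rewrite !indicE !in_setI.
    have nFn : ~ F n t by move=> Fn; apply: nF; exists n.
    by rewrite (memNset nF) (memNset nFn) subrr expr0n.
  + exact: iB.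
  + apply: nearW => t n _ /=; rewrite lee_fin ger0_norm ?sqr_ge0//.
    rewrite !indicE !in_setI; case: (t \in B); case: (_ \in _) => /=;
      case: (_ \in _) => /=; rewrite ?mul0n; lra.
  by move=> _ _; rewrite integral0.
Qed.

Import HBNNSimple.

(** Approximation by simple functions from below, cut off to growing boxes. *)
Lemma ge0_parseval g : L12 g -> (forall t, 0 <= g t) -> parseval_class g.
Proof.
move=> Lg g0; have mg := L12_measurable Lg.
have mG : measurable_fun setT (EFin \o g) by exact/measurable_EFinP.
pose h := nnsfun_approx measurableT mG.
pose B n : set P := `](- n%:R), n%:R]%classic `*` `](- n%:R), n%:R]%classic.
have bB n : boxes (B n).
  by exists `](- n%:R), n%:R]%classic; [exact: is_ocitv|]; exists `](- n%:R), n%:R]%classic;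
    [exact: is_ocitv|].
pose g_ n t := h n t * \1_(B n) t.
have h_le n t : 0 <= h n t <= g t.
  rewrite fun_ge0/= -lee_fin /h nnsfun_approxE.
  by apply: le_approx => // *; rewrite lee_fin.
have g_le n t : 0 <= g_ n t <= g t.
  have /andP[h0 hg] := h_le n t.
  by rewrite /g_ indicE; case: (_ \in _); rewrite ?mulr1 ?h0//= mulr0 lexx g0.
apply: (parseval_class_lim b1_neq0 b2_neq0 (g_ := g_)) => //.
  move=> n; have -> : g_ n = fun t => \sum_(y <- fset_set (range (h n)))
      y * \1_((h n @^-1` [set y]) `&` B n) t.
    apply/funext => t; rewrite /g_ [in LHS]fimfunE fsbig_finite//= mulr_suml.
    by apply: eq_bigr => y _; rewrite -mulrA !indicE in_setI -natrM mulnb.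
  apply: (parseval_class_sum b1_neq0 b2_neq0) => y.
  by apply: (parseval_classZ b1_neq0 b2_neq0); apply: indic_parseval => //; exact: measurable_funPTI.
have [] := @dominated_convergence _ P R mu setT measurableT
    (fun n t => ((g t - g_ n t) ^+ 2)%:E) (cst 0%E)
    (EFin \o (fun t => g t ^+ 2)).
- move=> n; apply/measurable_EFinP; apply: measurable_funX; apply: measurable_funB => //.
  by apply: measurable_funM => //; apply: measurable_indic; exact: measurable_box.
- by [].
- apply: nearW => t _; apply: cvg_EFin; first exact: nearW.
  have hh : h n t @[n --> \oo] --> g t.
    have G0 (x : P) : [set: P] x -> (0 <= (EFin \o g) x)%E by rewrite lee_fin.
    exact: (fine_cvg (cvg_nnsfun_approx measurableT mG G0 (x := t) Logic.I)).
  have hb : (\1_(B n) t : R) @[n --> \oo] --> (1 : R).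
    apply: cvg_near_cst; exists (Num.truncn (`|t.1| + `|t.2|)).+1 => // n /= tn.
    rewrite indicE mem_set//.
    have := truncnS_gt (`|t.1| + `|t.2|); move: tn; rewrite -(ler_nat R).
    move=> tn tlt; have tn2 := lt_le_trans tlt tn.
    have [t1 t2] : `|t.1| < n%:R /\ `|t.2| < n%:R.
      by have := (normr_ge0 t.1, normr_ge0 t.2) => -[]; lra.
    move: t1 t2; rewrite !ltr_norml => /andP[? ?] /andP[? ?].
    by split; rewrite /= in_itv/=; apply/andP; split => //; exact: ltW.
  have hg : g_ n t @[n --> \oo] --> g t.
    by rewrite -[X in _ --> X]mulr1; exact: cvgM.
  have hd : g t - g_ n t @[n --> \oo] --> 0.
    by rewrite -[X in _ --> X](subrr (g t)); apply: cvgB => //; exact: cvg_cst.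
  by rewrite /= -[X in _ --> X](mul0r 0); under eq_fun do rewrite expr2; exact: cvgM.
- exact: Lg.2.
- apply: nearW => t n _ /=; rewrite lee_fin ger0_norm ?sqr_ge0//.
  have /andP[h0 hg] := g_le n t.
  by rewrite ler_sqr ?nnegrE ?g0// ?subr_ge0// gerBl.
by move=> _ _; rewrite integral0.
Qed.

Theorem parseval g : L12 g ->
  (\int[mu]_u (energy g u)%:E = trig_mass%:E * \int[mu]_t (g t ^+ 2)%:E)%E.
Proof.
move=> Lg.
have Ln : L12 (fun t => `|g t|).
  split; first exact: (integrable_norm Lg.1).
  by under eq_fun do rewrite /= real_normK ?num_real//; exact: Lg.2.
have hp : parseval_class (fun t => 2^-1 * (`|g t| + g t)).
  apply: ge0_parseval; first by apply: L12Z; exact: L12D.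
  by move=> t; have := ler_norm (- g t); rewrite normrN; lra.
have hm : parseval_class (fun t => 2^-1 * (`|g t| - g t)).
  apply: ge0_parseval; first by apply: L12Z; exact: L12B.
  by move=> t; have := ler_norm (g t); lra.
have := parseval_classB b1_neq0 b2_neq0 hp hm.
rewrite (_ : (fun t => _) = g); last by apply/funext => t; field.
move=> [_ /eqP]; rewrite /defect subr_eq0 => /eqP h.
have iE := integrable_fin_num measurableT (energy_integrable b1_neq0 b2_neq0 Lg).
have iN := integrable_fin_num measurableT Lg.2.
by rewrite -(fineK iE) -(fineK iN) -EFinM; congr EFin; exact/esym.
Qed.

End parseval_theorem.

(** * Quaternions and their square norm *)

Section quat_algebra.
Variable R : realType.
Implicit Types (x y z : quat R) (r : R).

Definition qnormsq x : R := q0 x ^+ 2 + qi x ^+ 2 + qj x ^+ 2 + qk x ^+ 2.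

Lemma quat_eqP x y : q0 x = q0 y -> qi x = qi y -> qj x = qj y -> qk x = qk y -> x = y.
Proof. by case: x => ? ? ? ?; case: y => ? ? ? ? /= -> -> -> ->. Qed.

Lemma qmod_ge0 x : 0 <= qmod x. Proof. exact: sqrtr_ge0. Qed.

Lemma qnormsq_ge0 x : 0 <= qnormsq x.
Proof. by rewrite /qnormsq !addr_ge0 ?sqr_ge0. Qed.

Lemma sqr_qmod x : qmod x ^+ 2 = qnormsq x.
Proof. by rewrite sqr_sqrtr// qnormsq_ge0. Qed.

Lemma qnormsqM x y : qnormsq (x * y) = qnormsq x * qnormsq y.
Proof. by rewrite /qnormsq /=; ring. Qed.

Lemma qnormsqZ r x : qnormsq (r *: x) = r ^+ 2 * qnormsq x.
Proof. by rewrite /qnormsq /=; ring. Qed.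

Lemma qnormsqN x : qnormsq (- x) = qnormsq x.
Proof. by rewrite /qnormsq /=; ring. Qed.

(** The difference of the two sides is [r^-1 |r x - y| ^ 2]. *)
Lemma qnormsqD_le r x y : 0 < r ->
  qnormsq (x + y) <= (1 + r) * qnormsq x + (1 + r^-1) * qnormsq y.
Proof.
move=> r0; suff : (r^-1) * qnormsq (r *: x - y) =
    r * qnormsq x + r^-1 * qnormsq y - (qnormsq (x + y) - qnormsq x - qnormsq y).
  have : 0 <= r^-1 * qnormsq (r *: x - y) by rewrite mulr_ge0 ?invr_ge0 ?(ltW r0)// qnormsq_ge0.
  by move=> + h; rewrite h; lra.
by rewrite /qnormsq /=; field; exact: lt0r_neq0.
Qed.

(** [exp (i th)] and [exp (j th)]. *)
Definition ei (th : R) : quat R := Quat (cos th) (sin th) 0 0.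
Definition ej (th : R) : quat R := Quat (cos th) 0 (sin th) 0.

Lemma complex_iM (z w : R[i]) : complex_i (z * w) = complex_i z * complex_i w.
Proof. by case: z => a b; case: w => c d; apply: quat_eqP => /=; ring. Qed.

Lemma complex_jM (z w : R[i]) : complex_j (z * w) = complex_j z * complex_j w.
Proof. by case: z => a b; case: w => c d; apply: quat_eqP => /=; ring. Qed.

Lemma complex_i_expi th : complex_i (expi th) = ei th. Proof. by []. Qed.
Lemma complex_j_expi th : complex_j (expi th) = ej th. Proof. by []. Qed.

Lemma eiD a b : ei (a + b) = ei a * ei b.
Proof. by apply: quat_eqP; rewrite /= ?cosD ?sinD; ring. Qed.

Lemma ejD a b : ej (a + b) = ej a * ej b.
Proof. by apply: quat_eqP; rewrite /= ?cosD ?sinD; ring. Qed.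

Lemma qnormsq_ei a : qnormsq (ei a) = 1.
Proof. by rewrite /qnormsq /= -(cos2Dsin2 a); ring. Qed.

Lemma qnormsq_ej a : qnormsq (ej a) = 1.
Proof. by rewrite /qnormsq /= -(cos2Dsin2 a); ring. Qed.

Lemma norm_components x : [/\ `|q0 x| <= qmod x, `|qi x| <= qmod x,
  `|qj x| <= qmod x & `|qk x| <= qmod x].
Proof.
have key (a b : R) : a ^+ 2 <= b -> `|a| <= Num.sqrt b.
  by move=> ab; rewrite -sqrtr_sqr ler_wsqrtr.
have h := (sqr_ge0 (q0 x), sqr_ge0 (qi x), sqr_ge0 (qj x), sqr_ge0 (qk x)).
by split; apply: key; case: h => [[[]]]; lra.
Qed.

Lemma qnormsq_complex_j (z : R[i]) : qnormsq (complex_j z) = qnormsq (complex_i z).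
Proof. by rewrite /qnormsq /=; ring. Qed.

(** Since [qnormsq] is multiplicative, its value at a square root of [w] is
    the square root of its value at [w]. *)
Lemma qnormsq_sqrtc (y : R) : y != 0 ->
  qnormsq (complex_i (sqrtc ((Complex 0 y)^-1))) = `|y|^-1.
Proof.
move=> y0; set s := sqrtc _; set N := qnormsq _.
have w0 : Complex 0 y != 0 :> R[i].
  by rewrite eq_complex /= (negbTE y0) andbF.
have N0 : 0 <= N by exact: qnormsq_ge0.
have : N ^+ 2 * y ^+ 2 = 1.
  have -> : y ^+ 2 = qnormsq (complex_i (Complex 0 y)) by rewrite /qnormsq /=; ring.
  rewrite expr2 -!qnormsqM -!complex_iM -expr2 sqr_sqrtc mulVf//.
  by rewrite /qnormsq /=; ring.
rewrite -(real_normK (num_real y)) -exprMn => /eqP.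
rewrite -(expr1n _ 2) eqrXn2 ?mulr_ge0// => /eqP h.
by rewrite -[LHS]mulr1 -(divff (lt0r_neq0 (_ : 0 < `|y|))) ?normr_gt0// mulrA h mul1r.
Qed.

End quat_algebra.

(** * Square-integrable quaternion-valued functions *)

Section quat_plancherel.
Variable R : realType.
Notation line := (measurableTypeR R).
Notation P := (line * line)%type.
Notation mu := (@plane_lebesgue R).
Implicit Types (f g : R * R -> quat R).

Definition qnorm2 f : \bar R := (\int[mu]_t (qnormsq (f t))%:E)%E.

Definition qL12 f := [/\ @L12 R (fun t => q0 (f t)), @L12 R (fun t => qi (f t)),
  @L12 R (fun t => qj (f t)) & @L12 R (fun t => qk (f t))].

Lemma measurable_qnormsq f : qmeasurable f ->
  measurable_fun [set: P] (fun t : P => qnormsq (f t)).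
Proof.
by move=> [? ? ? ?]; do 3?[apply: measurable_funD]; apply: measurable_funX.
Qed.

Lemma qmeasurableM f g : qmeasurable f -> qmeasurable g -> qmeasurable (fun t => f t * g t).
Proof.
move=> [? ? ? ?] [? ? ? ?]; split => /=; do 3?[apply: measurable_funB|apply: measurable_funD];
  exact: measurable_funM.
Qed.

Lemma qmeasurableD f g : qmeasurable f -> qmeasurable g -> qmeasurable (fun t => f t + g t).
Proof.
by move=> [? ? ? ?] [? ? ? ?]; split => /=; apply: measurable_funD.
Qed.

Lemma qmeasurableN f : qmeasurable f -> qmeasurable (fun t => - f t).
Proof. by move=> [? ? ? ?]; split => /=; exact: measurableT_comp. Qed.

Lemma qmeasurableB f g : qmeasurable f -> qmeasurable g -> qmeasurable (fun t => f t - g t).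
Proof. by move=> mf mg; apply: qmeasurableD => //; exact: qmeasurableN. Qed.

Lemma qmeasurableZ (r : R * R -> R) f : measurable_fun [set: P] (r : P -> R) ->
  qmeasurable f -> qmeasurable (fun t => r t *: f t).
Proof. by move=> mr [? ? ? ?]; split => /=; exact: measurable_funM. Qed.

Lemma qnorm2_ge0 f : (0 <= qnorm2 f)%E.
Proof. by apply: integral_ge0 => t _; rewrite lee_fin qnormsq_ge0. Qed.

Lemma qLnorm2E f : qLnorm 2%:E f = (qnorm2 f `^ 2^-1)%E.
Proof.
rewrite /qLnorm unlock /=; congr (_ `^ _)%E; apply: eq_integral => t _.
by rewrite /= ger0_norm ?qmod_ge0// powR_mulrn ?qmod_ge0// sqr_qmod.
Qed.

Lemma sqr_qLnorm2 f : (qLnorm 2%:E f ^+ 2 = qnorm2 f)%E.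
Proof.
rewrite qLnorm2E; have := qnorm2_ge0 f; case: (qnorm2 f) => [r r0||//].
  rewrite poweR_EFin -EFin_expe -powR_mulrn ?powR_ge0// -powRrM mulVf// powRr1//.
by move=> _; rewrite poweRyr ?invr_eq0// expe2 mulyy.
Qed.

Lemma Lq2P f : Lq 2%:E f <-> qmeasurable f /\ (qnorm2 f < +oo)%E.
Proof.
split=> [] [mf foo]; split => //.
  rewrite -sqr_qLnorm2 expe2; move: foo; have : (0 <= qLnorm 2%:E f)%E by exact: Lnorm_ge0.
  by case: (qLnorm _ _) => // r r0 _; rewrite -EFinM ltry.
rewrite qLnorm2E; move: foo; have := qnorm2_ge0 f.
by case: (qnorm2 f) => // r r0 _; rewrite poweR_EFin ltry.
Qed.

Lemma qnorm2_components f : qmeasurable f ->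
  (qnorm2 f = \int[mu]_t (q0 (f t) ^+ 2)%:E + \int[mu]_t (qi (f t) ^+ 2)%:E +
    \int[mu]_t (qj (f t) ^+ 2)%:E + \int[mu]_t (qk (f t) ^+ 2)%:E)%E.
Proof.
move=> [m0 mi mj mk].
have mX (h : P -> R) : measurable_fun [set: P] h -> measurable_fun [set: P] (fun t => (h t ^+ 2)%:E).
  by move=> mh; apply/measurable_EFinP; exact: measurable_funX.
have X0 (h : P -> R) t : [set: P] t -> (0 <= (h t ^+ 2)%:E)%E by rewrite lee_fin sqr_ge0.
do 3![rewrite -ge0_integralD//;
  try by [do 2?[apply: emeasurable_funD]; exact: mX];
  try by [move=> t _; rewrite -?EFinD lee_fin ?addr_ge0 ?sqr_ge0]].
Qed.

Lemma measurable_EFin_qnormsq f : qmeasurable f ->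
  measurable_fun [set: P] (fun t : P => (qnormsq (f t))%:E).
Proof. by move=> mf; apply/measurable_EFinP; exact: measurable_qnormsq. Qed.

Lemma measurable_qmod f : qmeasurable f -> measurable_fun [set: P] (fun t : P => qmod (f t)).
Proof.
move=> mf; apply: measurableT_comp; last exact: measurable_qnormsq.
by apply: continuous_measurable_fun; exact: sqrt_continuous.
Qed.

Lemma Lq1P f : Lq 1%:E f <-> qmeasurable f /\ (\int[mu]_t (qmod (f t))%:E < +oo)%E.
Proof.
have E : qLnorm 1%:E f = (\int[mu]_t (qmod (f t))%:E)%E.
  by rewrite /qLnorm Lnorm1; apply: eq_integral => t _; rewrite /= ger0_norm ?qmod_ge0.
by split=> -[mf foo]; split => //; move: foo; rewrite E.
Qed.

Definition qintegrable f := [/\ mu.-integrable setT (EFin \o (fun t : P => q0 (f t))),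
  mu.-integrable setT (EFin \o (fun t : P => qi (f t))),
  mu.-integrable setT (EFin \o (fun t : P => qj (f t))) &
  mu.-integrable setT (EFin \o (fun t : P => qk (f t)))].

Lemma Lq1_qintegrable f : Lq 1%:E f -> qintegrable f.
Proof.
move=> /Lq1P[mf f1]; have [m0 mi mj mk] := mf.
have key (h : P -> R) : measurable_fun [set: P] h -> (forall t, `|h t| <= qmod (f t)) ->
    mu.-integrable setT (EFin \o h).
  move=> mh hf; apply/integrableP; split; first exact/measurable_EFinP.
  apply: le_lt_trans f1; apply: ge0_le_integral => //.
  - by apply/measurable_EFinP; exact: measurableT_comp.
  - by apply/measurable_EFinP; exact: measurable_qmod.
  - by move=> t _; rewrite lee_fin.
by split; apply: key => // t; case: (norm_components (f t)).
Qed.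

Lemma Lq12_qL12 f : Lq 1%:E f -> Lq 2%:E f -> qL12 f.
Proof.
move=> /Lq1_qintegrable[i0 ii ij ik] /Lq2P[mf f2]; have [m0 mi mj mk] := mf.
have key (h : P -> R) : measurable_fun [set: P] h -> (forall t, `|h t| <= qmod (f t)) ->
    mu.-integrable setT (EFin \o (fun t => h t ^+ 2)).
  move=> mh hf; apply/integrableP; split.
    by apply/measurable_EFinP; exact: measurable_funX.
  apply: le_lt_trans f2; apply: ge0_le_integral => //.
  - by apply/measurable_EFinP; apply: measurableT_comp => //; exact: measurable_funX.
  - exact: measurable_EFin_qnormsq.
  - by move=> t _; rewrite lee_fin normrX -sqr_qmod ler_sqr ?nnegrE ?qmod_ge0//.
by split; split=> //; apply: key => // t; case: (norm_components (f t)).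
Qed.

Lemma integral_scale_qnormsq (c : R) f : 0 <= c -> qmeasurable f ->
  (\int[mu]_t (c * qnormsq (f t))%:E = c%:E * qnorm2 f)%E.
Proof.
move=> c0 mf; rewrite /qnorm2 -ge0_integralZl//.
- exact: measurable_EFin_qnormsq.
- by move=> t _; rewrite lee_fin qnormsq_ge0.
Qed.

End quat_plancherel.

(** * Plancherel's identity for the two-sided quaternion Fourier transform *)

Section quat_fourier.
Variable R : realType.
Notation line := (measurableTypeR R).
Notation P := (line * line)%type.
Notation mu := (@plane_lebesgue R).
Variables (b1 b2 : R).
Implicit Types (g : R * R -> quat R) (u t : R * R).
Notation T := (trig_transform b1 b2).
Notation energy := (energy b1 b2).
Notation trig_mass := (trig_mass b1 b2).

(** The two-sided quaternion Fourier transform; [b1] and [b2] rescale the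
    frequencies, so that it matches the kernel of the canonical transform. *)
Definition QFT g u : quat R :=
  qintegral (fun t => ei (- (b1 * u.1 * t.1)) * g t * ej (- (b2 * u.2 * t.2))).

Let integrable_trig i (h : P -> R) u : L12 h ->
  mu.-integrable setT (EFin \o (fun t : P => h t * trig_kernel b1 b2 i (u, t))).
Proof.
move=> [ih _].
have mk : measurable_fun setT (fun t : P => trig_kernel b1 b2 i (u, t)).
  exact: (measurable_fun_pair2 _ (measurable_trig_kernel b1 b2 i)).
by apply: (integrable_bounded_mul ih mk) => t; exact: trig_kernel_le1.
Qed.

Let Rintegral_trig4 (h1 h2 h3 h4 : P -> R) (c1 c2 c3 c4 : R) u :
  L12 h1 -> L12 h2 -> L12 h3 -> L12 h4 ->
  \int[mu]_t (c1 * (h1 t * trig_kernel b1 b2 (false, false) (u, t)) +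
              c2 * (h2 t * trig_kernel b1 b2 (true, false) (u, t)) +
              c3 * (h3 t * trig_kernel b1 b2 (false, true) (u, t)) +
              c4 * (h4 t * trig_kernel b1 b2 (true, true) (u, t))) =
  c1 * T (false, false) h1 u + c2 * T (true, false) h2 u +
  c3 * T (false, true) h3 u + c4 * T (true, true) h4 u.
Proof.
move=> L1 L2 L3 L4.
have key c i h : L12 h -> mu.-integrable setT
    (EFin \o (fun t : P => c * (h t * trig_kernel b1 b2 i (u, t)))).
  by move=> Lh; exact: (integrableZl measurableT c (integrable_trig i u Lh)).
have i1 := key c1 (false, false) _ L1; have i2 := key c2 (true, false) _ L2.
have i3 := key c3 (false, true) _ L3; have i4 := key c4 (true, true) _ L4.
have i12 := integrableD measurableT i1 i2.
have i123 := integrableD measurableT i12 i3.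
rewrite !RintegralD// !RintegralZl//; exact: integrable_trig.
Qed.

Lemma QFT_components g u : qL12 g -> QFT g u = Quat
  (T (false, false) (fun t => q0 (g t)) u + T (true, false) (fun t => qi (g t)) u
   + T (false, true) (fun t => qj (g t)) u + T (true, true) (fun t => qk (g t)) u)
  (T (false, false) (fun t => qi (g t)) u - T (true, false) (fun t => q0 (g t)) u
   + T (false, true) (fun t => qk (g t)) u - T (true, true) (fun t => qj (g t)) u)
  (T (false, false) (fun t => qj (g t)) u + T (true, false) (fun t => qk (g t)) u
   - T (false, true) (fun t => q0 (g t)) u - T (true, true) (fun t => qi (g t)) u)
  (T (false, false) (fun t => qk (g t)) u - T (true, false) (fun t => qj (g t)) u
   - T (false, true) (fun t => qi (g t)) u + T (true, true) (fun t => q0 (g t)) u).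
Proof.
move=> [L0 Li Lj Lk]; apply: quat_eqP => /=.
- have := @Rintegral_trig4 _ _ _ _ 1 1 1 1 u L0 Li Lj Lk.
  rewrite !mul1r ?mulN1r => <-.
  by apply: eq_Rintegral => t _; rewrite /trig_kernel /= !cosN !sinN; ring.
- have := @Rintegral_trig4 _ _ _ _ 1 (-1) 1 (-1) u Li L0 Lk Lj.
  rewrite !mul1r ?mulN1r => <-.
  by apply: eq_Rintegral => t _; rewrite /trig_kernel /= !cosN !sinN; ring.
- have := @Rintegral_trig4 _ _ _ _ 1 1 (-1) (-1) u Lj Lk L0 Li.
  rewrite !mul1r ?mulN1r => <-.
  by apply: eq_Rintegral => t _; rewrite /trig_kernel /= !cosN !sinN; ring.
- have := @Rintegral_trig4 _ _ _ _ 1 (-1) (-1) 1 u Lk Lj Li L0.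
  rewrite !mul1r ?mulN1r => <-.
  by apply: eq_Rintegral => t _; rewrite /trig_kernel /= !cosN !sinN; ring.
Qed.

Lemma qmeasurable_QFT g : qL12 g -> qmeasurable (QFT g).
Proof.
move=> Lg; have [[i0 _] [ii _] [ij _] [ik _]] := Lg.
have mT i h : mu.-integrable setT (EFin \o h) -> measurable_fun setT (T i h).
  exact: measurable_trig_transform.
have -> := funext (fun u => QFT_components u Lg).
by split => /=; do 3?[apply: measurable_funB|apply: measurable_funD]; exact: mT.
Qed.

Let trig_oppP i (h : P -> R) u v : L12 h ->
  (forall t, trig_kernel b1 b2 i (v, t) = - trig_kernel b1 b2 i (u, t)) ->
  T i h v = - T i h u.
Proof.
move=> Lh kE; rewrite -mulN1r -RintegralZl//; last exact: integrable_trig.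
by apply: eq_Rintegral => t _; rewrite kE mulrN mulN1r.
Qed.

Let trig_evenP i (h : P -> R) u v :
  (forall t, trig_kernel b1 b2 i (v, t) = trig_kernel b1 b2 i (u, t)) ->
  T i h v = T i h u.
Proof. by move=> kE; apply: eq_Rintegral => t _; rewrite kE. Qed.

Let trig_opp1 q h u : L12 h ->
  (T (true, q) h (- u.1, u.2) = - T (true, q) h u) *
  (T (false, q) h (- u.1, u.2) = T (false, q) h u).
Proof.
by move=> Lh; split; [apply: trig_oppP => // t|apply: trig_evenP => t];
  rewrite /trig_kernel /= mulrN mulNr ?sinN ?mulNr ?cosN.
Qed.

Let trig_opp2 p h u : L12 h ->
  (T (p, true) h (u.1, - u.2) = - T (p, true) h u) *
  (T (p, false) h (u.1, - u.2) = T (p, false) h u).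
Proof.
by move=> Lh; split; [apply: trig_oppP => // t|apply: trig_evenP => t];
  rewrite /trig_kernel /= mulrN mulNr ?sinN ?mulrN ?cosN.
Qed.

(** Changing the signs of the two frequencies changes the signs of the sine
    parts, so that all cross terms cancel in the sum of the four values. *)
Lemma qnormsq_QFT_reflect g u : qL12 g ->
  qnormsq (QFT g u) + qnormsq (QFT g (- u.1, u.2)) +
  (qnormsq (QFT g (u.1, - u.2)) + qnormsq (QFT g (- u.1, - u.2))) =
  4 * (energy (fun t => q0 (g t)) u + energy (fun t => qi (g t)) u +
       energy (fun t => qj (g t)) u + energy (fun t => qk (g t)) u).
Proof.
move=> Lg; have [L0 Li Lj Lk] := Lg; rewrite !QFT_components//.
have o12 := (trig_opp1 _ (u.1, - u.2)).
have o1 := (trig_opp1 _ u); have o2 := (trig_opp2 _ u).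
rewrite /= in o12.
rewrite !(o12 _ _ L0) !(o12 _ _ Li) !(o12 _ _ Lj) !(o12 _ _ Lk).
rewrite !(o1 _ _ L0) !(o1 _ _ Li) !(o1 _ _ Lj) !(o1 _ _ Lk).
rewrite !(o2 _ _ L0) !(o2 _ _ Li) !(o2 _ _ Lj) !(o2 _ _ Lk).
rewrite /qnormsq /energy /trig_indices !big_cons !big_nil /=.
move: (T (false, false) (fun t => q0 (g t)) u)
  (T (false, true) (fun t => q0 (g t)) u)
  (T (true, false) (fun t => q0 (g t)) u)
  (T (true, true) (fun t => q0 (g t)) u)
  (T (false, false) (fun t => qi (g t)) u)
  (T (false, true) (fun t => qi (g t)) u)
  (T (true, false) (fun t => qi (g t)) u)
  (T (true, true) (fun t => qi (g t)) u)
  (T (false, false) (fun t => qj (g t)) u)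
  (T (false, true) (fun t => qj (g t)) u)
  (T (true, false) (fun t => qj (g t)) u)
  (T (true, true) (fun t => qj (g t)) u)
  (T (false, false) (fun t => qk (g t)) u)
  (T (false, true) (fun t => qk (g t)) u)
  (T (true, false) (fun t => qk (g t)) u)
  (T (true, true) (fun t => qk (g t)) u).
by move=> *; ring.
Qed.

Hypotheses (b1_neq0 : b1 != 0) (b2_neq0 : b2 != 0).

(** Averaging over the reflections of the frequency replaces the left-hand
    side by the energies of the four components, and Parseval's identity
    applies to each of them. *)
Theorem QFT_plancherel g : qL12 g -> (qnorm2 (QFT g) = trig_mass%:E * qnorm2 g)%E.
Proof.
move=> Lg; have [L0 Li Lj Lk] := Lg.
have mg : qmeasurable g by split; exact: L12_measurable.
have mF : measurable_fun [set: P] (fun u : P => (qnormsq (QFT g u))%:E).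
  by apply/measurable_EFinP; apply: measurable_qnormsq; exact: qmeasurable_QFT.
have F0 (u : P) : (0 <= (qnormsq (QFT g u))%:E)%E by rewrite lee_fin qnormsq_ge0.
have lhs := ge0_integral_plane_reflect mF F0.
have mE (h : P -> R) : L12 h -> measurable_fun [set: P] (fun u => (energy h u)%:E).
  by move=> [ih _]; apply/measurable_EFinP; exact: measurable_energy.
have E0 (h : P -> R) u : (0 <= (energy h u)%:E)%E by rewrite lee_fin energy_ge0.
have rhs : (4%:E * qnorm2 (QFT g) = 4%:E * (trig_mass%:E * qnorm2 g))%E.
  rewrite -[LHS]lhs.
  transitivity (\int[mu]_u (4%:E * ((energy (fun t => q0 (g t)) u)%:E +
      (energy (fun t => qi (g t)) u)%:E + (energy (fun t => qj (g t)) u)%:E +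
      (energy (fun t => qk (g t)) u)%:E)))%E.
    apply: eq_integral => u _; rewrite -!EFinD -EFinM; congr EFin.
    exact: qnormsq_QFT_reflect.
  have m0 := mE _ L0; have mi := mE _ Li; have mj := mE _ Lj; have mk := mE _ Lk.
  have m0i := emeasurable_funD m0 mi; have m0ij := emeasurable_funD m0i mj.
  rewrite ge0_integralZl//; last 2 first.
  - exact: (emeasurable_funD m0ij mk).
  - by move=> u _; rewrite -!EFinD lee_fin !addr_ge0 ?energy_ge0.
  congr (_ * _)%E; rewrite ge0_integralD//; last first.
    by move=> u _; rewrite -!EFinD lee_fin !addr_ge0 ?energy_ge0.
  rewrite ge0_integralD//; last first.
    by move=> u _; rewrite -!EFinD lee_fin !addr_ge0 ?energy_ge0.
  rewrite ge0_integralD//.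
  rewrite !parseval// qnorm2_components//.
  have N0 (h : P -> R) : (0 <= \int[mu]_t (h t ^+ 2)%:E)%E.
    by apply: integral_ge0 => t _; rewrite lee_fin sqr_ge0.
  have D (x a b c d : \bar R) : (0 <= a)%E -> (0 <= b)%E -> (0 <= c)%E -> (0 <= d)%E ->
      (x * a + x * b + x * c + x * d = x * (a + b + c + d))%E.
    by move=> a0 b0 c0 d0; rewrite !ge0_muleDr// ?adde_ge0// ?adde_ge0.
  by apply: D; exact: N0.
move/(congr1 (fun x => (4^-1)%:E * x)%E): rhs; rewrite !muleA -EFinM mulVf ?mul1e//.
Qed.

End quat_fourier.

(** * Linearity of the quaternion integral *)

Section qintegral_linear.
Variable R : realType.
Notation line := (measurableTypeR R).
Notation P := (line * line)%type.
Notation mu := (@plane_lebesgue R).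
Implicit Types (f g : R * R -> quat R).

Let Rintegral_lin4 (h1 h2 h3 h4 : P -> R) (c1 c2 c3 c4 : R) :
  mu.-integrable setT (EFin \o h1) -> mu.-integrable setT (EFin \o h2) ->
  mu.-integrable setT (EFin \o h3) -> mu.-integrable setT (EFin \o h4) ->
  \int[mu]_t (c1 * h1 t + c2 * h2 t + c3 * h3 t + c4 * h4 t) =
  c1 * \int[mu]_t h1 t + c2 * \int[mu]_t h2 t + c3 * \int[mu]_t h3 t + c4 * \int[mu]_t h4 t.
Proof.
move=> i1 i2 i3 i4.
have key c h : mu.-integrable setT (EFin \o h) -> mu.-integrable setT
    (EFin \o (fun t : P => c * h t)).
  by move=> ih; exact: (integrableZl measurableT c ih).
have k1 := key c1 _ i1; have k2 := key c2 _ i2.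
have k3 := key c3 _ i3; have k4 := key c4 _ i4.
have i12 := integrableD measurableT k1 k2.
have i123 := integrableD measurableT i12 k3.
by rewrite !RintegralD// !RintegralZl.
Qed.

Let integrable_lin4 (h1 h2 h3 h4 : P -> R) (c1 c2 c3 c4 : R) :
  mu.-integrable setT (EFin \o h1) -> mu.-integrable setT (EFin \o h2) ->
  mu.-integrable setT (EFin \o h3) -> mu.-integrable setT (EFin \o h4) ->
  mu.-integrable setT
    (EFin \o (fun t => c1 * h1 t + c2 * h2 t + c3 * h3 t + c4 * h4 t)).
Proof.
move=> i1 i2 i3 i4.
have key c h : mu.-integrable setT (EFin \o h) -> mu.-integrable setT
    (EFin \o (fun t : P => c * h t)).
  by move=> ih; exact: (integrableZl measurableT c ih).
have i12 := integrableD measurableT (key c1 _ i1) (key c2 _ i2).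
have i123 := integrableD measurableT i12 (key c3 _ i3).
exact: (integrableD measurableT i123 (key c4 _ i4)).
Qed.

Lemma qintegrableMl a f : qintegrable f -> qintegrable (fun t => a * f t).
Proof.
move=> [i0 ii ij ik]; split.
- apply: eq_integrable (integrable_lin4 (q0 a) (- qi a) (- qj a) (- qk a) i0 ii ij ik) => //.
  by move=> t _ /=; congr EFin; ring.
- apply: eq_integrable (integrable_lin4 (q0 a) (qi a) (qj a) (- qk a) ii i0 ik ij) => //.
  by move=> t _ /=; congr EFin; ring.
- apply: eq_integrable (integrable_lin4 (q0 a) (- qi a) (qj a) (qk a) ij ik i0 ii) => //.
  by move=> t _ /=; congr EFin; ring.
- apply: eq_integrable (integrable_lin4 (q0 a) (qi a) (- qj a) (qk a) ik ij ii i0) => //.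
  by move=> t _ /=; congr EFin; ring.
Qed.

Lemma qintegralMl a f : qintegrable f -> qintegral (fun t => a * f t) = a * qintegral f.
Proof.
move=> [i0 ii ij ik]; apply: quat_eqP => /=.
- transitivity (q0 a * \int[mu]_t q0 (f t) + (- qi a) * \int[mu]_t qi (f t)
    + (- qj a) * \int[mu]_t qj (f t) + (- qk a) * \int[mu]_t qk (f t)).
    by rewrite -Rintegral_lin4//; apply: eq_Rintegral => t _; ring.
  rewrite !mulNr//.
- transitivity (q0 a * \int[mu]_t qi (f t) + qi a * \int[mu]_t q0 (f t)
    + qj a * \int[mu]_t qk (f t) + (- qk a) * \int[mu]_t qj (f t)).
    by rewrite -Rintegral_lin4//; apply: eq_Rintegral => t _; ring.
  rewrite !mulNr//.
- transitivity (q0 a * \int[mu]_t qj (f t) + (- qi a) * \int[mu]_t qk (f t)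
    + qj a * \int[mu]_t q0 (f t) + qk a * \int[mu]_t qi (f t)).
    by rewrite -Rintegral_lin4//; apply: eq_Rintegral => t _; ring.
  rewrite !mulNr//.
- transitivity (q0 a * \int[mu]_t qk (f t) + qi a * \int[mu]_t qj (f t)
    + (- qj a) * \int[mu]_t qi (f t) + qk a * \int[mu]_t q0 (f t)).
    by rewrite -Rintegral_lin4//; apply: eq_Rintegral => t _; ring.
  rewrite !mulNr//.
Qed.

Lemma qintegralMr a f : qintegrable f -> qintegral (fun t => f t * a) = qintegral f * a.
Proof.
move=> [i0 ii ij ik]; apply: quat_eqP => /=.
- transitivity (q0 a * \int[mu]_t q0 (f t) + (- qi a) * \int[mu]_t qi (f t)
    + (- qj a) * \int[mu]_t qj (f t) + (- qk a) * \int[mu]_t qk (f t)).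
    by rewrite -Rintegral_lin4//; apply: eq_Rintegral => t _; ring.
  rewrite !mulNr -!(mulrC (\int[_]_t _))//.
- transitivity (q0 a * \int[mu]_t qi (f t) + qi a * \int[mu]_t q0 (f t)
    + (- qj a) * \int[mu]_t qk (f t) + qk a * \int[mu]_t qj (f t)).
    by rewrite -Rintegral_lin4//; apply: eq_Rintegral => t _; ring.
  rewrite /plane_lebesgue; ring.
- transitivity (q0 a * \int[mu]_t qj (f t) + qi a * \int[mu]_t qk (f t)
    + qj a * \int[mu]_t q0 (f t) + (- qk a) * \int[mu]_t qi (f t)).
    by rewrite -Rintegral_lin4//; apply: eq_Rintegral => t _; ring.
  rewrite /plane_lebesgue; ring.
- transitivity (q0 a * \int[mu]_t qk (f t) + (- qi a) * \int[mu]_t qj (f t)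
    + qj a * \int[mu]_t qi (f t) + qk a * \int[mu]_t q0 (f t)).
    by rewrite -Rintegral_lin4//; apply: eq_Rintegral => t _; ring.
  rewrite /plane_lebesgue; ring.
Qed.

Lemma qintegralB f g : qintegrable f -> qintegrable g ->
  qintegral (fun t => f t - g t) = qintegral f - qintegral g.
Proof.
by move=> [? ? ? ?] [? ? ? ?]; apply: quat_eqP => /=; rewrite -RintegralB.
Qed.

Lemma Lq_isometry p f g : qmeasurable g -> (forall t, qnormsq (g t) = qnormsq (f t)) ->
  Lq p f -> Lq p g.
Proof.
move=> mg fg [mf foo]; split => //; move: foo; rewrite /qLnorm.
by under [X in (X < _)%E -> _]eq_Lnorm => t do rewrite /qmod -/(qnormsq (f t)) -fg.
Qed.

End qintegral_linear.

(** * The offset linear canonical transform as a chirped Fourier transform *)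

Section olct_transform.
Variable R : realType.
Notation line := (measurableTypeR R).
Notation P := (line * line)%type.
Implicit Types (f g : R * R -> quat R) (m : olct_param R) (u t : R * R).

Lemma qmeasurable_ei (phi : P -> R) : measurable_fun [set: P] phi ->
  qmeasurable (fun t => ei (phi t)).
Proof.
move=> mphi; split => //=.
- exact: (measurableT_comp (measurable_trig false) mphi).
- exact: (measurableT_comp (measurable_trig true) mphi).
Qed.

Lemma qmeasurable_ej (phi : P -> R) : measurable_fun [set: P] phi ->
  qmeasurable (fun t => ej (phi t)).
Proof.
move=> mphi; split => //=.
- exact: (measurableT_comp (measurable_trig false) mphi).
- exact: (measurableT_comp (measurable_trig true) mphi).
Qed.

(** The phase of the kernel is a function of [t] alone, a function of [u]
    alone and the bilinear Fourier phase [- u t / b]. *)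
Definition phase_in m (t : R) : R := (oa m * t ^+ 2 + 2 * t * otau m) / (2 * ob m).

Definition phase_out m (u : R) : R :=
  (- 2 * u * (od m * otau m - ob m * oeta m) + od m * u ^+ 2 + od m * otau m ^+ 2)
  / (2 * ob m).

Lemma olct_phaseE m (u t : R) : ob m != 0 ->
  olct_phase m u t = phase_out m u + - ((ob m)^-1 * u * t) + phase_in m t.
Proof. by move=> b0; rewrite /olct_phase /phase_out /phase_in; field. Qed.

Definition olct_const m : R[i] := sqrtc ((Complex 0 (2 * pi * ob m))^-1).

Lemma expiD (a b : R) : expi (a + b) = expi a * expi b.
Proof.
by rewrite /expi cosD sinD; apply/eqP; rewrite eq_complex /=; apply/andP; split;
  apply/eqP; ring.
Qed.

Lemma Lq_modulate (b1 b2 : R) p g u : Lq p g ->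
  Lq p (fun t => ei (- (b1 * u.1 * t.1)) * g t * ej (- (b2 * u.2 * t.2))).
Proof.
move=> Lg; apply: Lq_isometry (Lg); last first.
  by move=> t; rewrite !qnormsqM qnormsq_ei qnormsq_ej mul1r mulr1.
have mlin c (r : P -> R) : measurable_fun [set: P] r ->
    measurable_fun [set: P] (fun t => - (c * r t)).
  move=> mr; rewrite (_ : (fun t => _) = (fun t => - c * r t)).
    exact: measurable_funM.
  by apply/funext => t; rewrite mulNr.
apply: qmeasurableM; last first.
  by apply: qmeasurable_ej; apply: mlin; exact: measurable_coord2.
apply: qmeasurableM; last by case: Lg.
by apply: qmeasurable_ei; apply: mlin; exact: measurable_coord1.
Qed.

Variable M : 'I_2 -> olct_param R.
Hypothesis hb : forall k, ob (M k) != 0.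
Notation m1 := (M ord0).
Notation m2 := (M ord_max).
Notation b1 := ((ob m1)^-1).
Notation b2 := ((ob m2)^-1).

Definition chirp f t : quat R :=
  ei (phase_in m1 t.1) * f t * ej (phase_in m2 t.2).

Let measurable_phase_in m (c : P -> R) : measurable_fun [set: P] c ->
  measurable_fun [set: P] (fun t => phase_in m (c t)).
Proof.
move=> mc; apply: measurable_funM => //; apply: measurable_funD.
  by apply: measurable_funM => //; exact: measurable_funX.
by apply: measurable_funM => //; exact: measurable_funM.
Qed.

Lemma measurable_phase_out m (c : P -> R) : measurable_fun [set: P] c ->
  measurable_fun [set: P] (fun t => phase_out m (c t)).
Proof.
move=> mc; apply: measurable_funM => //; apply: measurable_funD => //; apply: measurable_funD.
  by apply: measurable_funM => //; exact: measurable_funM.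
by apply: measurable_funM => //; exact: measurable_funX.
Qed.

Lemma qmeasurable_chirp f : qmeasurable f -> qmeasurable (chirp f).
Proof.
move=> mf; apply: qmeasurableM.
  apply: qmeasurableM => //; apply: qmeasurable_ei; apply: measurable_phase_in.
  exact: measurable_coord1.
by apply: qmeasurable_ej; apply: measurable_phase_in; exact: measurable_coord2.
Qed.

Lemma qnormsq_chirp f t : qnormsq (chirp f t) = qnormsq (f t).
Proof. by rewrite !qnormsqM qnormsq_ei qnormsq_ej mul1r mulr1. Qed.

Lemma qnorm2_chirp f : qnorm2 (chirp f) = qnorm2 f.
Proof. by apply: eq_integral => t _; rewrite qnormsq_chirp. Qed.

Lemma chirp_sub f g t : chirp (fun s => f s - g s) t = chirp f t - chirp g t.
Proof. by rewrite /chirp mulrBr mulrBl. Qed.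

Lemma Lq_chirp p f : Lq p f -> Lq p (chirp f).
Proof.
move=> Lf; apply: Lq_isometry (Lf); last exact: qnormsq_chirp.
by apply: qmeasurable_chirp; case: Lf.
Qed.

(** The chirps factor out of the kernel, up to a factor that depends on the
    frequency only. *)
Lemma QOLCT1_chirp f u : Lq 1%:E f -> QOLCT1 M f u =
  (complex_i (olct_const m1) * ei (phase_out m1 u.1)) * QFT b1 b2 (chirp f) u
  * (ej (phase_out m2 u.2) * complex_j (olct_const m2)).
Proof.
move=> Lf; have Lg := Lq_modulate b1 b2 u (Lq_chirp Lf).
have iq := Lq1_qintegrable Lg.
rewrite -qintegralMl//.
have iq' : qintegrable (fun t => (complex_i (olct_const m1) * ei (phase_out m1 u.1)) *
    (ei (- (b1 * u.1 * t.1)) * chirp f t * ej (- (b2 * u.2 * t.2)))).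
  exact: qintegrableMl.
rewrite -qintegralMr//; congr qintegral; apply/funext => t.
rewrite /olct_kernel -/(olct_const m1) -/(olct_const m2) !olct_phaseE//.
rewrite [olct_const m2 * _]mulrC !expiD complex_iM !complex_iM !complex_jM.
rewrite !complex_i_expi !complex_j_expi /chirp.
have -> : ej (phase_out m2 u.2) * ej (- (b2 * u.2 * t.2)) * ej (phase_in m2 t.2) =
   ej (phase_in m2 t.2) * ej (- (b2 * u.2 * t.2)) * ej (phase_out m2 u.2).
  by rewrite -!ejD; congr ej; ring.
by rewrite !mulrA.
Qed.

End olct_transform.

Section plane_shift_transform.
Variable R : realType.
Notation line := (measurableTypeR R).
Notation P := (line * line)%type.
Notation mu := (@plane_lebesgue R).
Implicit Types (f g : R * R -> quat R) (u t : R * R) (c d : R).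

Lemma measurable_plane_shift c d :
  measurable_fun [set: P] (fun z : P => ((z.1 + c)%R, (z.2 + d)%R) : P).
Proof.
by apply: measurable_fun_pair;
  [exact: (measurableT_comp (measurable_shift c) measurable_fst)|
   exact: (measurableT_comp (measurable_shift d) measurable_snd)].
Qed.

Lemma integral_plane_shift c d (F : P -> \bar R) : measurable_fun [set: P] F ->
  (\int[mu]_z F ((z.1 + c)%R, (z.2 + d)%R) = \int[mu]_z F z)%E.
Proof.
move=> mF; rewrite integralE [RHS]integralE; congr (_ - _)%E.
  rewrite -(ge0_integral_plane_shift c d (measurable_funepos mF))//.
  by apply: eq_integral => z _; rewrite !funeposE.
rewrite -(ge0_integral_plane_shift c d (measurable_funeneg mF))//.
by apply: eq_integral => z _; rewrite !funenegE.
Qed.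

Lemma qintegral_shift c d f : qmeasurable f ->
  qintegral (fun t => f (t.1 + c, t.2 + d)) = qintegral f.
Proof.
move=> [m0 mi mj mk]; apply: quat_eqP => /=; congr fine.
- by apply: (integral_plane_shift c d (F := EFin \o (fun t : P => q0 (f t)))); exact/measurable_EFinP.
- by apply: (integral_plane_shift c d (F := EFin \o (fun t : P => qi (f t)))); exact/measurable_EFinP.
- by apply: (integral_plane_shift c d (F := EFin \o (fun t : P => qj (f t)))); exact/measurable_EFinP.
- by apply: (integral_plane_shift c d (F := EFin \o (fun t : P => qk (f t)))); exact/measurable_EFinP.
Qed.

Lemma qmeasurable_shift c d f : qmeasurable f ->
  qmeasurable (fun t => f (t.1 + c, t.2 + d)).
Proof.
move=> [m0 mi mj mk]; split.
- exact: (measurableT_comp m0 (measurable_plane_shift c d)).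
- exact: (measurableT_comp mi (measurable_plane_shift c d)).
- exact: (measurableT_comp mj (measurable_plane_shift c d)).
- exact: (measurableT_comp mk (measurable_plane_shift c d)).
Qed.

Lemma qnorm2_shift c d f : qmeasurable f ->
  qnorm2 (fun t => f (t.1 + c, t.2 + d)) = qnorm2 f.
Proof.
move=> mf; apply: (integral_plane_shift c d (F := fun t : P => (qnormsq (f t))%:E)).
by apply/measurable_EFinP; exact: measurable_qnormsq.
Qed.

Lemma integrable_plane_shift c d (h : P -> R) : mu.-integrable setT (EFin \o h) ->
  mu.-integrable setT (EFin \o (fun t : P => h (t.1 + c, t.2 + d))).
Proof.
move=> /integrableP[mh hoo]; apply/integrableP; split.
  exact: (measurableT_comp mh (measurable_plane_shift c d)).
by rewrite (integral_plane_shift c d (F := fun t => `|(EFin \o h) t|%E))//; exact: measurableT_comp.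
Qed.

Lemma L12_shift c d (h : P -> R) : L12 h -> L12 (fun t : P => h (t.1 + c, t.2 + d)).
Proof.
by move=> [ih ih2]; split; [exact: integrable_plane_shift|exact: (integrable_plane_shift c d ih2)].
Qed.

Lemma qL12_shift c d f : qL12 f -> qL12 (fun t => f (t.1 + c, t.2 + d)).
Proof.
move=> [L0 Li Lj Lk]; split.
- exact: (L12_shift c d L0).
- exact: (L12_shift c d Li).
- exact: (L12_shift c d Lj).
- exact: (L12_shift c d Lk).
Qed.

Lemma qL12B f g : qL12 f -> qL12 g -> qL12 (fun t => f t - g t).
Proof. by move=> [? ? ? ?] [? ? ? ?]; split; exact: L12B. Qed.

Lemma Lq1_shift c d f : Lq 1%:E f -> Lq 1%:E (fun t => f (t.1 + c, t.2 + d)).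
Proof.
move=> /Lq1P[mf foo]; apply/Lq1P; split; first exact: qmeasurable_shift.
rewrite (integral_plane_shift c d (F := fun t : P => (qmod (f t))%:E))//.
by apply/measurable_EFinP; exact: measurable_qmod.
Qed.

Variables (b1 b2 : R).
Notation QFT := (QFT b1 b2).

Lemma QFT_sub f g u : Lq 1%:E f -> Lq 1%:E g ->
  QFT (fun t => f t - g t) u = QFT f u - QFT g u.
Proof.
move=> Lf Lg.
rewrite -qintegralB; last 2 first.
- exact: (Lq1_qintegrable (Lq_modulate b1 b2 u Lf)).
- exact: (Lq1_qintegrable (Lq_modulate b1 b2 u Lg)).
by congr qintegral; apply/funext => t; rewrite mulrBr mulrBl.
Qed.

(** The left and the right exponential each carry the translation of one
    coordinate out of the integral, on their own side. *)
Lemma QFT_shift c d g u : Lq 1%:E g ->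
  QFT (fun t => g (t.1 + c, t.2 + d)) u = ei (b1 * u.1 * c) * QFT g u * ej (b2 * u.2 * d).
Proof.
move=> Lg; have Lm := Lq_modulate b1 b2 u Lg.
have iq := Lq1_qintegrable Lm.
rewrite -qintegralMl// -qintegralMr; last exact: qintegrableMl.
rewrite -[RHS](qintegral_shift c d); last first.
  have mc (a : quat R) : qmeasurable (fun=> a) by split; exact: measurable_cst.
  by apply: qmeasurableM => //; apply: qmeasurableM => //; case: Lm.
congr qintegral; apply/funext => t /=.
rewrite !mulrA -eiD -!mulrA -ejD !mulrA; congr (ei _ * _ * ej _).
  by rewrite mulrDr opprD addrCA subrr addr0.
by rewrite mulrDr opprD -addrA addNr addr0.
Qed.

Lemma qnormsq_ei_sub x (q : quat R) :
  qnormsq (ei x * q - q) = (2 - 2 * cos x) * qnormsq q.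
Proof.
rewrite -{2}[q]mul1r -mulrBl qnormsqM; congr (_ * _).
by rewrite /qnormsq /=; have := cos2Dsin2 x; lra.
Qed.

Lemma qnormsq_ej_sub x (q : quat R) :
  qnormsq (q * ej x - q) = (2 - 2 * cos x) * qnormsq q.
Proof.
rewrite -{2}[q]mulr1 -mulrBr qnormsqM mulrC; congr (_ * _).
by rewrite /qnormsq /=; have := cos2Dsin2 x; lra.
Qed.

End plane_shift_transform.

Section olct_plancherel.
Variable R : realType.
Notation mu := (@plane_lebesgue R).
Implicit Types (f g : R * R -> quat R) (u t : R * R).
Variable M : 'I_2 -> olct_param R.
Hypothesis hb : forall k, ob (M k) != 0.
Notation m1 := (M ord0).
Notation m2 := (M ord_max).
Notation b1 := ((ob m1)^-1).
Notation b2 := ((ob m2)^-1).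

(** The chirps have modulus 1, and the squared moduli of the square roots
    multiply to the inverse of [trig_mass]. *)
Lemma qnormsq_QOLCT1 f u : Lq 1%:E f ->
  qnormsq (QFT b1 b2 (chirp M f) u) = trig_mass b1 b2 * qnormsq (QOLCT1 M f u).
Proof.
move=> Lf; rewrite QOLCT1_chirp// !qnormsqM qnormsq_ei qnormsq_ej mulr1 mul1r.
rewrite qnormsq_complex_j /olct_const.
have pi0 : pi != 0 :> R by rewrite lt0r_neq0// pi_gt0.
rewrite !qnormsq_sqrtc ?mulf_neq0//; rewrite /trig_mass !normfV !normrM.
have n1 : `|ob m1| != 0 by rewrite normr_eq0.
have n2 : `|ob m2| != 0 by rewrite normr_eq0.
rewrite !(@ger0_norm _ pi) ?pi_ge0// !(@ger0_norm _ 2)//.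
by move: pi pi0 => p p0; field; rewrite n1 n2 p0.
Qed.

Let b1_neq0 : b1 != 0. Proof. by rewrite invr_eq0. Qed.
Let b2_neq0 : b2 != 0. Proof. by rewrite invr_eq0. Qed.

Lemma qmeasurable_QOLCT1 f : Lq 1%:E f -> Lq 2%:E f -> qmeasurable (QOLCT1 M f).
Proof.
move=> Lf Lf2; rewrite (funext (fun u => QOLCT1_chirp hb u Lf)).
have mc (a : quat R) : qmeasurable (fun=> a) by split; exact: measurable_cst.
have mF : qmeasurable (QFT b1 b2 (chirp M f)).
  by apply: qmeasurable_QFT; apply: Lq12_qL12; exact: Lq_chirp.
apply: qmeasurableM.
  apply: qmeasurableM => //; apply: qmeasurableM => //; apply: qmeasurable_ei.
  by apply: measurable_phase_out; exact: measurable_coord1.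
apply: qmeasurableM => //; apply: qmeasurable_ej.
by apply: measurable_phase_out; exact: measurable_coord2.
Qed.

Theorem QOLCT1_plancherel f : Lq 1%:E f -> Lq 2%:E f -> qnorm2 (QOLCT1 M f) = qnorm2 f.
Proof.
move=> Lf Lf2; have Lg := Lq12_qL12 (Lq_chirp M Lf) (Lq_chirp M Lf2).
have C0 := trig_mass_gt0 b1_neq0 b2_neq0.
have E : (qnorm2 (QFT b1 b2 (chirp M f)) = (trig_mass b1 b2)%:E * qnorm2 (QOLCT1 M f))%E.
  rewrite -integral_scale_qnormsq; [|exact: ltW|exact: qmeasurable_QOLCT1].
  by apply: eq_integral => u _; rewrite qnormsq_QOLCT1.
have := QFT_plancherel b1_neq0 b2_neq0 Lg; rewrite E qnorm2_chirp.
move/(congr1 (fun x => (trig_mass b1 b2)^-1%:E * x)%E).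
by rewrite !muleA -EFinM mulVf ?lt0r_neq0// !mul1e.
Qed.

Lemma QOLCT1_sub f g u : Lq 1%:E f -> Lq 1%:E g ->
  Lq 1%:E (fun t => f t - g t) ->
  QOLCT1 M (fun t => f t - g t) u = QOLCT1 M f u - QOLCT1 M g u.
Proof.
move=> Lf Lg Lfg; rewrite !QOLCT1_chirp//.
rewrite (funext (fun t => chirp_sub M f g t)) QFT_sub; [|exact: Lq_chirp|exact: Lq_chirp].
by rewrite mulrBr mulrBl.
Qed.

Definition shift_coord (k : 'I_2) (h : R) (t : R * R) : R * R :=
  if k == ord0 then (t.1 + h, t.2) else (t.1, t.2 + h).

(** Translating the chirped function multiplies its transform by a unit
    quaternion, whence the symbol [2 - 2 cos] of the squared difference. *)
Lemma qnorm2_shift_chirp k h f : Lq 1%:E f -> Lq 2%:E f ->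
  qnorm2 (fun t => chirp M f (shift_coord k h t) - chirp M f t) =
  (\int[mu]_u ((2 - 2 * cos ((ob (M k))^-1 * Defs.coord k u * h)) *
     qnormsq (QOLCT1 M f u))%:E)%E.
Proof.
move=> Lf Lf2; have Lg1 := Lq_chirp M Lf.
have Lg := Lq12_qL12 Lg1 (Lq_chirp M Lf2).
have C0 := trig_mass_gt0 b1_neq0 b2_neq0.
pose c := if k == ord0 then h else 0; pose d := if k == ord0 then 0 else h.
have sE t : shift_coord k h t = (t.1 + c, t.2 + d).
  by rewrite /shift_coord /c /d; case: ifP => _; rewrite addr0.
under [in LHS]eq_fun do rewrite sE.
have LD := qL12B (qL12_shift c d Lg) Lg.
have := QFT_plancherel b1_neq0 b2_neq0 LD.
move/(congr1 (fun x => (trig_mass b1 b2)^-1%:E * x)%E).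
rewrite muleA -EFinM mulVf ?lt0r_neq0// mul1e => <-.
rewrite -integral_scale_qnormsq; last 2 first.
- by rewrite invr_ge0 ltW.
- exact: qmeasurable_QFT.
apply: eq_integral => u _; congr EFin.
rewrite QFT_sub//; last exact: Lq1_shift.
rewrite QFT_shift//.
have -> : qnormsq (QOLCT1 M f u) = (trig_mass b1 b2)^-1 * qnormsq (QFT b1 b2 (chirp M f) u).
  by rewrite qnormsq_QOLCT1// mulKf// lt0r_neq0.
rewrite [RHS]mulrCA; congr (_ * _).
have e1 : ei 0 = 1 :> quat R by rewrite /ei cos0 sin0.
have e2 : ej 0 = 1 :> quat R by rewrite /ej cos0 sin0.
rewrite /c /d /Defs.coord; case: ifPn => [/eqP ->|k1].
  by rewrite mulr0 e2 mulr1 qnormsq_ei_sub.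
have -> : k = ord_max by case: k k1 {c d sE LD} => -[|[|//]] //= kk _; exact: val_inj.
by rewrite mulr0 e1 mul1r qnormsq_ej_sub.
Qed.

End olct_plancherel.

(** * Limits and completeness in the space of square-integrable functions *)

Section L2_tools.
Variable R : realType.
Notation line := (measurableTypeR R).
Notation P := (line * line)%type.
Notation mu := (@plane_lebesgue R).
Implicit Types (f g : R * R -> quat R) (t : R * R).

Lemma qnorm2D_le (r : R) f g : 0 < r -> qmeasurable f -> qmeasurable g ->
  (qnorm2 (fun t => f t + g t)%R <=
   (1 + r)%:E * qnorm2 f + (1 + r^-1)%:E * qnorm2 g)%E.
Proof.
move=> r0 mf mg.
have c1 : 0 <= 1 + r by rewrite addr_ge0// ltW.
have c2 : 0 <= 1 + r^-1 by rewrite addr_ge0// invr_ge0 ltW.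
have m1 := measurable_EFin_qnormsq mf; have m2 := measurable_EFin_qnormsq mg.
have mm1 := measurable_funeM (1 + r)%:E m1; have mm2 := measurable_funeM (1 + r^-1)%:E m2.
rewrite /qnorm2 -ge0_integralZl//; last by move=> t _; rewrite lee_fin qnormsq_ge0.
rewrite -ge0_integralZl//; last by move=> t _; rewrite lee_fin qnormsq_ge0.
rewrite -ge0_integralD//; last 2 first.
- by move=> t _; rewrite -EFinM lee_fin mulr_ge0 ?qnormsq_ge0.
- by move=> t _; rewrite -EFinM lee_fin mulr_ge0 ?qnormsq_ge0.
apply: ge0_le_integral => //.
- by move=> t _; rewrite lee_fin qnormsq_ge0.
- by apply: measurable_EFin_qnormsq; exact: qmeasurableD.
- exact: emeasurable_funD.
by move=> t _; rewrite -!EFinM -EFinD lee_fin qnormsqD_le.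
Qed.

Lemma qnorm2_subC f g : qnorm2 (fun t => f t - g t) = qnorm2 (fun t => g t - f t).
Proof. by apply: eq_integral => t _; rewrite -qnormsqN opprB. Qed.

Lemma qnorm2B_le2 f g : qmeasurable f -> qmeasurable g ->
  (qnorm2 (fun t => f t - g t)%R <= 2%:E * qnorm2 f + 2%:E * qnorm2 g)%E.
Proof.
move=> mf mg; have := qnorm2D_le (@ltr01 R) mf (qmeasurableN mg).
rewrite invr1 -[(1 + 1)%R]/(2 : R) => /le_trans; apply; rewrite leeD2l//.
by apply: lee_wpmul2l => //; rewrite le_eqVlt; apply/orP; left; apply/eqP;
  apply: eq_integral => t _; rewrite qnormsqN.
Qed.

Lemma Lq2B f g : Lq 2%:E f -> Lq 2%:E g -> Lq 2%:E (fun t => f t - g t).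
Proof.
move=> /Lq2P[mf foo] /Lq2P[mg goo]; apply/Lq2P; split; first exact: qmeasurableB.
apply: le_lt_trans (qnorm2B_le2 mf mg) _.
move: foo goo; have := qnorm2_ge0 f; have := qnorm2_ge0 g.
by case: (qnorm2 f) => [a||]//; case: (qnorm2 g) => [b||]// _ _ _ _; rewrite -!EFinM -EFinD ltry.
Qed.

Lemma qmodB_le (x y : quat R) : qmod (x - y) <= 2 * qmod x + 2 * qmod y.
Proof.
rewrite -ler_sqr ?nnegrE ?addr_ge0 ?mulr_ge0 ?qmod_ge0// sqr_qmod.
have := qnormsqD_le x (- y) (@ltr01 R); rewrite invr1 qnormsqN -!sqr_qmod => h.
have := mulr_ge0 (qmod_ge0 x) (qmod_ge0 y).
by have := (sqr_ge0 (qmod x), sqr_ge0 (qmod y)) => -[]; move: h; lra.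
Qed.

Lemma Lq1B f g : Lq 1%:E f -> Lq 1%:E g -> Lq 1%:E (fun t => f t - g t).
Proof.
move=> /Lq1P[mf foo] /Lq1P[mg goo]; apply/Lq1P; split; first exact: qmeasurableB.
have m1 : measurable_fun [set: P] (fun t : P => (qmod (f t))%:E).
  by apply/measurable_EFinP; exact: measurable_qmod.
have m2 : measurable_fun [set: P] (fun t : P => (qmod (g t))%:E).
  by apply/measurable_EFinP; exact: measurable_qmod.
have mm1 := measurable_funeM 2%:E m1; have mm2 := measurable_funeM 2%:E m2.
apply: (@le_lt_trans _ _ (\int[mu]_t (2%:E * (qmod (f t))%:E + 2%:E * (qmod (g t))%:E))%E).
  apply: ge0_le_integral => //.
  - by move=> t _; rewrite lee_fin qmod_ge0.
  - by apply/measurable_EFinP; apply: measurable_qmod; exact: qmeasurableB.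
  - exact: emeasurable_funD.
  - by move=> t _; rewrite -!EFinM -EFinD lee_fin qmodB_le.
rewrite ge0_integralD//; last 2 first.
- by move=> t _; rewrite mule_ge0// lee_fin qmod_ge0.
- by move=> t _; rewrite mule_ge0// lee_fin qmod_ge0.
rewrite ge0_integralZl//; last by move=> t _; rewrite lee_fin qmod_ge0.
rewrite ge0_integralZl//; last by move=> t _; rewrite lee_fin qmod_ge0.
by rewrite lte_add_pinfty// lte_mul_pinfty.
Qed.

Lemma cvg_qLnorm2 (x : nat -> R * R -> quat R) :
  qLnorm 2%:E (x n) @[n --> \oo] --> 0%E <-> qnorm2 (x n) @[n --> \oo] --> 0%E.
Proof.
split => h.
  rewrite (_ : (fun n => _) = (fun n => qLnorm 2%:E (x n) * qLnorm 2%:E (x n))%E); last first.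
    by apply/funext => n; rewrite -sqr_qLnorm2 expe2.
  by rewrite -[X in _ --> X](mule0 0); apply: cvgeM.
have [fn hc] := (fine_cvgP _ _).1 h.
apply/fine_cvgP; split.
  near=> n; have : qnorm2 (x n) \is a fin_num by near: n.
  by rewrite qLnorm2E; case: (qnorm2 _) => // r; rewrite poweR_EFin.
have hs : Num.sqrt (fine (qnorm2 (x n))) @[n --> \oo] --> (0 : R).
  rewrite -[X in _ --> X]sqrtr0.
  exact: (cvg_comp _ _ hc (@sqrt_continuous R 0)).
apply: cvg_trans hs; apply: near_eq_cvg; near=> n.
have : qnorm2 (x n) \is a fin_num by near: n.
rewrite /= qLnorm2E; have := qnorm2_ge0 (x n); case: (qnorm2 _) => // r r0 _.
by rewrite poweR_EFin /= powR12_sqrt.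
Unshelve. all: by end_near. Qed.

End L2_tools.

Section L2_limits.
Variable R : realType.
Notation line := (measurableTypeR R).
Notation P := (line * line)%type.
Implicit Types (x y : R * R -> quat R) (u t : R * R).

(** As [qnorm2] is the square of a norm, Young's inequality with a small
    weight [r] stands in for the triangle inequality. *)
Lemma qnorm2_lim_le x y (x_ y_ : nat -> R * R -> quat R) :
  qmeasurable x -> qmeasurable y ->
  (forall n, qmeasurable (x_ n)) -> (forall n, qmeasurable (y_ n)) ->
  qnorm2 (fun t => x_ n t - x t) @[n --> \oo] --> 0%E ->
  qnorm2 (fun t => y_ n t - y t) @[n --> \oo] --> 0%E ->
  (forall n, qnorm2 (x_ n) <= qnorm2 (y_ n))%E -> (qnorm2 x <= qnorm2 y)%E.
Proof.
move=> mx my mxn myn cx cy hle.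
have [->|yfin] := eqVneq (qnorm2 y) +oo%E; first by rewrite leey.
have step (r : R) : 0 < r -> (qnorm2 x <= ((1 + r) ^+ 2)%:E * qnorm2 y)%E.
  move=> r0.
  have r1 : 0 <= 1 + r by rewrite addr_ge0// ltW.
  have s1 : 0 <= 1 + r^-1 by rewrite addr_ge0// invr_ge0 ltW.
  pose B n := (((1 + r) ^+ 2)%:E * qnorm2 y
     + ((1 + r)%:E * ((1 + r^-1)%:E * qnorm2 (fun t => y_ n t - y t)%R)
     + (1 + r^-1)%:E * qnorm2 (fun t => x_ n t - x t)%R))%E.
  have bnd n : (qnorm2 x <= B n)%E.
    have e1 : x = (fun t => x_ n t + (x t - x_ n t)).
      by apply/funext => t; rewrite addrC subrK.
    have e2 : y_ n = (fun t => y t + (y_ n t - y t)).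
      by apply/funext => t; rewrite addrC subrK.
    rewrite {1}e1; apply: le_trans (qnorm2D_le r0 (mxn n) (qmeasurableB mx (mxn n))) _.
    rewrite [qnorm2 (fun t => x t - _)]qnorm2_subC /B addeA leeD2r//.
    apply: le_trans (lee_wpmul2l _ (hle n)) _; first by rewrite lee_fin.
    rewrite {1}e2.
    apply: le_trans (lee_wpmul2l _ (qnorm2D_le r0 my (qmeasurableB (myn n) my))) _.
      by rewrite lee_fin.
    by rewrite ge0_muleDr ?mule_ge0 ?qnorm2_ge0 ?lee_fin// muleA -EFinM expr2.
  have Bcvg : B n @[n --> \oo] --> (((1 + r) ^+ 2)%:E * qnorm2 y)%E.
    rewrite -[X in _ --> X]adde0; apply: cvgeD.
    - by rewrite fin_num_adde_defl.
    - exact: cvg_cst.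
    rewrite -[X in _ --> X]adde0; apply: cvgeD => //.
      rewrite -[X in _ --> X](mule0 (1 + r)%:E); apply: cvgeZl => //.
      by rewrite -[X in _ --> X](mule0 (1 + r^-1)%:E); apply: cvgeZl.
    by rewrite -[X in _ --> X](mule0 (1 + r^-1)%:E); apply: cvgeZl.
  rewrite -(cvg_lim _ Bcvg)//; apply: lime_ge; first by apply/cvg_ex; eexists; exact: Bcvg.
  exact: nearW.
move: step yfin; have := qnorm2_ge0 x; have := qnorm2_ge0 y.
case: (qnorm2 y) => [Y||]//; case: (qnorm2 x) => [X||]//; last first.
  by move=> _ _ /(_ 1 ltr01).
rewrite !lee_fin => Y0 X0 step _.
have {}step (r : R) : 0 < r -> X <= (1 + r) ^+ 2 * Y by move/step; rewrite -EFinM lee_fin.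
have hc : (1 + n.+1%:R^-1) ^+ 2 * Y @[n --> \oo] --> Y.
  rewrite -[X in _ --> X]mul1r; apply: cvgM; last exact: cvg_cst.
  have h1 : 1 + n.+1%:R^-1 @[n --> \oo] --> (1 : R).
    by rewrite -[X in _ --> X]addr0; apply: cvgD; [exact: cvg_cst|exact: cvg_harmonic].
  by have := cvgM h1 h1; rewrite mulr1; exact.
rewrite -(cvg_lim _ hc)//; apply: limr_ge; first by apply/cvg_ex; eexists; exact: hc.
by apply: nearW => n; exact: step.
Qed.

Lemma cvg_geometric_increments (c : nat -> R) (A : R) :
  (forall n, `|c n.+1 - c n| <= A * 2^-1 ^+ n) -> cvgn c.
Proof.
move=> hc.
have A0 n : 0 <= A * 2^-1 ^+ n by apply: le_trans (hc n); exact: normr_ge0.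
have : cvgn (series (fun n => c n.+1 - c n)).
  apply: normed_cvg; apply: (@series_le_cvg _ _ (geometric A 2^-1)).
  - by move=> n; exact: normr_ge0.
  - exact: A0.
  - exact: hc.
  by apply: is_cvg_geometric_series; rewrite ger0_norm ?invr_ge0// invf_lt1// ltr1n.
rewrite (_ : series _ = (fun n => c n - c 0%N)); last first.
  by apply/funext => n; rewrite /series /= telescope_sumr.
move=> h; have : cvgn (fun n => (c n - c 0%N) + c 0%N).
  by apply: is_cvgD => //; exact: is_cvg_cst.
by under eq_fun do rewrite subrK.
Qed.

(** The upper limit is measurable without any convergence hypothesis, and is
    the limit wherever there is one; this gives measurable limits of sequences
    that converge only almost everywhere. *)
Lemma measurable_fine_limn_esup (h : nat -> P -> R) :
  (forall n, measurable_fun [set: P] (h n)) ->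
  measurable_fun [set: P] (fun u => fine (limn_esup (fun n => (h n u)%:E))).
Proof.
move=> mh; apply: (measurableT_comp (@fine_measurable R setT measurableT)).
apply: (@measurable_fun_limn_esup _ _ _ _ (fun n u => (h n u)%:E)).
by move=> n; apply/measurable_EFinP; exact: mh.
Qed.

Lemma fine_limn_esup_cvg (c : nat -> R) : cvgn c ->
  c n @[n --> \oo] --> fine (limn_esup (fun n => (c n)%:E)).
Proof.
move=> hc; have hE : (c n)%:E @[n --> \oo] --> (limn c)%:E.
  by apply: cvg_EFin => //; exact: nearW.
rewrite is_cvg_limn_esupE; last by apply/cvg_ex; eexists; exact: hE.
by rewrite (cvg_lim _ hE).
Qed.

End L2_limits.

Section L2_complete.
Variable R : realType.
Notation line := (measurableTypeR R).
Notation P := (line * line)%type.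
Notation mu := (@plane_lebesgue R).
Implicit Types (t : R * R).

Lemma limn_einf_le (c : \bar R) (u : nat -> \bar R) (N : nat) :
  (forall n, (N <= n)%N -> u n <= c)%E -> (limn_einf u <= c)%E.
Proof.
move=> uc; rewrite limn_einf_lim; apply: lime_le; first exact: is_cvg_einfs.
by exists N => // n /= Nn; apply: le_trans (uc n Nn); apply: ereal_inf_lbound; exists n => /=.
Qed.

Lemma sum_half (n : nat) : \sum_(0 <= k < n) (2^-1 : R) ^+ k = 2 - 2 * 2^-1 ^+ n.
Proof.
elim: n => [|n IH]; first by rewrite big_nil expr0 mulr1 subrr.
by rewrite big_nat_recr//= IH exprS; lra.
Qed.

(** The sum of [4 ^ k |G k.+1 - G k| ^ 2] has a finite integral, its terms
    having integrals at most [2 ^ - k]; hence it is finite almost everywhere,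
    and there [|G k.+1 - G k|] is at most a multiple of [2 ^ - k]. *)
Lemma ae_geometric_increments (G : nat -> R * R -> quat R) :
  (forall n, qmeasurable (G n)) ->
  (forall n, qnorm2 (fun t => G n.+1 t - G n t)%R <= (8^-1 ^+ n)%:E)%E ->
  {ae mu, forall t : P, exists s : R, forall n,
     qmod (G n.+1 t - G n t) <= s * 2^-1 ^+ n}.
Proof.
move=> mG hG.
pose d n (t : P) := (4 ^+ n * qnormsq (G n.+1 t - G n t))%:E.
have d0 n t : (0 <= d n t)%E by rewrite lee_fin mulr_ge0 ?exprn_ge0// qnormsq_ge0.
have mq n : qmeasurable (fun t => G n.+1 t - G n t) by exact: qmeasurableB.
have md n : measurable_fun setT (d n).
  by apply/measurable_EFinP; apply: measurable_funM => //; exact: measurable_qnormsq.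
pose S (t : P) := (\sum_(n <oo) d n t)%E.
have S0 t : (0 <= S t)%E by apply: nneseries_ge0.
have mS : measurable_fun setT S.
  exact: (ge0_emeasurable_sum (fun n _ _ _ => d0 n _) (fun n _ => md n)).
have iS : mu.-integrable setT S.
  apply/integrableP; split => //.
  rewrite (_ : (\int[mu]_t _ = \int[mu]_t S t)%E); last first.
    by apply: eq_integral => t _; rewrite gee0_abs.
  rewrite integral_nneseries//.
  apply: (@le_lt_trans _ _ 2%:E); last exact: ltry.
  apply: lime_le; first by apply: is_cvg_nneseries => n _ _; apply: integral_ge0.
  apply: nearW => n; apply: (@le_trans _ _ (\sum_(0 <= k < n) (2^-1 ^+ k)%:E)%E).
    apply: lee_sum => k _.
    rewrite integral_scale_qnormsq ?exprn_ge0//.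
    apply: le_trans (lee_wpmul2l _ (hG k)) _; first by rewrite lee_fin exprn_ge0.
    rewrite -EFinM lee_fin -exprMn le_eqVlt; apply/orP; left; apply/eqP.
    by congr (_ ^+ _); field.
  by rewrite sumEFin sum_half lee_fin gerBl mulr_ge0// exprn_ge0.
have := integrable_ae measurableT iS; apply: filterS => t /(_ Logic.I) fS.
pose s := fine (S t); exists (Num.sqrt s) => n.
have h : 4 ^+ n * qnormsq (G n.+1 t - G n t) <= s.
  rewrite -lee_fin fineK//.
  apply: le_trans (@nneseries_lim_ge R (d^~ t) xpredT 0%N n.+1 _); last by move=> *; exact: d0.
  by rewrite big_nat_recr//= -[leLHS]add0e leeD2r// sume_ge0.
have s0 : 0 <= s by apply: le_trans h; rewrite mulr_ge0 ?exprn_ge0 ?qnormsq_ge0.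
rewrite -ler_sqr ?nnegrE ?qmod_ge0 ?mulr_ge0 ?sqrtr_ge0 ?exprn_ge0 ?invr_ge0//.
rewrite sqr_qmod exprMn sqr_sqrtr// -exprM mulnC exprM exprVn -natrX exprVn.
by rewrite ler_pdivlMr ?exprn_gt0// mulrC.
Qed.

(** Riesz-Fischer: the limit is taken componentwise, and Fatou's lemma
    turns the Cauchy bound into a bound on the distance to the limit. *)
Theorem L2_complete (G : nat -> R * R -> quat R) :
  (forall n, qmeasurable (G n)) ->
  (forall n m, (n <= m)%N -> qnorm2 (fun t => G m t - G n t)%R <= (8^-1 ^+ n)%:E)%E ->
  exists2 F : R * R -> quat R, qmeasurable F &
    forall n, (qnorm2 (fun t => F t - G n t)%R <= (8^-1 ^+ n)%:E)%E.
Proof.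
move=> mG hG.
pose L (c : quat R -> R) (t : P) := fine (limn_esup (fun n => (c (G n t))%:E)).
pose F (t : R * R) := Quat (L (@q0 R) t) (L (@qi R) t) (L (@qj R) t) (L (@qk R) t).
have mF : qmeasurable F.
  by split; apply: measurable_fine_limn_esup => n; case: (mG n).
exists F => // n.
have mX m : measurable_fun setT (fun t : P => (qnormsq (G m t - G n t))%:E).
  by apply: measurable_EFin_qnormsq; exact: qmeasurableB.
have X0 m t : (0 <= (qnormsq (G m t - G n t))%:E)%E by rewrite lee_fin qnormsq_ge0.
have ae : {ae mu, forall t : P, [set: P] t ->
    (limn_einf (fun m => (qnormsq (G m t - G n t))%:E)) = (qnormsq (F t - G n t))%:E}.
  have := ae_geometric_increments mG (fun k => hG k k.+1 (leqnSn k)).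
  apply: (@filterS _ _ (ae_filter_ringOfSetsType mu)) => t [s hs] _.
  have cv (c : quat R -> R) : (forall x y, c (x - y) = c x - c y) ->
      (forall x, `|c x| <= qmod x) -> c (G m t - G n t) @[m --> \oo] --> L c t - c (G n t).
    move=> cB cle.
    rewrite (_ : (fun m => c (G m t - G n t)) = (fun m => c (G m t) - c (G n t))); last first.
      by apply/funext => m; rewrite cB.
    apply: cvgB; last exact: cvg_cst.
    apply: fine_limn_esup_cvg; apply: (@cvg_geometric_increments _ _ s) => k.
    by rewrite -cB; exact: le_trans (cle _) (hs k).
  have cN := norm_components.
  have c0 := cv (@q0 R) (fun _ _ => erefl) (fun x => let: And4 h _ _ _ := cN _ x in h).
  have ci := cv (@qi R) (fun _ _ => erefl) (fun x => let: And4 _ h _ _ := cN _ x in h).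
  have cj := cv (@qj R) (fun _ _ => erefl) (fun x => let: And4 _ _ h _ := cN _ x in h).
  have ck := cv (@qk R) (fun _ _ => erefl) (fun x => let: And4 _ _ _ h := cN _ x in h).
  have h : qnormsq (G m t - G n t) @[m --> \oo] --> qnormsq (F t - G n t).
    exact: cvgD (cvgD (cvgD (cvgM c0 c0) (cvgM ci ci)) (cvgM cj cj)) (cvgM ck ck).
  have hE : (qnormsq (G m t - G n t))%:E @[m --> \oo] --> (qnormsq (F t - G n t))%:E.
    by apply: cvg_EFin => //; exact: nearW.
  rewrite is_cvg_limn_einfE; last by apply/cvg_ex; eexists; exact: hE.
  by rewrite (cvg_lim _ hE).
have mlim : measurable_fun setT (fun t : P => limn_einf (fun m => (qnormsq (G m t - G n t))%:E)).
  rewrite /limn_einf; apply: measurableT_comp => //.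
  apply: (@measurable_fun_limn_esup _ _ _ _ (fun m t => - (qnormsq (G m t - G n t))%:E)%E) => m.
  by apply: measurableT_comp => //; exact: mX.
rewrite /qnorm2 -(ge0_ae_eq_integral _ mlim _ _ _ ae)//; last 3 first.
- by apply: measurable_EFin_qnormsq; exact: qmeasurableB.
- move=> t _; rewrite limn_einf_lim; apply: lime_ge; first exact: is_cvg_einfs.
  by apply: nearW => m; apply: le_ereal_inf_tmp => _ [k _ <-]; exact: X0.
- by move=> t _; rewrite lee_fin qnormsq_ge0.
apply: le_trans (fatou mu measurableT mX (fun m t _ => X0 m t)) _.
by apply: (@limn_einf_le _ _ n) => m nm; exact: hG.
Qed.

End L2_complete.

(** * Extension of the transform to square-integrable functions *)

Section L2_density.
Variable R : realType.
Notation line := (measurableTypeR R).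
Notation P := (line * line)%type.
Notation mu := (@plane_lebesgue R).
Implicit Types (f : R * R -> quat R) (t : R * R).

(** Discarding the values of modulus below [1 / n.+1] makes the function
    integrable, because there [|f| <= n.+1 |f| ^ 2]. *)
Definition truncate (n : nat) f (t : R * R) : quat R :=
  \1_[set t | n.+1%:R^-1 <= qmod (f t)] t *: f t.

Lemma truncate_case n f t : truncate n f t = f t \/
  truncate n f t = 0 /\ qmod (f t) < n.+1%:R^-1.
Proof.
rewrite /truncate indicE; case: (boolP (t \in _)) => [_|]; first by left; rewrite scale1r.
by rewrite notin_setE /= => /negP; rewrite -ltNge => h; right; rewrite scale0r.
Qed.

Lemma qnormsq0 : qnormsq (0 : quat R) = 0.
Proof. by rewrite /qnormsq /= expr0n /= !addr0. Qed.

Lemma qmod0 : qmod (0 : quat R) = 0.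
Proof. by rewrite /qmod -/(qnormsq 0) qnormsq0 sqrtr0. Qed.

Lemma qmeasurable_truncate n f : qmeasurable f -> qmeasurable (truncate n f).
Proof.
move=> mf; apply: qmeasurableZ => //; apply: measurable_indic.
have := measurable_qmod mf measurableT (measurable_itv `[n.+1%:R^-1, +oo[).
rewrite setTI; congr measurable; apply/seteqP.
by split => t /=; rewrite in_itv /= andbT.
Qed.

Lemma Lq12_truncate n f : Lq 2%:E f -> Lq 1%:E (truncate n f) /\ Lq 2%:E (truncate n f).
Proof.
move=> /Lq2P[mf foo]; have mt := qmeasurable_truncate n mf; split.
  apply/Lq1P; split => //.
  apply: (@le_lt_trans _ _ (\int[mu]_t (n.+1%:R * qnormsq (f t))%:E)%E); last first.
    by rewrite integral_scale_qnormsq// lte_mul_pinfty// qnorm2_ge0.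
  apply: ge0_le_integral => //.
  - by move=> t _; rewrite lee_fin qmod_ge0.
  - by apply/measurable_EFinP; exact: measurable_qmod.
  - by apply/measurable_EFinP; apply: measurable_funM => //; exact: measurable_qnormsq.
  move=> t _; rewrite lee_fin -sqr_qmod /truncate indicE.
  case: (boolP (t \in _)) => [|_]; last first.
    by rewrite scale0r qmod0 mulr_ge0 ?sqr_ge0.
  rewrite inE /= scale1r expr2 => h; rewrite mulrA ler_peMl ?qmod_ge0//.
  by rewrite -ler_pdivrMl// mulr1.
apply/Lq2P; split => //; apply: le_lt_trans foo; apply: ge0_le_integral => //.
- by move=> t _; rewrite lee_fin qnormsq_ge0.
- exact: measurable_EFin_qnormsq.
- exact: measurable_EFin_qnormsq.
by move=> t _; rewrite lee_fin; case: (truncate_case n f t) => [->//|[-> _]]; rewrite qnormsq0 qnormsq_ge0.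
Qed.

Lemma truncate_cvg f : Lq 2%:E f ->
  qnorm2 (fun t => truncate n f t - f t) @[n --> \oo] --> 0%E.
Proof.
move=> /Lq2P[mf foo].
have mq n : qmeasurable (fun t => truncate n f t - f t).
  by apply: qmeasurableB => //; exact: qmeasurable_truncate.
have [] := @dominated_convergence _ P R mu setT measurableT
    (fun n t => (qnormsq (truncate n f t - f t))%:E) (cst 0%E)
    (fun t => (qnormsq (f t))%:E).
- by move=> n; exact: measurable_EFin_qnormsq.
- by [].
- apply: nearW => t _; apply: cvg_near_cst.
  have [f0|f0] := eqVneq (qmod (f t)) 0.
    exists 0%N => // n _ /=; congr EFin.
    have : qnormsq (f t) = 0 by rewrite -sqr_qmod f0 expr0n.
    case: (truncate_case n f t) => [->|[-> _]]; first by rewrite subrr qnormsq0.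
    by rewrite sub0r qnormsqN.
  have fp : 0 < qmod (f t) by rewrite lt_neqAle eq_sym f0 qmod_ge0.
  have [N _ hN] := near_infty_natSinv_lt (PosNum fp).
  exists N => // n /= Nn; congr EFin.
  case: (truncate_case n f t) => [->|[_ h]]; first by rewrite subrr qnormsq0.
  by have := lt_trans h (hN n Nn); rewrite ltxx.
- apply/integrableP; split; first exact: measurable_EFin_qnormsq.
  apply: le_lt_trans foo; apply: ge0_le_integral => //.
  + by apply: measurableT_comp => //; exact: measurable_EFin_qnormsq.
  + exact: measurable_EFin_qnormsq.
  + by move=> t _; rewrite lee_fin ger0_norm// qnormsq_ge0.
- apply: nearW => t n _; rewrite /= lee_fin ger0_norm ?qnormsq_ge0//.
  case: (truncate_case n f t) => [->|[-> _]].
    by rewrite subrr qnormsq0 qnormsq_ge0.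
  by rewrite sub0r qnormsqN.
by move=> _ _; rewrite integral0.
Qed.

End L2_density.

Section QOLCT_extension.
Variable R : realType.
Implicit Types (f g : R * R -> quat R) (u t : R * R).
Variable M : 'I_2 -> olct_param R.
Hypothesis hb : forall k, ob (M k) != 0.

Lemma cvg0_geometric_bound (u : nat -> \bar R) :
  (forall n, 0 <= u n)%E -> (forall n, u n <= (8^-1 ^+ n)%:E)%E ->
  u n @[n --> \oo] --> 0%E.
Proof.
move=> u0 u8; apply: (squeeze_cvge (f := cst 0%E) (h := fun n => (8^-1 ^+ n)%:E)).
- by apply: nearW => n; rewrite u0 u8.
- exact: cvg_cst.
- apply: cvg_EFin; first exact: nearW.
  by apply: cvg_expr; rewrite ger0_norm ?invr_ge0// invf_lt1// ltr1n.
Qed.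

Lemma exists_le_of_cvg0 (u : nat -> \bar R) (e : R) : 0 < e ->
  u n @[n --> \oo] --> 0%E -> exists n, (u n <= e%:E)%E.
Proof.
move=> e0 /fine_cvgP[ufin /cvgrPdist_lt/(_ e e0) ue].
near \oo => n; exists n.
have fn : u n \is a fin_num by near: n.
rewrite -(fineK fn) lee_fin; apply: le_trans (ler_norm _) _; apply: ltW.
by rewrite -normrN -[- _]add0r; near: n.
Unshelve. all: by end_near. Qed.

(** By Plancherel's identity the transforms of a rapidly convergent sequence
    of truncations are a rapidly Cauchy sequence. *)
Lemma exists_QOLCT f : Lq 2%:E f -> exists F, is_QOLCT M f F.
Proof.
move=> Lf; have mf := (Lq2P f).1 Lf; case: mf => mf _.
(* The factor [1 / 4] pays for the constants 2 in [qnorm2B_le2]. *)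
have /choice[n_ hn] : forall k, exists n,
    (qnorm2 (fun t => truncate n f t - f t)%R <= (8^-1 ^+ k / 4)%:E)%E.
  move=> k; apply: (exists_le_of_cvg0 _ (truncate_cvg Lf)).
  by rewrite divr_gt0// exprn_gt0// invr_gt0.
pose g k := truncate (n_ k) f.
have Lg1 k : Lq 1%:E (g k) by case: (Lq12_truncate (n_ k) Lf).
have Lg2 k : Lq 2%:E (g k) by case: (Lq12_truncate (n_ k) Lf).
have mgf k : qmeasurable (fun t => g k t - f t).
  by apply: qmeasurableB => //; case: (Lg1 k).
have gg k m : (k <= m)%N -> (qnorm2 (fun t => g m t - g k t)%R <= (8^-1 ^+ k)%:E)%E.
  move=> km.
  rewrite (_ : (fun t => _) = (fun t => (g m t - f t) - (g k t - f t))); last first.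
    by apply/funext => t; rewrite opprB addrA subrK.
  apply: le_trans (qnorm2B_le2 (mgf m) (mgf k)) _.
  apply: (@le_trans _ _ (2%:E * (8^-1 ^+ m / 4)%:E + 2%:E * (8^-1 ^+ k / 4)%:E)%E).
    by apply: leeD; apply: lee_wpmul2l; rewrite ?lee_fin//; exact: hn.
  rewrite -!EFinM -EFinD lee_fin.
  have : 8^-1 ^+ m <= 8^-1 ^+ k :> R.
    by apply: ler_wiXn2l => //; rewrite ?invr_ge0// invf_le1// ler1n.
  lra.
pose G k := QOLCT1 M (g k).
have mG k : qmeasurable (G k) by exact: qmeasurable_QOLCT1.
have GG k m : (k <= m)%N -> (qnorm2 (fun t => G m t - G k t)%R <= (8^-1 ^+ k)%:E)%E.
  move=> km; have Lmk := Lq1B (Lg1 m) (Lg1 k).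
  rewrite (_ : (fun t => _) = QOLCT1 M (fun t => g m t - g k t)); last first.
    by apply/funext => u; rewrite QOLCT1_sub.
  by rewrite QOLCT1_plancherel//; [exact: gg|exact: Lq2B].
have [F mF hF] := L2_complete mG GG.
have LG0 : Lq 2%:E (G 0%N).
  apply/Lq2P; split => //; rewrite QOLCT1_plancherel//; by case: ((Lq2P _).1 (Lg2 0%N)).
have hF' n : (qnorm2 (fun t => G n t - F t)%R <= (8^-1 ^+ n)%:E)%E.
  by rewrite qnorm2_subC.
have LF : Lq 2%:E F.
  have LGF : Lq 2%:E (fun t => G 0%N t - F t).
    by apply/Lq2P; split; [exact: qmeasurableB|exact: le_lt_trans (hF' 0%N) (ltry _)].
  have := Lq2B LG0 LGF; congr Lq; apply/funext => t.
  by rewrite opprB addrCA subrr addr0.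
exists F; split => //; exists g; split => //.
- apply/cvg_qLnorm2; apply: cvg0_geometric_bound => n; first exact: qnorm2_ge0.
  apply: le_trans (hn n) _; rewrite lee_fin ler_pdivrMr// ler_peMr ?exprn_ge0//; last by rewrite ler1n.
- by apply/cvg_qLnorm2; apply: cvg0_geometric_bound => n; [exact: qnorm2_ge0|exact: hF'].
Qed.

Lemma is_QOLCT_QOLCT f : Lq 2%:E f -> is_QOLCT M f (QOLCT M f).
Proof. by move=> /exists_QOLCT[F hF]; exact: (xgetPex _ (ex_intro _ F hF)). Qed.

End QOLCT_extension.

(** * Translations and the spread of the transform *)

Section QOLCT_properties.
Variable R : realType.
Notation line := (measurableTypeR R).
Notation P := (line * line)%type.
Implicit Types (f g F : R * R -> quat R) (u t : R * R).

Lemma sin_norm_le (x : R) : `|sin x| <= `|x|.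
Proof.
have key (y : R) : 0 <= y -> `|sin y| <= y.
  move=> y0; have [|c _] := @MVT_segment R sin cos 0 y y0 (fun z _ => is_derive_sin z).
    by apply: continuous_subspaceT; exact: continuous_sin.
  rewrite sin0 !subr0 => ->; rewrite normrM (ger0_norm y0) ler_piMl//.
  exact: cos_max.
have [x0|x0] := leP 0 x; first by rewrite (ger0_norm x0) key.
have x1 : 0 <= - x by rewrite oppr_ge0 ltW.
by rewrite -normrN -sinN (ltr0_norm x0) key.
Qed.

(** [2 - 2 cos x] is the square of the chord [|exp (i x) - 1|]. *)
Lemma chord_le (x : R) : 0 <= 2 - 2 * cos x <= x ^+ 2.
Proof.
have h : 2 - 2 * cos x = (2 * sin (x / 2)) ^+ 2.
  have -> : cos x = cos ((x / 2) *+ 2) by congr cos; rewrite -mulr_natr; field.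
  rewrite cos_mulr2n exprMn sin2cos2; lra.
rewrite h sqr_ge0/= -[leLHS]real_normK ?num_real// -[leRHS]real_normK ?num_real//.
rewrite ler_sqr ?nnegrE// normrM (ger0_norm (ler0n R 2)).
have := sin_norm_le (x / 2); rewrite normrM (@ger0_norm _ 2^-1) ?invr_ge0//; lra.
Qed.

Variable M : 'I_2 -> olct_param R.
Hypothesis hb : forall k, ob (M k) != 0.

Lemma is_QOLCTP f F : qmeasurable f -> is_QOLCT M f F ->
  exists f_ : nat -> R * R -> quat R,
    [/\ forall n, Lq 1%:E (f_ n), forall n, Lq 2%:E (f_ n),
      qnorm2 (fun t => f_ n t - f t) @[n --> \oo] --> 0%E &
      qnorm2 (fun u => QOLCT1 M (f_ n) u - F u) @[n --> \oo] --> 0%E].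
Proof.
move=> mf [LF [f_ [Lf_ /cvg_qLnorm2 c1 /cvg_qLnorm2 c2]]].
by exists f_; split => // n; case: (Lf_ n).
Qed.

(** Plancherel's identity passes to the limit. *)
Lemma qnorm2_le_QOLCT f F : Lq 2%:E f -> is_QOLCT M f F -> (qnorm2 f <= qnorm2 F)%E.
Proof.
move=> [mf _] hF; have mF : qmeasurable F by case: hF => -[].
have [f_ [L1 L2 c1 c2]] := is_QOLCTP mf hF.
apply: (qnorm2_lim_le mf mF (fun n => (L1 n).1) _ c1 c2) => n.
  exact: qmeasurable_QOLCT1.
by rewrite QOLCT1_plancherel.
Qed.

Lemma qmeasurable_shift_coord k h f : qmeasurable f ->
  qmeasurable (fun t => f (shift_coord k h t)).
Proof.
move=> mf; rewrite /shift_coord; case: (k == ord0).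
  by have := qmeasurable_shift h 0 mf; congr qmeasurable; apply/funext => t; rewrite addr0.
by have := qmeasurable_shift 0 h mf; congr qmeasurable; apply/funext => t; rewrite addr0.
Qed.

Lemma qnorm2_shift_coord k h f : qmeasurable f ->
  qnorm2 (fun t => f (shift_coord k h t)) = qnorm2 f.
Proof.
move=> mf; rewrite /shift_coord; case: (k == ord0).
  rewrite -(qnorm2_shift h 0 mf); congr qnorm2; by apply/funext => t; rewrite addr0.
rewrite -(qnorm2_shift 0 h mf); congr qnorm2; by apply/funext => t; rewrite addr0.
Qed.

Lemma qnorm2Z_le (r : R * R -> R) (c : R) f : 0 <= c ->
  measurable_fun [set: P] (r : P -> R) -> qmeasurable f -> (forall u, r u ^+ 2 <= c) ->
  (qnorm2 (fun u => r u *: f u)%R <= c%:E * qnorm2 f)%E.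
Proof.
move=> c0 mr mf rc; rewrite -integral_scale_qnormsq//; apply: ge0_le_integral => //.
- by move=> t _; rewrite lee_fin qnormsq_ge0.
- by apply: measurable_EFin_qnormsq; exact: qmeasurableZ.
- by apply/measurable_EFinP; apply: measurable_funM => //; exact: measurable_qnormsq.
by move=> t _; rewrite lee_fin qnormsqZ ler_wpM2r// qnormsq_ge0.
Qed.

Lemma measurable_coord k : measurable_fun [set: P] (Defs.coord k : P -> R).
Proof.
rewrite /Defs.coord; case: (k == ord0); first exact: measurable_coord1.
exact: measurable_coord2.
Qed.

(** For integrable functions the left-hand side is the squared norm of the
    transform multiplied by a chord, which is at most its arc; both sides pass
    to the limit along an approximating sequence. *)
Lemma qnorm2_difference_le k h f F : Lq 2%:E f -> is_QOLCT M f F ->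
  (qnorm2 (fun t => chirp M f (shift_coord k h t) - chirp M f t)%R <=
   (((ob (M k))^-1 * h) ^+ 2)%:E * qnorm2 (fun u => Defs.coord k u *: F u)%R)%E.
Proof.
move=> [mf _] hF; have mF : qmeasurable F by case: hF => -[].
have [f_ [L1 L2 c1 c2]] := is_QOLCTP mf hF.
have mQ n : qmeasurable (QOLCT1 M (f_ n)) by exact: qmeasurable_QOLCT1.
pose th (u : R * R) := (ob (M k))^-1 * Defs.coord k u * h.
pose s (u : R * R) := Num.sqrt (2 - 2 * cos (th u)).
have th0 u : 0 <= 2 - 2 * cos (th u) by case/andP: (chord_le (th u)).
have s2 u : s u ^+ 2 = 2 - 2 * cos (th u) by rewrite sqr_sqrtr.
have mth : measurable_fun [set: P] (th : P -> R).
  apply: measurable_funM => //; apply: measurable_funM => //; exact: measurable_coord.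
have ms : measurable_fun [set: P] (s : P -> R).
  apply: (@measurableT_comp _ _ _ _ _ _ (@Num.sqrt R)).
    by apply: continuous_measurable_fun; exact: sqrt_continuous.
  apply: measurable_funB => //; apply: measurable_funM => //.
  exact: (measurableT_comp (measurable_trig false) mth).
pose D g t := chirp M g (shift_coord k h t) - chirp M g t.
have mD g : qmeasurable g -> qmeasurable (D g).
  move=> mg; have mc := qmeasurable_chirp M mg.
  by apply: qmeasurableB => //; exact: qmeasurable_shift_coord.
have nD g : qmeasurable g -> (qnorm2 (D g) <= 4%:E * qnorm2 g)%E.
  move=> mg; have mc := qmeasurable_chirp M mg.
  apply: le_trans (qnorm2B_le2 (qmeasurable_shift_coord k h mc) mc) _.
  rewrite qnorm2_shift_coord// -ge0_muleDl// -EFinD.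
  by rewrite qnorm2_chirp -natrD.
have to0 (x y : nat -> R * R -> quat R) : (forall n, qnorm2 (x n) <= 4%:E * qnorm2 (y n))%E ->
    qnorm2 (y n) @[n --> \oo] --> 0%E -> qnorm2 (x n) @[n --> \oo] --> 0%E.
  move=> xy cy; apply: (squeeze_cvge (f := cst 0%E) (h := fun n => 4%:E * qnorm2 (y n))%E).
  - by apply: nearW => n; rewrite qnorm2_ge0 xy.
  - exact: cvg_cst.
  - by rewrite -[X in _ --> X](mule0 4%:E); apply: cvgeZl.
apply: (@le_trans _ _ (qnorm2 (fun u => s u *: F u)%R)).
  apply: (@qnorm2_lim_le _ (D f) (fun u => s u *: F u) (fun n => D (f_ n))
    (fun n u => s u *: QOLCT1 M (f_ n) u)).
  - exact: mD.
  - exact: qmeasurableZ.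
  - by move=> n; apply: mD; exact: (L1 n).1.
  - by move=> n; exact: qmeasurableZ.
  - apply: to0 c1 => n.
    have mn : qmeasurable (fun t => f_ n t - f t) by exact: (qmeasurableB (L1 n).1 mf).
    apply: le_trans (nD _ mn).
    rewrite le_eqVlt; apply/orP; left; apply/eqP; congr qnorm2; apply/funext => t.
    by rewrite /D !chirp_sub; apply: quat_eqP => /=; ring.
  - apply: to0 c2 => n.
    rewrite (_ : (fun u => _) = (fun u => s u *: (QOLCT1 M (f_ n) u - F u))); last first.
      by apply/funext => u; rewrite scalerBr.
    apply: qnorm2Z_le => //; first exact: qmeasurableB.
    by move=> u; rewrite s2; have := cos_geN1 (th u); lra.
  - move=> n; rewrite qnorm2_shift_chirp// le_eqVlt; apply/orP; left; apply/eqP.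
    by apply: eq_integral => u _; rewrite qnormsqZ s2.
have mcF : qmeasurable (fun u => Defs.coord k u *: F u).
  by apply: qmeasurableZ => //; exact: measurable_coord.
rewrite -integral_scale_qnormsq ?sqr_ge0//; apply: ge0_le_integral => //.
- by move=> t _; rewrite lee_fin qnormsq_ge0.
- by apply: measurable_EFin_qnormsq; exact: qmeasurableZ.
- by apply/measurable_EFinP; apply: measurable_funM => //; exact: measurable_qnormsq.
move=> u _; rewrite lee_fin !qnormsqZ s2 mulrA -exprMn.
rewrite ler_wpM2r ?qnormsq_ge0//; case/andP: (chord_le (th u)) => _.
by rewrite /th mulrAC.
Qed.

End QOLCT_properties.

(** * The uncertainty inequality *)

Section uncertainty.
Variable R : realType.
Notation line := (measurableTypeR R).
Notation P := (line * line)%type.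
Notation mu := (@plane_lebesgue R).
Implicit Types (G : R * R -> quat R) (a b : quat R) (x y : P -> R) (c h : R) (t : R * R).
Notation itg x := (mu.-integrable [set: P] (EFin \o (x : P -> R))).

(** The difference of the two sides is a sum of two squares: the first absorbs
    the product [(a - b) (a + b)], the second the mixed terms of
    [(a + b) ^ 2]. *)
Lemma qnormsqB_weighted_le (s c : R) a b : 0 < c ->
  s * (qnormsq a - qnormsq b) <=
  (2 * c)^-1 * qnormsq (b - a) + c * (s ^+ 2 * (qnormsq a + qnormsq b)).
Proof.
move=> c0; rewrite -subr_ge0.
rewrite (_ : _ - _ = (2 * c)^-1 * qnormsq ((a - b) - (c * s) *: (a + b)) +
    c / 2 * (s ^+ 2 * qnormsq (a - b))).
  have c1 := ltW c0; have c2 : 0 <= (2 * c)^-1 by rewrite invr_ge0 mulr_ge0.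
  apply: addr_ge0; first exact: mulr_ge0 c2 (qnormsq_ge0 _).
  by apply: (mulr_ge0 (divr_ge0 c1 (ler0n R 2)) (mulr_ge0 (sqr_ge0 _) (qnormsq_ge0 _))).
by rewrite /qnormsq /=; field; exact: lt0r_neq0.
Qed.

Let itgD x y : itg x -> itg y -> itg (fun t => x t + y t).
Proof. by move=> ix iy; exact: (integrableD measurableT ix iy). Qed.

Let itgB x y : itg x -> itg y -> itg (fun t => x t - y t).
Proof. by move=> ix iy; exact: (integrableB measurableT ix iy). Qed.

Let itgZ c x : itg x -> itg (fun t => c * x t).
Proof. by move=> ix; exact: (integrableZl measurableT c ix). Qed.

Let itg_shift_coord k h x : itg x -> itg (fun t : P => x (shift_coord k h t)).
Proof.
move=> ix; rewrite /shift_coord; case: (k == ord0).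
  have := integrable_plane_shift h 0 ix; congr (_.-integrable _ _).
  by apply/funext => t; rewrite /= addr0.
have := integrable_plane_shift 0 h ix; congr (_.-integrable _ _).
by apply/funext => t; rewrite /= addr0.
Qed.

Let Rintegral_shift_coord k h x : itg x ->
  (\int[mu]_t x (shift_coord k h t) = \int[mu]_t x t)%R.
Proof.
move=> /integrableP[mx _]; congr fine.
rewrite -[RHS](integral_plane_shift (if k == ord0 then h else 0) (if k == ord0 then 0 else h) mx).
by apply: eq_integral => t _; rewrite /= /shift_coord; case: (k == ord0); rewrite /= addr0.
Qed.

Lemma coord_shift k h t : Defs.coord k (shift_coord k h t) = Defs.coord k t + h.
Proof. by rewrite /Defs.coord /shift_coord; case: (k == ord0). Qed.

Let itg_qnormsq G : qmeasurable G -> (qnorm2 G < +oo)%E -> itg (fun t => qnormsq (G t)).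
Proof.
move=> mG fG; apply/integrableP; split; first exact: measurable_EFin_qnormsq.
apply: le_lt_trans fG; apply: ge0_le_integral => //.
- by apply: measurableT_comp => //; exact: measurable_EFin_qnormsq.
- exact: measurable_EFin_qnormsq.
by move=> t _; rewrite lee_fin ger0_norm// qnormsq_ge0.
Qed.

(** Integrating by parts with the difference quotient of step [h]: the mass of
    [|G| ^ 2] is [h^-1] times the integral of
    [t_k (|G (t)| ^ 2 - |G (t + h e_k)| ^ 2)]. *)
Lemma difference_uncertainty k G (B c h : R) : qmeasurable G -> (qnorm2 G < +oo)%E ->
  (qnorm2 (fun t => Defs.coord k t *: G t)%R < +oo)%E ->
  0 < c -> 0 < h ->
  (qnorm2 (fun t => G (shift_coord k h t) - G t)%R <= (h ^+ 2 * B)%:E)%E ->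
  fine (qnorm2 G) <= B / (2 * c) + c * (2 * fine (qnorm2 (fun t => Defs.coord k t *: G t))
    - 2 * h * (\int[mu]_t (Defs.coord k t * qnormsq (G t)))%R + h ^+ 2 * fine (qnorm2 G)).
Proof.
move=> mG fG fT c0 h0 hB.
(* A weight proportional to [h] makes all the terms of order [h]. *)
have C0 := mulr_gt0 h0 c0; set C := h * c in C0.
set s := shift_coord k h; pose q (t : P) := qnormsq (G t).
pose w (t : P) := Defs.coord k t * q t.
pose v (t : P) := qnormsq (Defs.coord k t *: G t).
pose d (t : P) := qnormsq (G (s t) - G t).
have mk := @measurable_coord R k.
have iq : itg q by exact: itg_qnormsq.
have iv : itg v by apply: itg_qnormsq => //; exact: qmeasurableZ.
have id : itg d.
  apply: itg_qnormsq; first by apply: qmeasurableB => //; exact: qmeasurable_shift_coord.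
  by apply: le_lt_trans hB _; exact: ltry.
have iw : itg w.
  apply: (le_integrable measurableT _ _ (itgD iq iv)).
    by apply/measurable_EFinP; apply: measurable_funM => //; exact: measurable_qnormsq.
  move=> t _; rewrite lee_fin /= [leRHS](ger0_norm (addr_ge0 (qnormsq_ge0 _) (qnormsq_ge0 _))).
  rewrite /w /v qnormsqZ normrM (ger0_norm (qnormsq_ge0 _)) -/(q t) -[in leRHS]real_normK ?num_real//.
  rewrite -[X in X + _]mul1r -mulrDl ler_wpM2r ?qnormsq_ge0//.
  by have := sqr_ge0 (`|Defs.coord k t| - 1); rewrite sqrrB; have := normr_ge0 (Defs.coord k t); lra.
have iqs := itg_shift_coord k h iq; have iws := itg_shift_coord k h iw.
have ivs := itg_shift_coord k h iv; rewrite -/s in iqs iws ivs.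
pose N := (\int[mu]_t q t)%R; pose W := (\int[mu]_t w t)%R.
pose V := (\int[mu]_t v t)%R; pose A := (\int[mu]_t d t)%R.
have Eqs : (\int[mu]_t q (s t))%R = N by exact: Rintegral_shift_coord.
have Ews : (\int[mu]_t w (s t))%R = W by exact: Rintegral_shift_coord.
have Evs : (\int[mu]_t v (s t))%R = V by exact: Rintegral_shift_coord.
have iL1 := itgB iw iws; have iL2 := itgZ h iqs; have iL := itgD iL1 iL2.
have iB1 := itgD iv ivs; have iB2 := itgZ (2 * h) iws; have iB3 := itgZ (h ^+ 2) iqs.
have iB4 := itgB iB1 iB2; have iB5 := itgD iB4 iB3.
have iB6 := itgZ (2 * C)^-1 id; have iB7 := itgZ C iB5; have iB8 := itgD iB6 iB7.
have := le_Rintegral measurableT iL iB8.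
rewrite (RintegralD measurableT iL1 iL2) (RintegralB measurableT iw iws).
rewrite (RintegralD measurableT iB6 iB7) !RintegralZl//.
rewrite (RintegralD measurableT iB4 iB3) (RintegralB measurableT iB1 iB2).
rewrite (RintegralD measurableT iv ivs) !RintegralZl// Eqs Ews Evs -/N -/W -/V -/A.
rewrite subrr add0r => le_int.
have {}le_int : h * N <= (2 * C)^-1 * A + C * (V + V - 2 * h * W + h ^+ 2 * N).
  apply: le_int => t _; have := qnormsqB_weighted_le (Defs.coord k t) (G t) (G (s t)) C0.
  rewrite /d /w /v /q !qnormsqZ /s coord_shift -/s; congr (_ <= _); ring.
have AB : A <= h ^+ 2 * B.
  rewrite -lee_fin /A /Rintegral fineK//.
  by rewrite ge0_fin_numE ?(le_lt_trans hB _) ?ltry// qnorm2_ge0.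
change (N <= B / (2 * c) + c * (2 * V - 2 * h * W + h ^+ 2 * N)).
rewrite -(ler_pM2l h0); apply: le_trans le_int _.
set X := 2 * V - _ + _.
have -> : h * (B / (2 * c) + c * X) = (2 * C)^-1 * (h ^+ 2 * B) + C * X.
  by rewrite /C; field; rewrite !lt0r_neq0.
apply: lerD; first by apply: ler_wpM2l => //; rewrite invr_ge0 mulr_ge0// ltW.
by apply: (ler_wpM2l (ltW C0)); rewrite /X; lra.
Qed.

(** Letting the step tend to zero removes the terms of order [h], and the
    weight is then optimized, with [B + e] in place of [B] since [B] may
    vanish. *)
Lemma uncertainty k G (B : R) : qmeasurable G -> (qnorm2 G < +oo)%E ->
  (qnorm2 (fun t => Defs.coord k t *: G t)%R < +oo)%E -> 0 <= B ->
  (forall h, (0 < h)%R ->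
    qnorm2 (fun t => G (shift_coord k h t) - G t)%R <= (h ^+ 2 * B)%:E)%E ->
  fine (qnorm2 G) ^+ 2 <= 4 * B * fine (qnorm2 (fun t => Defs.coord k t *: G t)).
Proof.
move=> mG fG fT B0 hB.
have step c h (c0 : 0 < c) (h0 : 0 < h) := difference_uncertainty mG fG fT c0 h0 (hB h h0).
set N := fine (qnorm2 G) in step *; set T := fine (qnorm2 _) in step *.
set W := (\int[mu]_t _)%R in step.
have N0 : 0 <= N by rewrite fine_ge0// qnorm2_ge0.
have T0 : 0 <= T by rewrite fine_ge0// qnorm2_ge0.
have lim c : 0 < c -> N <= B / (2 * c) + 2 * c * T.
  move=> c0; apply/ler_addgt0Pr => e e0.
  pose K := c * (2 * `|W| + N).
  have K0 : 0 <= K by rewrite mulr_ge0 ?(ltW c0)// addr_ge0// mulr_ge0.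
  (* This step is at most 1 and makes the remainder [h * K] at most [e]. *)
  pose h := e / (K + e).
  have Ke : 0 < K + e by rewrite ltr_wpDl.
  have h0 : 0 < h by rewrite divr_gt0.
  have h1 : h <= 1 by rewrite ler_pdivrMr// mul1r lerDr.
  apply: le_trans (step c h c0 h0) _; rewrite -[leRHS]addrA lerD2l.
  have hK : h * K <= e by rewrite mulrAC ler_pdivrMr// ler_pM2l// lerDl ltW.
  apply: le_trans (_ : 2 * c * T + h * K <= _); last by rewrite lerD2l.
  rewrite (_ : 2 * c * T + h * K = c * (2 * T + 2 * (h * `|W|) + h * N)); last by rewrite /K; ring.
  rewrite ler_pM2l//.
  have hW : h * - W <= h * `|W| by rewrite ler_pM2l// ler_normr lexx orbT.
  have hN : h ^+ 2 * N <= h * N by rewrite ler_wpM2r// expr2 ler_piMl// ltW.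
  by move: hW hN; rewrite mulrN; lra.
have [->|Nn] := eqVneq N 0; first by rewrite expr0n !mulr_ge0.
have Np : 0 < N by rewrite lt_neqAle eq_sym Nn.
have eps (e : R) : 0 < e -> N ^+ 2 <= 4 * (B + e) * T.
  move=> e0; have Be : 0 < B + e by rewrite ltr_wpDl.
  (* The weight [(B + e) / N] makes the first term at most half of [N]. *)
  have := lim _ (divr_gt0 Be Np).
  have E1 : B / (2 * ((B + e) / N)) <= N / 2.
    rewrite (_ : B / _ = (B / (B + e)) * (N / 2)); last by field; rewrite Nn lt0r_neq0.
    by rewrite ler_piMl ?divr_ge0// ler_pdivrMr// mul1r lerDl ltW.
  move=> E2; have : N / 2 <= 2 * ((B + e) / N) * T by lra.
  rewrite -(ler_pM2r Np) (_ : 2 * ((B + e) / N) * T * N = 2 * (B + e) * T); last by field.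
  by rewrite expr2; lra.
apply/ler_addgt0Pr => e e0.
have T1 : 0 < 4 * T + 1 by rewrite ltr_wpDl// mulr_ge0.
apply: le_trans (eps (e / (4 * T + 1)) (divr_gt0 e0 T1)) _.
rewrite mulrDr mulrDl lerD2l (_ : _ * T = e * ((4 * T) / (4 * T + 1))); last by field; rewrite lt0r_neq0.
by rewrite ler_piMr ?ltW// ltr_pdivrMr// mul1r ltrDl.
Qed.

End uncertainty.

Section heisenberg.
Variable R : realType.
Notation line := (measurableTypeR R).
Notation P := (line * line)%type.
Notation mu := (@plane_lebesgue R).
Implicit Types (f F : R * R -> quat R) (u t : R * R).

Lemma ae_coord_neq0 k : {ae mu, forall t : P, Defs.coord k t != 0}.
Proof.
have m0 : measurable ([set 0] : set line) by exact: measurable_set1.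
have mZ : measurable ([set t | Defs.coord k t = 0] : set P).
  have := measurable_coord k measurableT m0; rewrite setTI.
  by congr measurable; apply/seteqP; split.
exists [set t | Defs.coord k t = 0]; split => //.
- rewrite /plane_lebesgue /Defs.coord; case: (k == ord0).
    rewrite (_ : [set t | _] = [set 0] `*` setT); last first.
      by apply/seteqP; split => [[x y] /= ->//|[x y] /= []].
    by rewrite /plane_measure product_measure1E//= lebesgue_measure_set1 mul0e.
  rewrite (_ : [set t | _] = setT `*` [set 0]); last first.
    by apply/seteqP; split => [[x y] /= ->//|[x y] /= []].
  by rewrite /plane_measure product_measure1E//= lebesgue_measure_set1 mule0.
- by move=> t /= /negP; rewrite negbK => /eqP.
Qed.

(** The line on which the coordinate vanishes is negligible. *)
Lemma qnorm2_coord_eq0 k f : qmeasurable f ->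
  qnorm2 (fun t => Defs.coord k t *: f t) = 0%E -> qnorm2 f = 0%E.
Proof.
move=> mf h; have mq := measurable_EFin_qnormsq mf.
have mc := measurable_EFin_qnormsq (qmeasurableZ (measurable_coord k) mf).
have /(ae_eq_integral_abs mu measurableT mc) hc : (\int[mu]_t `|(qnormsq (Defs.coord k t *: f t))%:E| = 0)%E.
  by rewrite -[RHS]h; apply: eq_integral => t _; rewrite gee0_abs// lee_fin qnormsq_ge0.
rewrite /qnorm2 (@ge0_ae_eq_integral _ _ _ mu setT _ (cst 0%E))//.
- by rewrite integral0.
- by move=> t _; rewrite lee_fin qnormsq_ge0.
apply: (@filterS2 _ _ (ae_filter_ringOfSetsType mu) _ _ _ _ (ae_coord_neq0 k) hc) => t c0 ct tT.
have /eqP := ct tT; rewrite eqe qnormsqZ mulf_eq0 sqrf_eq0 (negbTE c0) /= => /eqP e.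
by rewrite /cst /= e.
Qed.

Variable M : 'I_2 -> olct_param R.
Hypothesis hb : forall k, ob (M k) != 0.

(** A spread vanishes only if [f] does, by Plancherel's identity for the
    second one; so if [f] is not zero and a spread is infinite, the right-hand
    side is infinite. Otherwise the inequality is [uncertainty] for the chirped
    function. *)
Theorem QOLCT_uncertainty k f F : Lq 2%:E f -> is_QOLCT M f F ->
  ((`|ob (M k) / 2| ^+ 2)%:E * qnorm2 f ^+ 2 <=
   qnorm2 (fun t => Defs.coord k t *: f t) * qnorm2 (fun u => Defs.coord k u *: F u))%E.
Proof.
move=> Lf hF; have [mf fN] := (Lq2P f).1 Lf; have mF : qmeasurable F by case: hF => -[].
set T := qnorm2 (fun t => Defs.coord k t *: f t); set U := qnorm2 (fun u => Defs.coord k u *: F u).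
have T0 : (0 <= T)%E by exact: qnorm2_ge0.
have U0 : (0 <= U)%E by exact: qnorm2_ge0.
have f0le : qnorm2 f = 0%E -> ((`|ob (M k) / 2| ^+ 2)%:E * qnorm2 f ^+ 2 <= T * U)%E.
  by move=> ->; rewrite expe2 !mule0 mule_ge0.
have Tz : T = 0%E -> qnorm2 f = 0%E by exact: (@qnorm2_coord_eq0 k f mf).
have Uz : U = 0%E -> qnorm2 f = 0%E.
  move=> /(@qnorm2_coord_eq0 k F mF) F0; apply/eqP; rewrite eq_le qnorm2_ge0 andbT -F0.
  exact: (qnorm2_le_QOLCT hb Lf hF).
have [/f0le//|fn0] := eqVneq (qnorm2 f) 0%E.
have Tp : (0 < T)%E by rewrite lt_neqAle T0 andbT; apply/eqP => /esym/Tz/eqP; apply/negP.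
have Up : (0 < U)%E by rewrite lt_neqAle U0 andbT; apply/eqP => /esym/Uz/eqP; apply/negP.
have [Too|Tfin] := eqVneq T +oo%E; first by rewrite Too gt0_mulye// leey.
have [Uoo|Ufin] := eqVneq U +oo%E; first by rewrite Uoo gt0_muley// leey.
have chirpE (r : R * R -> R) :
    qnorm2 (fun t => r t *: chirp M f t) = qnorm2 (fun t => r t *: f t).
  by apply: eq_integral => t _; rewrite !qnormsqZ qnormsq_chirp.
have UE : U = (fine U)%:E by rewrite fineK// ge0_fin_numE// ltey.
have TE : T = (fine T)%:E by rewrite fineK// ge0_fin_numE// ltey.
have NE : qnorm2 f = (fine (qnorm2 f))%:E by rewrite fineK// ge0_fin_numE ?qnorm2_ge0.
set b := ob (M k); have b0 : b != 0 by exact: hb.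
have := @uncertainty _ k (chirp M f) (b^-1 ^+ 2 * fine U).
rewrite qnorm2_chirp chirpE -/T => /(_ (qmeasurable_chirp M mf) fN); rewrite ltey Tfin => /(_ isT).
have B0 : 0 <= b^-1 ^+ 2 * fine U by rewrite mulr_ge0 ?sqr_ge0 ?fine_ge0.
move=> /(_ B0) h.
have {}h : fine (qnorm2 f) ^+ 2 <= 4 * (b^-1 ^+ 2 * fine U) * fine T.
  apply: h => h h0; apply: le_trans (qnorm2_difference_le hb k h Lf hF) _.
  by rewrite -/U UE -EFinM lee_fin exprMn -/b /=; rewrite le_eqVlt; apply/orP; left;
    apply/eqP; ring.
rewrite UE TE NE expe2 -!EFinM lee_fin -expr2 real_normK ?num_real//.
apply: le_trans (ler_wpM2l (sqr_ge0 _) h) _.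
by rewrite le_eqVlt; apply/orP; left; apply/eqP; field.
Qed.

End heisenberg.

Theorem theorem7p6 (R : realType) (M : 'I_2 -> olct_param R)
    (hdet : forall k, oa (M k) * od (M k) - ob (M k) * oc (M k) = 1)
    (hb : forall k, ob (M k) != 0)
    (f : R * R -> quat R) (hf : Lq 2%:E f)
    (hD : forall k, Dop_in_L2 M k f) :
  (\prod_(k < 2) ((`|ob (M k) / 2| ^+ 2)%:E * qLnorm 2%:E f ^+ 4) <=
   \prod_(k < 2) (Delta_t k f * Delta_u M k f) ^+ 2)%E.
Proof.
have factor k : ((`|ob (M k) / 2| ^+ 2)%:E * qLnorm 2%:E f ^+ 4 <=
    (Delta_t k f * Delta_u M k f) ^+ 2)%E.
  have -> : (qLnorm 2%:E f ^+ 4 = qnorm2 f ^+ 2)%E.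
    by rewrite -sqr_qLnorm2 !expeS expe0 !mule1 !muleA.
  rewrite [leRHS]expe2 muleACA -!expe2 /Delta_t /Delta_u !sqr_qLnorm2.
  exact: (QOLCT_uncertainty hb k hf (is_QOLCT_QOLCT hb hf)).
have factor_ge0 k : (0 <= (`|ob (M k) / 2| ^+ 2)%:E * qLnorm 2%:E f ^+ 4)%E.
  by apply: mule_ge0; [rewrite lee_fin exprn_ge0|rewrite expe_ge0// Lnorm_ge0].
rewrite !big_ord_recl !big_ord0 !mule1; exact: lee_pmul.
Qed.
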